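(* Let $(X,d,f)$ be a topological dynamical system ($(X,d)$ compact metric, $f:X\to X$ continuous) which is topologically transitive and has the pseudo-orbit tracing property. If $\nu\in\mathscr M_{\rm inv}(X,f)$ and the entropy map $\mu\mapsto h_\mu(f)$ on $\mathscr M_{\rm inv}(X,f)$ is upper semi-continuous, then \[ \lim_{\delta\to0}h^B_{\rm top}(\Delta_{sub}(B(\nu,\delta)),f)=h_\nu(f). \]
   Context: $\mathscr M(X)$ is the set of Borel probability measures on $X$, $\mathscr M_{\rm inv}(X,f)$ the $f$-invariant ones, both with the weak* topology; $h_\mu(f)$ is measure-theoretic entropy. Fix a dense sequence $\{\varphi_i\}_{i\ge1}$ in $C(X)$ (sup norm) and define the metric $D(\mu,\nu)=\sum_{i\ge1}\frac{|\int\varphi_id\mu-\int\varphi_id\nu|}{2^{i+1}\|\varphi_i\|}$ on $\mathscr M(X)$; $B(\nu,\delta)=\{\mu\in\mathscr M(X):D(\nu,\mu)<\delta\}$. For $x\in X$, $\mathscr E_n(x)=\frac1n\sum_{i=0}^{n-1}\delta_{f^ix}$ and $V(x)$ is the set of weak* limit points of $(\mathscr E_n(x))_n$; for $I\subset\mathscr M(X)$, $\Delta_{sub}(I)=\{x:V(x)\subset I\}$. Topological transitivity: for all nonempty open $U,V\subset X$ some $n\in\mathbb N$ has $f^n(U)\cap V\ne\emptyset$. Pseudo-orbit tracing property: for every $\epsilon>0$ there is $\delta>0$ such that every sequence $(x_i)_{i\ge0}$ with $d(f(x_i),x_{i+1})\le\delta$ admits $x$ with $d(f^ix,x_i)<\epsilon$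 for all $i\ge 0$. Bowen topological entropy $h^B_{\rm top}(Z,f)$: with $d_n(x,y)=\max_{0\le i<n}d(f^ix,f^iy)$, $B_n(x,\epsilon)$ the open $d_n$-ball, $\Gamma_N(Z,\epsilon)$ the finite or countable covers of $Z$ by $B_n(x,\epsilon)$ with $n\ge N$, $m(Z,s,N,\epsilon)=\inf_{\mathcal C\in\Gamma_N(Z,\epsilon)}\sum_{B_n(x,\epsilon)\in\mathcal C}e^{-ns}$, $m(Z,s,\epsilon)=\lim_N m(Z,s,N,\epsilon)$, $h_{\rm top}(Z,\epsilon)=\inf\{s:m(Z,s,\epsilon)=0\}$, $h^B_{\rm top}(Z,f)=\lim_{\epsilon\to0}h_{\rm top}(Z,\epsilon)$. *)

(* Defs.v *)
From HB Require Import structures.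
From mathcomp Require Import all_boot all_order all_algebra.
From mathcomp Require Import all_classical all_reals all_analysis.
Set Implicit Arguments. Unset Strict Implicit. Unset Printing Implicit Defensive.
Import Order.TTheory GRing.Theory Num.Theory.
Import numFieldNormedType.Exports.
Local Open Scope classical_set_scope.
Local Open Scope ring_scope.

Section TDS.
Context {dm : measure_display} {X : measurableType dm} {R : realType}.
Variable (d : X -> X -> R).

Definition is_metric : Prop :=
  [/\ (forall x y, 0 <= d x y), (forall x y, d x y = 0 <-> x = y),
      (forall x y, d x y = d y x) & (forall x y z, d x z <= d x y + d y z)].

Definition d_open (U : set X) : Prop :=
  forall x, U x -> exists2 e : R, 0 < e & forall y, d x y < e -> U y.

Definition d_compact : Prop :=
  forall (I : Type) (U : I -> set X), (forall i, d_open (U i)) ->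
    (forall x, exists i, U i x) ->
    exists (n : nat) (g : 'I_n -> I), forall x, exists k, U (g k) x.

Definition borel_sets : Prop :=
  @measurable dm X = <<s d_open >>.

Definition d_cont (g : X -> X) : Prop :=
  forall x (e : R), 0 < e -> exists2 dl : R, 0 < dl &
    forall y, d x y < dl -> d (g x) (g y) < e.

Definition rcont (g : X -> R) : Prop :=
  forall x (e : R), 0 < e -> exists2 dl : R, 0 < dl &
    forall y, d x y < dl -> `|g x - g y| < e.

Definition supnorm (g : X -> R) : R := sup [set `|g x| | x in [set: X]].

Definition dense_seq (phi : nat -> X -> R) : Prop :=
  forall g, rcont g -> forall e : R, 0 < e ->
    exists2 i, (0 < i)%N & supnorm (fun x => g x - phi i x) < e.

Variable (f : X -> X).

Definition top_transitive : Prop :=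
  forall U V : set X, d_open U -> d_open V -> U !=set0 -> V !=set0 ->
    exists2 n : nat, (0 < n)%N & (iter n f @` U) `&` V !=set0.

Definition potp : Prop :=
  forall e : R, 0 < e -> exists2 dl : R, 0 < dl &
    forall xs : nat -> X, (forall i, d (f (xs i)) (xs i.+1) <= dl) ->
      exists x, forall i, d (iter i f x) (xs i) < e.

Definition Int (mu : {measure set X -> \bar R}) (g : X -> R) : R :=
  fine (\int[mu]_x (g x)%:E).

Definition Dmetric (phi : nat -> X -> R) (mu nu : probability X R) : R :=
  limn (fun n => \sum_(1 <= i < n)
    (`|Int mu (phi i) - Int nu (phi i)| / (2 ^+ i.+1 * supnorm (phi i)))).

Definition Ball (phi : nat -> X -> R) (nu : probability X R) (dl : R)
  : set (probability X R) := [set mu | Dmetric phi nu mu < dl].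

Lemma inv_natr_ge0 (n : nat) : (0 : R) <= n%:R^-1.
Proof. by rewrite invr_ge0 ler0n. Qed.

Definition emp (n : nat) (x : X) : {measure set X -> \bar R} :=
  mscale (NngNum (inv_natr_ge0 n)) (msum (fun i => \d_(iter i f x)) n).

(* mu is a weak* limit point of (E_n(x))_n : every basic weak* neighbourhood
   of mu contains E_n(x) for infinitely many n >= 1 *)
Definition Vpts (x : X) : set (probability X R) :=
  [set mu | forall (k : nat) (gs : 'I_k -> X -> R), (forall j, rcont (gs j)) ->
     forall e : R, 0 < e -> forall N : nat, exists n : nat,
       [/\ (N <= n)%N, (0 < n)%N &
           forall j, `|Int (emp n x) (gs j) - Int mu (gs j)| < e]].

Definition Delta_sub (I : set (probability X R)) : set X :=
  [set x | Vpts x `<=` I].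

Definition f_invariant (mu : probability X R) : Prop :=
  forall A, measurable A -> mu (f @^-1` A) = mu A.

Definition meas_partition (s : seq (set X)) : Prop :=
  [/\ (forall A, A \in s -> measurable A),
      (forall i j, (i < size s)%N -> (j < size s)%N -> i != j ->
         nth set0 s i `&` nth set0 s j = set0) &
      (forall x, exists2 i, (i < size s)%N & nth set0 s i x)].

Definition Hjoin (mu : probability X R) (s : seq (set X)) (n : nat) : R :=
  \sum_(w : {ffun 'I_n -> 'I_(size s)})
     (let t := fine (mu [set x | forall i : 'I_n, nth set0 s (w i) (iter i f x)])
      in - (t * ln t)).

Definition h_part (mu : probability X R) (s : seq (set X)) : R :=
  limn (fun n => Hjoin mu s n / n%:R).

Definition h_mu (mu : probability X R) : \bar R :=
  ereal_sup [set (h_part mu s)%:E | s in meas_partition].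

Definition usc_entropy : Prop :=
  forall mu : probability X R, f_invariant mu -> forall c : R, (h_mu mu < c%:E)%E ->
    exists (k : nat) (gs : 'I_k -> X -> R), (forall j, rcont (gs j)) /\
      exists2 e : R, 0 < e & forall nu : probability X R, f_invariant nu ->
        (forall j, `|Int nu (gs j) - Int mu (gs j)| < e) -> (h_mu nu < c%:E)%E.

Definition dn (n : nat) (x y : X) : R :=
  \big[Num.max/0]_(i < n) d (iter i f x) (iter i f y).

Definition Bn (n : nat) (x : X) (e : R) : set X := [set y | dn n x y < e].

(* Gamma_N(Z,eps): finite or countable families of Bowen balls B_n(x,eps),
   n >= N, covering Z (a ball B_n(x,eps) is represented by the pair (x,n)) *)
Definition Gamma (Z : set X) (N : nat) (e : R) : set (set (X * nat)) :=
  [set C | [/\ countable C, (forall p, C p -> (N <= p.2)%N) &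
            Z `<=` \bigcup_(p in C) Bn p.2 p.1 e]].

Definition mZN (Z : set X) (s : R) (N : nat) (e : R) : \bar R :=
  ereal_inf [set (\esum_(p in C) (expR (- (p.2%:R * s)))%:E)%E | C in Gamma Z N e].

Definition mZ (Z : set X) (s : R) (e : R) : \bar R := limn (fun N => mZN Z s N e).

Definition htopZ (Z : set X) (e : R) : \bar R :=
  ereal_inf [set s%:E | s in [set s : R | mZ Z s e = 0%E]].

Definition hB (Z : set X) : \bar R := lim (htopZ Z e @[e --> 0^'+]).

End TDS.

(* Main.v *)
(**
Write [Delta] for the set of points whose limit measures all lie in the [delta]-ball around [nu].

Upper bound. By upper semicontinuity the invariant measures close to [nu] have entropy below [c]
when [h_nu < c]. For such a [mu], a partition with [mu]-null boundary and a block length [m] with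
[H_m / m < c], the logarithm of the smoothed distribution of [m]-blocks has a continuous minorant
[g] with [int g dmu > - m c]. If the empirical average of [g] at [x] up to time [n] is large, then
one of the [m] ways of cutting the orbit of [x] into [m]-blocks has likelihood at least
[exp (- n c)] up to a constant; likelihoods sum to 1, so such points are covered by
[C exp (n c)] Bowen balls. The function [g] may be taken in the given dense sequence, so countably
many such conditions cover [Delta], because every point has a limit measure (an ultrafilter limit
of empirical averages, represented by the Riesz theorem), necessarily invariant.

Lower bound. Let [c < H(nu, xi)] for a partition [xi]. Tuples of [M] independent words of length [n]
with law given by [nu] are typical with probability at least 1/2, for the tests defining the ball,
for the information and for the frequency of visits outside separated closed cores of the atoms
(Chebyshev). Orbits which stay close have words that are close in Hamming distance, and Hamming
balls have small mass, so there are about [exp (c n M)] separated typical tuples, all with the same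
initial and final cells. Transitivity connects the words by transitions depending on the cells
only, so all the concatenations have the same time pattern; shadowing turns an infinite
concatenation of tuples into a point of [Delta]. A cover of the resulting tree of orbits by Bowen
balls obeys a Kraft-type inequality, whence the entropy of [Delta] is at least [c].
*)
Require Import Defs.
From HB Require Import structures.
From mathcomp Require Import all_boot all_order all_algebra.
From mathcomp Require Import all_classical all_reals all_analysis.
From mathcomp Require Import measurable_realfun ring lra zify.
Set Implicit Arguments. Unset Strict Implicit. Unset Printing Implicit Defensive.
Import Order.TTheory GRing.Theory Num.Theory.
Import numFieldNormedType.Exports.
Local Open Scope classical_set_scope.
Local Open Scope ring_scope.

(** * Continuous functions on a compact metric space *)

(** [nu] is an arbitrary invariant measure, so neither Birkhoff averages nor the information of long
    words need be nearly constant along [nu]-typical orbits. Independent sampling restores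
    concentration: words drawn from the law of [nu] obey the weak law of large numbers whatever the
    ergodic decomposition, and the mean information per letter is the entropy of words over their
    length. The price is that consecutive words share no orbit and have to be joined; words are made
    so long that transitions of bounded length neither disturb the averages nor dilute the growth
    rate. A common time pattern is wanted because two shadowing points are told apart by running
    through different words at the same moment. The same tuples serve at every level of the tree,
    since limit measures have to fall into the ball, not to equal [nu]. In the upper bound a point
    may have many limit measures; a single one suffices, because a Bowen cover may use, for each
    point, any of the infinitely many lengths at which its empirical measure is near that limit. *)

Section Basic.
Context {dm : measure_display} {X : measurableType dm} {R : realType}.
Variable d : X -> X -> R.
Hypothesis dP : is_metric d.
Hypothesis dB : borel_sets d.
Hypothesis dK : d_compact d.

Lemma d_ge0 x y : 0 <= d x y. Proof. by case: dP. Qed.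
Lemma d_refl x : d x x = 0. Proof. by case: dP => _ h _ _; apply/h. Qed.
Lemma d_sym x y : d x y = d y x. Proof. by case: dP. Qed.
Lemma d_tri x y z : d x z <= d x y + d y z. Proof. by case: dP. Qed.

Lemma d_open_measurable (U : set X) : d_open d U -> measurable U.
Proof. by move=> oU; rewrite dB; exact: sub_sigma_algebra. Qed.

Lemma d_open_ball x (r : R) : d_open d [set y | d x y < r].
Proof.
move=> y /= xy; exists (r - d x y); first by rewrite subr_gt0.
by move=> z yz /=; apply: (le_lt_trans (d_tri x y z)); lra.
Qed.

Lemma d_openC_closed_ball x (r : R) : d_open d [set y | r < d x y].
Proof.
move=> y /= xy; exists (d x y - r); first by rewrite subr_gt0.
by move=> z yz /=; have := d_tri x z y; rewrite (d_sym z y); lra.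
Qed.

Lemma d_openI U V : d_open d U -> d_open d V -> d_open d (U `&` V).
Proof.
move=> oU oV x [/oU[e e0 he] /oV[e' e'0 he']].
exists (Num.min e e'); first by rewrite lt_min e0.
by move=> y; rewrite lt_min => /andP[? ?]; split; [apply: he|apply: he'].
Qed.

Lemma d_openT : d_open d setT.
Proof. by move=> x _; exists 1. Qed.

Lemma d_open_bigcup (I : Type) (P : set I) (F : I -> set X) :
  (forall i, P i -> d_open d (F i)) -> d_open d (\bigcup_(i in P) F i).
Proof.
by move=> h x [i Pi /(h i Pi)[e e0 he]]; exists e => // y /he ?; exists i.
Qed.

Lemma d_open_forall (I : finType) (F : I -> set X) :
  (forall i, d_open d (F i)) -> d_open d [set x | forall i, F i x].
Proof.
move=> h x /= hx.
have /choice[e he] : forall i, exists e : R, 0 < e /\ forall y, d x y < e -> F i y.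
  by move=> i; have [e e0 ?] := h i x (hx i); exists e.
exists (\big[Num.min/1]_i e i).
  by apply: lt_bigmin => // i _; case: (he i).
by move=> y hy i; case: (he i) => _; apply; apply: (lt_le_trans hy); exact: bigmin_le.
Qed.

Lemma d_open_preimage (g : X -> X) U : d_cont d g -> d_open d U -> d_open d (g @^-1` U).
Proof.
move=> cg oU x /= /oU[e e0 he]; have [dl dl0 h] := cg x e e0.
by exists dl => // y /h /he.
Qed.

Lemma d_cont_iter (g : X -> X) n : d_cont d g -> d_cont d (iter n g).
Proof.
move=> cg; elim: n => [|n IH] x e e0; first by exists e.
have [e1 e10 h1] := cg (iter n g x) e e0.
have [e2 e20 h2] := IH x e1 e10.
by exists e2 => // y /h2 /h1.
Qed.

Lemma d_cont_measurable (g : X -> X) : d_cont d g -> measurable_fun setT g.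
Proof.
move=> cg; apply: (measurability (d_open d) dB) => _ [U oU <-].
by rewrite setTI; apply: d_open_measurable; exact: d_open_preimage.
Qed.

Lemma rcont_openr (g : X -> R) a : rcont d g -> d_open d [set x | a < g x].
Proof.
move=> cg x /= ax; have [|dl dl0 h] := cg x (g x - a); first by rewrite subr_gt0.
by exists dl => // y /h; rewrite ltr_norml => /andP[_]; lra.
Qed.

Lemma rcont_openl (g : X -> R) a : rcont d g -> d_open d [set x | g x < a].
Proof.
move=> cg x /= ax; have [|dl dl0 h] := cg x (a - g x); first by rewrite subr_gt0.
by exists dl => // y /h; rewrite ltr_norml => /andP[]; lra.
Qed.

Lemma rcont_measurable (g : X -> R) : rcont d g -> measurable_fun setT g.
Proof.
move=> cg; apply: (measurability _ (@RGenOInfty.measurableE R)) => _ [_ [a ->] <-].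
rewrite setTI; apply: d_open_measurable.
have -> : g @^-1` `]a, +oo[%classic = [set x | a < g x].
  by apply/seteqP; split => x /=; rewrite in_itv /= andbT.
exact: rcont_openr.
Qed.

Lemma ball_cover (r : X -> R) : (forall x, 0 < r x) ->
  exists (n : nat) (c : 'I_n -> X), forall x, exists k, d (c k) x < r (c k).
Proof.
move=> r0; apply: (@dK X (fun c => [set x | d c x < r c])).
  by move=> c; exact: d_open_ball.
by move=> x; exists x => /=; rewrite d_refl.
Qed.

Lemma rcont_bounded (g : X -> R) : rcont d g -> exists2 B : R, 0 < B & forall x, `|g x| <= B.
Proof.
move=> cg.
have /choice[r hr] : forall x, exists r : R, 0 < r /\ forall y, d x y < r -> `|g x - g y| < 1.
  by move=> x; have [r r0 h] := cg x 1 ltr01; exists r.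
have [n [c hc]] := @ball_cover r (fun x => (hr x).1).
exists (1 + \sum_k `|g (c k)|).
  by apply: ltr_wpDr => //; apply: sumr_ge0.
move=> x; have [k /(hr _).2 hk] := hc x.
have : `|g x| <= `|g (c k) - g x| + `|g (c k)|.
  by rewrite distrC -{1}(subrK (g (c k)) (g x)) ler_normD.
move=> /le_trans; apply; apply: lerD; first exact: ltW.
by rewrite (bigD1 k) //= lerDl sumr_ge0.
Qed.

(** Lebesgue number argument: balls of radius [r] cover, while the oscillation is controlled on the
    balls of twice the radius. *)
Lemma rcont_unif (g : X -> R) (e : R) : rcont d g -> 0 < e ->
  exists2 r : R, 0 < r & forall x y, d x y < r -> `|g x - g y| < e.
Proof.
move=> cg e0.
have /choice[r hr] : forall x, exists r : R, 0 < r /\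
    forall y, d x y < r *+ 2 -> `|g x - g y| < e / 2.
  move=> x; have [|r r0 h] := cg x (e / 2); first by rewrite divr_gt0.
  exists (r / 2); split; first by rewrite divr_gt0.
  by move=> y; rewrite mulr2n -splitr => /h.
have [n [c hc]] := @ball_cover r (fun x => (hr x).1).
exists (\big[Num.min/1]_k r (c k)).
  by apply: lt_bigmin => // i _; case: (hr (c i)).
move=> x y hxy; have [k hk] := hc x.
have dxy : d x y < r (c k) by apply: (lt_le_trans hxy); exact: bigmin_le.
have hx : `|g (c k) - g x| < e / 2.
  by apply: (hr (c k)).2; apply: (lt_le_trans hk); rewrite mulr2n lerDl ltW// (hr _).1.
have hy : `|g (c k) - g y| < e / 2.
  by apply: (hr (c k)).2; apply: (le_lt_trans (d_tri _ x _)); rewrite mulr2n ltrD.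
rewrite (_ : g x - g y = (g (c k) - g y) - (g (c k) - g x)); last by ring.
by apply: (le_lt_trans (ler_normB _ _)); lra.
Qed.

Lemma rcont_cst (a : R) : rcont d (fun=> a).
Proof. by move=> x e e0; exists 1 => // y _; rewrite subrr normr0. Qed.

Lemma rcontD (g h : X -> R) : rcont d g -> rcont d h -> rcont d (fun x => g x + h x).
Proof.
move=> cg ch x e e0; have e20 : 0 < e / 2 by rewrite divr_gt0.
have [r r0 hr] := cg x _ e20; have [s s0 hs] := ch x _ e20.
exists (Num.min r s); first by rewrite lt_min r0.
move=> y; rewrite lt_min => /andP[/hr hy /hs hy'].
rewrite (_ : _ - _ = (g x - g y) + (h x - h y)); last by ring.
by apply: (le_lt_trans (ler_normD _ _)); lra.
Qed.

Lemma rcontZ (a : R) (g : X -> R) : rcont d g -> rcont d (fun x => a * g x).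
Proof.
move=> cg x e e0.
have a0 : 0 < `|a| + 1 by apply: ltr_wpDl.
have [|r r0 hr] := cg x (e / (`|a| + 1)); first by rewrite divr_gt0.
exists r => // y /hr; rewrite ltr_pdivlMr// => hy.
rewrite -mulrBr normrM; apply: le_lt_trans hy.
by rewrite mulrC ler_wpM2l// lerDl.
Qed.

Lemma rcontN (g : X -> R) : rcont d g -> rcont d (fun x => - g x).
Proof.
move=> cg x e /(cg x)[r r0 hr]; exists r => // y /hr.
by rewrite -opprD normrN.
Qed.

Lemma rcontB (g h : X -> R) : rcont d g -> rcont d h -> rcont d (fun x => g x - h x).
Proof. by move=> cg ch; apply: rcontD => //; exact: rcontN. Qed.

Lemma rcont_sum (I : Type) (s : seq I) (P : pred I) (F : I -> X -> R) :
  (forall i, rcont d (F i)) -> rcont d (fun x => \sum_(i <- s | P i) F i x).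
Proof.
move=> h; elim: s => [|i s IH].
  by under eq_fun do rewrite big_nil; exact: rcont_cst.
under eq_fun do rewrite big_cons.
by case: (P i) => //; exact: rcontD.
Qed.

Lemma rcont_contraction (F : R -> R) (g : X -> R) :
  (forall a b, `|F a - F b| <= `|a - b|) -> rcont d g -> rcont d (F \o g).
Proof.
move=> hF cg x e /(cg x)[r r0 hr]; exists r => // y /hr.
exact: le_lt_trans (hF _ _).
Qed.

Lemma max_contraction (m a b : R) : `|Num.max a m - Num.max b m| <= `|a - b|.
Proof. by rewrite ler_norml; case: (leP a m) => ?; case: (leP b m) => ?; case: (ler0P (a-b)) => ?; apply/andP; split; lra. Qed.

Lemma min_contraction (m a b : R) : `|Num.min a m - Num.min b m| <= `|a - b|.
Proof. by rewrite ler_norml; case: (leP a m) => ?; case: (leP b m) => ?; case: (ler0P (a-b)) => ?; apply/andP; split; lra. Qed.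

Lemma rcont_max (m : R) (g : X -> R) : rcont d g -> rcont d (fun x => Num.max (g x) m).
Proof. exact: (rcont_contraction (max_contraction m)). Qed.

Lemma rcont_min (m : R) (g : X -> R) : rcont d g -> rcont d (fun x => Num.min (g x) m).
Proof. exact: (rcont_contraction (min_contraction m)). Qed.

Lemma rcont_comp (g : X -> R) (h : X -> X) : rcont d g -> d_cont d h -> rcont d (g \o h).
Proof.
move=> cg ch x e /(cg (h x))[r r0 hr]; have [s s0 hs] := ch x r r0.
by exists s => // y /hs /hr.
Qed.

(* Truncated at 1, so that the infimum is over a nonempty set even when [U] is the whole space. *)
Definition dist_out (U : set X) (x : X) : R :=
  inf ([set d x a | a in ~` U] `|` [set 1]).

Lemma dist_out_has_inf U x : has_inf ([set d x a | a in ~` U] `|` [set 1]).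
Proof.
split; first by exists 1; right.
by exists 0 => _ [[a _ <-]|->//]; exact: d_ge0.
Qed.

Lemma dist_out_ge0 U x : 0 <= dist_out U x.
Proof. by apply: lb_le_inf => [|_ [[a _ <-]|->//]]; [exists 1; right|exact: d_ge0]. Qed.

Lemma dist_out_notin (U : set X) x : ~ U x -> dist_out U x = 0.
Proof.
move=> nU; apply/eqP; rewrite eq_le dist_out_ge0 andbT.
by apply: ge_inf; [case: (dist_out_has_inf U x)|left; exists x => //; rewrite d_refl].
Qed.

Lemma dist_out_gt0 (U : set X) x : d_open d U -> U x -> 0 < dist_out U x.
Proof.
move=> oU /oU[e e0 he]; apply: (@lt_le_trans _ _ (Num.min e 1)).
  by rewrite lt_min e0 ltr01.
apply: lb_le_inf => [|_ [[a na <-]|->]]; first by exists 1; right.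
  rewrite ge_min leNgt; apply/orP; left; apply/negP => /he.
  exact: na.
by rewrite ge_min lexx orbT.
Qed.

Lemma dist_out_lip U x y : dist_out U x <= dist_out U y + d x y.
Proof.
rewrite -lerBlDr; apply: lb_le_inf => [|_ [[a na <-]|->]]; first by exists 1; right.
  rewrite lerBlDr; apply: (@le_trans _ _ (d x a)).
    by apply: ge_inf; [case: (dist_out_has_inf U x)|left; exists a].
  by rewrite addrC; exact: d_tri.
apply: (@le_trans _ _ (dist_out U x)); first by rewrite lerBlDr lerDl d_ge0.
by apply: ge_inf; [case: (dist_out_has_inf U x)|right].
Qed.

Lemma rcont_dist_out U : rcont d (dist_out U).
Proof.
move=> x e e0; exists e => // y xy; apply: le_lt_trans xy.
rewrite ler_norml; have := dist_out_lip U x y; have := dist_out_lip U y x.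
by rewrite (d_sym y x); lra.
Qed.

(** For open [U] these continuous functions increase with [k] to the indicator of [U]; through them
    statements about continuous tests reach open sets. *)
Definition bump (U : set X) (k : nat) (x : X) : R := Num.min (k%:R * dist_out U x) 1.

Lemma rcont_bump U k : rcont d (bump U k).
Proof. by apply: rcont_min; apply: rcontZ; exact: rcont_dist_out. Qed.

Lemma bump_ge0 U k x : 0 <= bump U k x.
Proof. by rewrite le_min ler01 mulr_ge0// dist_out_ge0. Qed.

Lemma bump_le1 U k x : bump U k x <= 1.
Proof. by rewrite ge_min lexx orbT. Qed.

Lemma bump_notin (U : set X) k x : ~ U x -> bump U k x = 0.
Proof. by move=> /dist_out_notin; rewrite /bump => ->; rewrite mulr0 min_l. Qed.

Lemma bump_le_indic (U : set X) k x : bump U k x <= \1_U x.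
Proof.
have [Ux|nUx] := pselect (U x).
  by rewrite indicE mem_set// bump_le1.
by rewrite bump_notin// indicE memNset.
Qed.

Lemma bump_nd (U : set X) k l x : (k <= l)%N -> bump U k x <= bump U l x.
Proof.
move=> kl; rewrite /bump le_min !ge_min lexx orbT andbT; apply/orP; left.
by rewrite ler_wpM2r ?dist_out_ge0// ler_nat.
Qed.

Lemma bump_eq1 (U : set X) x : d_open d U -> U x -> exists k, forall l, (k <= l)%N -> bump U l x = 1.
Proof.
move=> oU Ux; have d0 := dist_out_gt0 oU Ux.
exists (Num.truncn (dist_out U x)^-1).+1 => l kl.
apply/min_r; rewrite -ler_pdivrMr// div1r.
apply: le_trans (ltW (truncnS_gt _)) _; by rewrite ler_nat.
Qed.

End Basic.

(** * Integrals and uniqueness of measures *)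

Section Integrals.
Context {dm : measure_display} {X : measurableType dm} {R : realType}.
Implicit Types mu : probability X R.

(** The class on which [Int] is used as a linear functional: [Int] is total, being [fine] of an
    integral, and its linearity rests on integrability, which boundedness gives for finite
    measures. *)
Definition bmeas (g : X -> R) := measurable_fun setT g /\ exists B : R, forall x, `|g x| <= B.

Lemma bmeas_integrable (mu : {measure set X -> \bar R}) (g : X -> R) :
  (mu setT < +oo)%E -> bmeas g -> mu.-integrable setT (EFin \o g).
Proof.
move=> fin [mg [B hB]]; apply: measurable_bounded_integrable => //.
exists B; split; first exact: num_real.
by move=> M BM x _ /=; apply: (le_trans (hB x)); exact: ltW.
Qed.

Lemma prob_fin mu : (mu setT < +oo)%E.
Proof. by rewrite probability_setT ltry. Qed.
Hint Resolve prob_fin : core.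

Lemma bmeas_cst (a : R) : bmeas (fun=> a).
Proof. by split; [exact: measurable_cst|exists `|a|]. Qed.

Lemma bmeasD g h : bmeas g -> bmeas h -> bmeas (fun x => g x + h x).
Proof.
move=> [mg [A hA]] [mh [B hB]]; split; first exact: measurable_funD.
by exists (A + B) => x; apply: (le_trans (ler_normD _ _)); exact: lerD.
Qed.

Lemma bmeasZ (a : R) g : bmeas g -> bmeas (fun x => a * g x).
Proof.
move=> [mg [A hA]]; split; first by apply: measurable_funM => //; exact: measurable_cst.
by exists (`|a| * A) => x; rewrite normrM ler_wpM2l.
Qed.

Lemma bmeas_sum (I : Type) (s : seq I) (P : pred I) (F : I -> X -> R) :
  (forall i, bmeas (F i)) -> bmeas (fun x => \sum_(i <- s | P i) F i x).
Proof.
move=> h; elim: s => [|i s IH].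
  by under eq_fun do rewrite big_nil; exact: bmeas_cst.
under eq_fun do rewrite big_cons.
by case: (P i) => //; exact: bmeasD.
Qed.

Lemma bmeas_indic (A : set X) : measurable A -> bmeas (\1_A : X -> R).
Proof.
move=> mA; split; first exact: measurable_indic.
by exists 1 => x; rewrite indicE; case: (_ \in _); rewrite ?normr1 ?normr0.
Qed.

Lemma bmeas_comp (g : X -> R) (h : X -> X) : measurable_fun setT h -> bmeas g -> bmeas (g \o h).
Proof.
move=> mh [mg [B hB]]; split; first exact: measurableT_comp.
by exists B => x; exact: hB.
Qed.

Lemma IntE (mu : {measure set X -> \bar R}) g : Int mu g = \int[mu]_x g x.
Proof. by []. Qed.

Lemma IntD mu g h : bmeas g -> bmeas h -> Int mu (fun x => g x + h x) = Int mu g + Int mu h.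
Proof. by move=> bg bh; rewrite !IntE RintegralD//; apply: bmeas_integrable => //; exact: prob_fin. Qed.

Lemma IntZ mu (a : R) g : bmeas g -> Int mu (fun x => a * g x) = a * Int mu g.
Proof. by move=> bg; rewrite !IntE RintegralZl//; apply: bmeas_integrable => //; exact: prob_fin. Qed.

Lemma Int_cst mu (a : R) : Int mu (fun=> a) = a.
Proof. by rewrite IntE Rintegral_cst//= ?probability_setT ?mulr1. Qed.

Lemma IntB mu g h : bmeas g -> bmeas h -> Int mu (fun x => g x - h x) = Int mu g - Int mu h.
Proof. by move=> bg bh; rewrite !IntE RintegralB//; apply: bmeas_integrable => //; exact: prob_fin. Qed.

Lemma Int_sum mu (I : Type) (s : seq I) (P : pred I) (F : I -> X -> R) :
  (forall i, bmeas (F i)) ->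
  Int mu (fun x => \sum_(i <- s | P i) F i x) = \sum_(i <- s | P i) Int mu (F i).
Proof.
move=> h; elim: s => [|i s IH].
  by rewrite big_nil; under eq_fun do rewrite big_nil; exact: Int_cst.
rewrite big_cons; under eq_fun do rewrite big_cons.
case: (P i) => //; rewrite IntD// ?IH//; exact: bmeas_sum.
Qed.

Lemma Int_le mu g h : bmeas g -> bmeas h -> (forall x, g x <= h x) -> Int mu g <= Int mu h.
Proof. by move=> bg bh gh; rewrite !IntE le_Rintegral//; apply: bmeas_integrable => //; exact: prob_fin. Qed.

Lemma Int_indic mu (A : set X) : measurable A -> Int mu \1_A = fine (mu A).
Proof. by move=> mA; rewrite /Int integral_indic// setIT. Qed.

Lemma Int_dist_le mu g h (e : R) : bmeas g -> bmeas h -> (forall x, `|g x - h x| <= e) ->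
  `|Int mu g - Int mu h| <= e.
Proof.
move=> bg bh gh; rewrite -IntB// ler_norml.
have bgh : bmeas (fun x => g x - h x).
  have -> : (fun x => g x - h x) = (fun x => g x + (-1) * h x).
    by apply/funext => x; rewrite mulN1r.
  by apply: bmeasD => //; exact: bmeasZ.
have bc (a : R) : bmeas (fun=> a : R) by exact: bmeas_cst.
rewrite -[X in X <= _ <= _](Int_cst mu (- e)) -[X in _ <= _ <= X](Int_cst mu e).
apply/andP; split; apply: Int_le => //.
all: by move=> x; have := gh x; rewrite ler_norml => /andP[].
Qed.

Lemma Int_fin mu (Q : finType) (tau : X -> Q) (a : Q -> R) :
  (forall q, measurable (tau @^-1` [set q])) ->
  Int mu (fun x => a (tau x)) = \sum_q a q * fine (mu (tau @^-1` [set q])).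
Proof.
move=> mt.
transitivity (Int mu (fun x => \sum_q a q * \1_(tau @^-1` [set q]) x)).
  congr Int; apply/funext => x; rewrite (bigD1 (tau x)) //= indicE mem_set// mulr1.
  rewrite big1 ?addr0// => q qx; rewrite indicE memNset ?mulr0// => /= /esym/eqP.
  by rewrite (negbTE qx).
rewrite Int_sum; last by move=> q; apply: bmeasZ; exact: bmeas_indic.
by apply: eq_bigr => q _; rewrite IntZ ?Int_indic//; exact: bmeas_indic.
Qed.

Lemma Int_invariant mu (f : X -> X) g : measurable_fun setT f -> f_invariant f mu ->
  bmeas g -> Int mu (g \o f) = Int mu g.
Proof.
move=> mf inv bg; rewrite /Int; congr fine.
have := @integral_pushforward _ _ _ _ R f mf mu setT (EFin \o g).
rewrite preimage_setT => <- //.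
- by apply: eq_measure_integral => A mA _; exact: inv.
- by apply/measurable_EFinP; case: bg.
- exact: (bmeas_integrable (prob_fin mu) (bmeas_comp mf bg)).
Qed.

Lemma Int_empE (f : X -> X) n (x : X) (g : X -> R) : bmeas g ->
  Int (emp f n x) g = n%:R^-1 * \sum_(i < n) g (iter i f x).
Proof.
move=> bg; have [mg [B hB]] := bg.
have B0 : 0 <= B by apply: le_trans (hB x); exact: normr_ge0.
have ge0E (h : X -> R) : measurable_fun setT h -> (forall x, 0 <= h x) ->
    (\int[emp f n x]_y (h y)%:E)%E = (n%:R^-1 * \sum_(i < n) h (iter i f x))%:E.
  move=> mh h0; rewrite /emp ge0_integral_mscale//=; last 2 first.
  - exact/measurable_EFinP.
  - by move=> y _; rewrite lee_fin.
  rewrite ge0_integral_measure_sum//=; last 2 first.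
  - by move=> y _; rewrite lee_fin.
  - exact/measurable_EFinP.
  rewrite EFinM -sumEFin; congr (_ * _)%E; apply: eq_bigr => i _.
  by rewrite integral_dirac// ?diracT ?mul1e//; exact/measurable_EFinP.
pose m : {measure set X -> \bar R} := emp f n x.
have fin : (m setT < +oo)%E.
  rewrite -[m setT]mul1e -integral_cst//.
  by rewrite (ge0E (fun=> 1)) ?ltry//; exact: measurable_cst.
have bB : bmeas (fun=> B) by exact: bmeas_cst.
(* Shifting [g] by its bound makes it nonnegative, where [ge0E] computes the integral; the constant
   is integrated separately. *)
rewrite IntE (_ : (fun x => g x) = (fun x => (g x + B) - B)); last first.
  by apply/funext => y; rewrite addrK.
rewrite RintegralB//; last 2 first.
- by apply: bmeas_integrable => //; exact: bmeasD.
- exact: bmeas_integrable.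
rewrite /Rintegral !ge0E//=; last 2 first.
- exact: (bmeasD bg bB).1.
- by move=> y; have := hB y; rewrite ler_norml => /andP[]; lra.
by rewrite -mulrBr -sumrB; congr (_ * _); apply: eq_bigr => i _; rewrite addrK.
Qed.

End Integrals.

(** * Continuous functions determine a finite measure *)

Section Uniqueness.
Context {dm : measure_display} {X : measurableType dm} {R : realType}.
Variable d : X -> X -> R.
Hypothesis dP : is_metric d.
Hypothesis dB : borel_sets d.
Hypothesis dK : d_compact d.

Lemma rcont_bmeas g : rcont d g -> bmeas g.
Proof.
move=> cg; split; first exact: (rcont_measurable dB).
by have [B _ hB] := rcont_bounded dP dK cg; exists B.
Qed.

Lemma Int_bump_cvg (mu : {measure set X -> \bar R}) (U : set X) : d_open d U ->
  (\int[mu]_x (bump d U k x)%:E)%E @[k --> \oo] --> mu U.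
Proof.
move=> oU; have mU := d_open_measurable dB oU.
have -> : mu U = (\int[mu]_x limn (fun k => (bump d U k x)%:E))%E.
  rewrite -[U in LHS]setIT -integral_indic//; apply: eq_integral => x _.
  apply/esym/cvg_lim => //.
  have [Ux|nUx] := pselect (U x).
    rewrite indicE mem_set//; apply: cvg_near_cst.
    have [k hk] := bump_eq1 oU Ux.
    by exists k => // l /= /hk ->.
  rewrite indicE memNset//; apply: cvg_near_cst.
  by exists 0%N => // l _; rewrite (bump_notin dP).
apply: cvg_monotone_convergence => //.
- by move=> k; apply/measurable_EFinP; apply: (rcont_measurable dB); exact: rcont_bump.
- by move=> k x _; rewrite lee_fin bump_ge0.
- by move=> x _ k l kl; rewrite lee_fin bump_nd.
Qed.

Lemma Int_bump_approx (mu : probability X R) (U : set X) (e : R) : d_open d U -> 0 < e ->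
  exists k, fine (mu U) - e < Int mu (bump d U k).
Proof.
move=> oU e0; have mU := d_open_measurable dB oU.
have /fine_cvgP[_ /cvgrPdist_lt /(_ e e0)[k _ /(_ k (leqnn _))]] : 
    (\int[mu]_x (bump d U k x)%:E)%E @[k --> \oo] --> (fine (mu U))%:E.
  by rewrite fineK ?fin_num_measure//; exact: Int_bump_cvg.
by move=> /= h; exists k; move: h; rewrite /Int ltr_norml => /andP[]; lra.
Qed.

(** Open sets are stable under intersection and generate the sigma-algebra, so agreement on them
    suffices, and the mass of an open set is the limit of the integrals of its bumps. *)
Lemma measure_ext_rcont (mu nu : {measure set X -> \bar R}) :
  (mu setT < +oo)%E -> (nu setT < +oo)%E ->
  (forall g, rcont d g -> Int mu g = Int nu g) -> forall A, measurable A -> mu A = nu A.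
Proof.
move=> fmu fnu h; apply: (@measure_unique _ _ _ (d_open d) (fun=> setT)).
- exact: dB.
- exact: d_openI.
- by move=> _; exact: d_openT.
- by apply/seteqP; split => // x _; exists 0%N.
- move=> U oU.
  have h1 := Int_bump_cvg (mu := mu) oU.
  have h2 := Int_bump_cvg (mu := nu) oU.
  suff E : (fun k => \int[mu]_x (bump d U k x)%:E)%E = (fun k => \int[nu]_x (bump d U k x)%:E)%E.
    by rewrite E in h1; exact: (cvg_unique _ h1 h2).
  apply/funext => k.
  have bb : bmeas (bump d U k) by apply: rcont_bmeas; exact: rcont_bump.
  rewrite -[LHS]fineK; last by apply: integrable_fin_num => //; exact: bmeas_integrable.
  rewrite -[RHS]fineK; last by apply: integrable_fin_num => //; exact: bmeas_integrable.
  by congr EFin; apply: h; exact: rcont_bump.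
- by [].
Qed.

End Uniqueness.

(** * Riesz representation *)

Section Riesz.
Context {dm : measure_display} {X : measurableType dm} {R : realType}.
Variable d : X -> X -> R.
Hypothesis dP : is_metric d.
Hypothesis dB : borel_sets d.
Hypothesis dK : d_compact d.
Variable L : (X -> R) -> R.
Hypothesis LD : forall g h, rcont d g -> rcont d h -> L (fun x => g x + h x) = L g + L h.
Hypothesis LZ : forall (a : R) g, rcont d g -> L (fun x => a * g x) = a * L g.
Hypothesis L_ge0 : forall g, rcont d g -> (forall x, 0 <= g x) -> 0 <= L g.
Hypothesis L_one : L (fun=> 1) = 1.

Lemma L_cst (a : R) : L (fun=> a) = a.
Proof.
rewrite (_ : (fun=> a) = (fun=> a * 1)); last by apply/funext => x; rewrite mulr1.
by rewrite LZ ?L_one ?mulr1//; exact: rcont_cst.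
Qed.

Lemma LB g h : rcont d g -> rcont d h -> L (fun x => g x - h x) = L g - L h.
Proof.
move=> cg ch; rewrite -mulN1r -LZ// -LD//; last exact: rcontZ.
by congr L; apply/funext => x; rewrite mulN1r.
Qed.

Lemma L_le g h : rcont d g -> rcont d h -> (forall x, g x <= h x) -> L g <= L h.
Proof.
move=> cg ch gh; rewrite -subr_ge0 -LB//; apply: L_ge0; first exact: rcontB.
by move=> x; rewrite subr_ge0.
Qed.

Lemma L_sum (I : Type) (s : seq I) (F : I -> X -> R) :
  (forall i, rcont d (F i)) -> L (fun x => \sum_(i <- s) F i x) = \sum_(i <- s) L (F i).
Proof.
move=> h; elim: s => [|i s IH].
  by rewrite big_nil; under eq_fun do rewrite big_nil; exact: L_cst.
rewrite big_cons; under eq_fun do rewrite big_cons.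
by rewrite LD// ?IH//; exact: rcont_sum.
Qed.

Definition below (U : set X) : set (X -> R) :=
  [set g | [/\ rcont d g, forall x, 0 <= g x & forall x, g x <= \1_U x]].

(** Riesz's content. The functions below [U] may be positive up to its boundary; the truncations
    [max (g - e) 0] used later keep away from it. *)
Definition lam (U : set X) : R := sup [set L g | g in below U].

Lemma below0 U : below U (fun=> 0).
Proof. by split => [|x|x]; [exact: rcont_cst| |rewrite indicE; case: (_ \in _)]. Qed.

Lemma lam_has_sup U : has_sup [set L g | g in below U].
Proof.
split; first by exists (L (fun=> 0)), (fun=> 0) => //; exact: below0.
exists 1 => _ [g [cg g0 g1] <-]; rewrite -(L_cst 1); apply: L_le => //.
  exact: rcont_cst.
by move=> x; apply: (le_trans (g1 x)); rewrite indicE; case: (_ \in _).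
Qed.

Lemma le_lam U g : below U g -> L g <= lam U.
Proof. by move=> h; apply: sup_ubound; [case: (lam_has_sup U)|exists g]. Qed.

Lemma lam_le U (c : R) : (forall g, below U g -> L g <= c) -> lam U <= c.
Proof.
by move=> h; apply: ge_sup => [|_ [g bg <-]]; [case: (lam_has_sup U)|exact: h].
Qed.

Lemma lam_ge0 U : 0 <= lam U.
Proof. by rewrite -(L_cst 0); apply: le_lam; exact: below0. Qed.

Lemma lam_mono U V : U `<=` V -> lam U <= lam V.
Proof.
move=> UV; apply: lam_le => g [cg g0 g1]; apply: le_lam; split => // x.
apply: (le_trans (g1 x)); rewrite !indicE ler_nat.
by case: (boolP (x \in U)) => // /set_mem/UV xV; rewrite mem_set.
Qed.

Lemma lam0 : lam set0 = 0.
Proof.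
apply/eqP; rewrite eq_le lam_ge0 andbT; apply: lam_le => g [cg g0 g1].
rewrite -(L_cst 0); apply: L_le => // [|x]; first exact: rcont_cst.
by apply: (le_trans (g1 x)); rewrite indic0.
Qed.

Lemma lamT : lam setT = 1.
Proof.
apply/eqP; rewrite eq_le; apply/andP; split.
  by apply: lam_le => g [cg g0 g1]; rewrite -(L_cst 1); apply: L_le => // [|x];
    [exact: rcont_cst|apply: (le_trans (g1 x)); rewrite indicT].
by rewrite -{1}(L_cst 1); apply: le_lam; split => // [|x]; [exact: rcont_cst|rewrite indicT].
Qed.

(** The truncation [max (g - e) 0] vanishes where [g < e]; by compactness the rest is covered by
    finitely many sets on each of which some bump equals 1, so a finite sum of bumps dominates the
    truncation. Up to [e] this is countable subadditivity. *)
Lemma below_bigcup_le (U : nat -> set X) g (e : R) : (forall i, d_open d (U i)) ->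
  below (\bigcup_i U i) g -> 0 < e -> exists N, L g <= e + \sum_(i < N) lam (U i).
Proof.
move=> oU [cg g0 g1] e0.
pose V (p : nat * nat) := [set x | g x < e] `|` [set x | 1 < p.2%:R * dist_out d (U p.1) x].
have oV p : d_open d (V p).
  move=> x [/= h|/= h].
    by have [r r0 hr] := rcont_openl cg h; exists r => // y /hr; left.
  have ck : rcont d (fun x => p.2%:R * dist_out d (U p.1) x).
    by apply: rcontZ; exact: rcont_dist_out.
  by have [r r0 hr] := rcont_openr ck h; exists r => // y /hr; right.
have cV x : exists p, V p x.
  have [xe|ex] := ltP (g x) e; first by exists (0, 0)%N; left.
  have [i _ Uix] : (\bigcup_i U i) x.
    apply: contrapT => nx; have := le_trans ex (g1 x).
    by rewrite indicE memNset//= leNgt e0.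
  have d0 := dist_out_gt0 (oU i) Uix.
  exists (i, (Num.truncn (dist_out d (U i) x)^-1).+1); right => /=.
  by rewrite -ltr_pdivrMr// div1r truncnS_gt.
have [n [h hh]] := dK oV cV.
pose K := (\max_(j < n) (h j).2)%N; pose N := (\max_(j < n) (h j).1).+1%N.
exists N; pose g' (x : X) : R := Num.max (g x - e) 0.
have cge : rcont d (fun x => g x - e) by apply: rcontB => //; exact: rcont_cst.
have cg' : rcont d g' by exact: rcont_max.
have gU x : g' x <= \sum_(i < N) bump d (U i) K x.
  rewrite /g'; case: (leP (g x - e) 0) => [_|ge0]; first by apply: sumr_ge0 => i _; exact: bump_ge0.
  have [j [/= hj|/= hj]] := hh x; first by lra.
  have jN : ((h j).1 < N)%N by rewrite ltnS (leq_bigmax j).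
  have -> : \sum_(i < N) bump d (U i) K x = bump d (U (h j).1) K x +
     \sum_(i < N | i != Ordinal jN) bump d (U i) K x by rewrite (bigD1 (Ordinal jN)).
  rewrite [X in _ <= X + _](_ : _ = 1); last first.
    apply/eqP; rewrite eq_le bump_le1 /=.
    apply: (@le_trans _ _ (bump d (U (h j).1) (h j).2 x)); last first.
      by apply: bump_nd => //; exact: (leq_bigmax j).
    by rewrite le_min lexx andbT ltW.
  apply: ler_wpDr; first by apply: sumr_ge0 => i _; rewrite bump_ge0.
  have : g x <= 1 by apply: (le_trans (g1 x)); rewrite indicE; case: (_ \in _).
  by lra.
have : L g - e <= L g'.
  rewrite -{1}(L_cst e) -LB//; last exact: rcont_cst.
  by apply: L_le => // x; rewrite /g' le_max lexx.
have : L g' <= \sum_(i < N) L (bump d (U i) K).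
  rewrite -L_sum; last by move=> i; exact: rcont_bump.
  by apply: L_le => //; apply: rcont_sum => i; exact: rcont_bump.
have : \sum_(i < N) L (bump d (U i) K) <= \sum_(i < N) lam (U i).
  apply: ler_sum => i _; apply: le_lam; split => [|x|x]; first exact: rcont_bump.
    exact: bump_ge0.
  exact: bump_le_indic.
by lra.
Qed.

Local Open Scope ereal_scope.

Definition ostar (A : set X) : \bar R :=
  ereal_inf [set (lam U)%:E | U in [set U | d_open d U /\ A `<=` U]].

Lemma ostar_open U : d_open d U -> ostar U = (lam U)%:E.
Proof.
move=> oU; apply/eqP; rewrite eq_le; apply/andP; split.
  by apply: ereal_inf_lbound => /=; exists U => //; split.
by apply: le_ereal_inf_tmp => _ [V [oV UV] <-]; rewrite lee_fin lam_mono.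
Qed.

Lemma ostar_ge0 A : 0 <= ostar A.
Proof. by apply: le_ereal_inf_tmp => _ [V [oV UV] <-]; rewrite lee_fin lam_ge0. Qed.

Lemma ostar0 : ostar set0 = 0.
Proof. by rewrite ostar_open ?lam0//; move=> x. Qed.

Lemma ostar_mono : {homo ostar : A B / A `<=` B >-> A <= B}.
Proof.
move=> A B AB; apply: le_ereal_inf_tmp => _ [V [oV UV] <-].
by apply: ereal_inf_lbound; exists V => //; split => //; exact: subset_trans UV.
Qed.

Lemma ostar_fin A : ostar A \is a fin_num.
Proof.
rewrite ge0_fin_numE ?ostar_ge0//; apply: (le_lt_trans (ostar_mono (@subsetT _ A))).
by rewrite ostar_open ?ltry//; exact: d_openT.
Qed.

Lemma ostar_approx A (e : R) : (0 < e)%R ->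
  exists U, [/\ d_open d U, A `<=` U & (lam U)%:E <= ostar A + e%:E].
Proof.
move=> e0; have [_ [U [oU AU] <-] h] := lb_ereal_inf_adherent e0 (ostar_fin A).
by exists U; split => //; exact: ltW.
Qed.

Lemma ostar_sigma_subadditive : sigma_subadditive ostar.
Proof.
move=> F; apply/lee_addgt0Pr => e e0.
have e20 : (0 < e / 2)%R by rewrite divr_gt0.
have /choice[U hU] : forall n, exists U, [/\ d_open d U, F n `<=` U &
    (lam U)%:E <= ostar (F n) + ((e / 2) / (2 ^ n.+1)%:R)%:E].
  by move=> n; apply: ostar_approx; rewrite divr_gt0// ltr0n expn_gt0.
have oU n : d_open d (U n) by case: (hU n).
have oUU : d_open d (\bigcup_n U n) by apply: d_open_bigcup.
apply: (@le_trans _ _ (ostar (\bigcup_n U n))).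
  by apply: ostar_mono; apply: subset_bigcup => n _; case: (hU n).
rewrite ostar_open//.
have lamU : (lam (\bigcup_n U n))%:E <= \sum_(n <oo) (lam (U n))%:E + (e / 2)%:E.
  have [fs|hc] := boolP ((\sum_(n <oo) (lam (U n))%:E)%E \is a fin_num); last first.
    have s0 : 0 <= \sum_(n <oo) (lam (U n))%:E.
      by apply: nneseries_ge0 => n _ _; rewrite lee_fin lam_ge0.
    move: hc s0; case: (\sum_(n <oo) (lam (U n))%:E) => //= _ _.
    by rewrite addye// leey.
  rewrite -(fineK fs) -EFinD lee_fin; apply: lam_le => g bg.
  have [N hN] := below_bigcup_le oU bg e20.
  apply: (le_trans hN); rewrite addrC lerD2r -lee_fin fineK// -sumEFin.
  rewrite -(big_mkord xpredT (fun i => (lam (U i))%:E)).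
  by apply: nneseries_lim_ge => n _ _; rewrite lee_fin lam_ge0.
apply: (le_trans lamU); rewrite [e in leRHS](splitr e) EFinD addeA; apply: leeD2r.
apply: (le_trans _ (epsilon_trick _ _ _)) => //; last exact: ltW.
  by apply: lee_nneseries => [n _ _|n _]; [rewrite lee_fin lam_ge0|case: (hU n)].
by move=> n; exact: ostar_ge0.
Qed.

HB.instance Definition _ := isOuterMeasure.Build R X ostar
  ostar0 ostar_ge0 ostar_mono ostar_sigma_subadditive.

(** The part [W] of [T] where [g < e] is open and contains [T] minus [U]. Since [max (g - e) 0]
    vanishes on [W], it can be added to any function below [W] without leaving the functions below
    [T]. This is Caratheodory's inequality for open sets. *)
Lemma lam_split (T U : set X) : d_open d T -> d_open d U ->
  (lam (T `&` U))%:E + ostar (T `&` ~` U) <= (lam T)%:E.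
Proof.
move=> oT oU; rewrite -(fineK (ostar_fin _)) -EFinD lee_fin -lerBrDr.
apply: lam_le => g [cg g0 g1]; rewrite lerBrDr.
apply/ler_addgt0Pr => e e0.
pose g' (x : X) : R := Num.max (g x - e)%R 0%R.
have cge : rcont d (fun x => g x - e)%R by apply: rcontB => //; exact: rcont_cst.
have cg' : rcont d g' by exact: rcont_max.
pose W := T `&` [set x | g x < e]%R.
have oW : d_open d W by apply: d_openI => //; exact: rcont_openl.
have TW : T `&` ~` U `<=` W.
  move=> x [Tx nUx]; split => //=; apply: le_lt_trans e0.
  by apply: (le_trans (g1 x)); rewrite indicE memNset// => -[].
have h1 : (fine (ostar (T `&` ~` U)) <= lam W)%R.
  by rewrite -lee_fin fineK ?ostar_fin// -ostar_open//; exact: ostar_mono.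
have h2 : (L g - e <= L g')%R.
  rewrite -{1}(L_cst e) -LB//; last exact: rcont_cst.
  by apply: L_le => // x; rewrite /g' le_max lexx.
have h3 : (lam W <= lam T - L g')%R.
  apply: lam_le => h [ch h0 h1']; rewrite lerBrDr -LD//; apply: le_lam; split.
  - exact: rcontD.
  - by move=> x; rewrite addr_ge0// le_max lexx orbT.
  - move=> x; have := h1' x; have := g1 x; have := h0 x; have := g0 x.
    rewrite /g' !indicE; have [xT|xT] := boolP (x \in T); last first.
      rewrite !memNset => [|[]|[]]; try by move/mem_set; rewrite (negbTE xT).
      by rewrite /=; case: (leP (g x - e)%R 0%R) => _; lra.
    have [gx|gx] := ltP (g x) e.
      by case: (x \in W) => /=; case: (x \in T `&` U) => /=; case: (leP (g x - e)%R 0%R) => _ /=; lra.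
    rewrite (memNset (A := W)); last by move=> [_ /=]; rewrite ltNge gx.
    by case: (x \in T `&` U) => /=; case: (leP (g x - e)%R 0%R) => _ /=; lra.
by lra.
Qed.

Lemma open_caratheodory (U : set X) : d_open d U -> ostar.-caratheodory U.
Proof.
move=> oU; apply: le_caratheodory_measurable => T.
apply: le_ereal_inf_tmp => _ [V [oV TV] <-].
apply: le_trans (lam_split oV oU).
rewrite -(ostar_open (d_openI oV oU)).
by apply: leeD; apply: ostar_mono => x [Tx Ux]; split => //; exact: TV.
Qed.

Lemma borel_caratheodory (A : set X) : measurable A -> ostar.-caratheodory A.
Proof.
rewrite dB; apply: smallest_sub; last exact: open_caratheodory.
split.
- exact: caratheodory_measurable_set0.
- by move=> B hB; rewrite setTD; exact: caratheodory_measurable_setC.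
- by move=> F hF; exact: caratheodory_measurable_bigcup.
Qed.

Definition riesz_measure (A : set X) : \bar R := ostar A.

Lemma riesz_sigma_additive : semi_sigma_additive riesz_measure.
Proof.
move=> F mF tF mUF.
apply: (@caratheodory_measure_sigma_additive R X ostar F) => //.
  by move=> i; exact: borel_caratheodory.
exact: borel_caratheodory.
Qed.

HB.instance Definition _ := isMeasure.Build dm X R riesz_measure
  ostar0 ostar_ge0 riesz_sigma_additive.

Lemma riesz_setT : riesz_measure setT = 1.
Proof. by rewrite /riesz_measure ostar_open ?lamT//; exact: d_openT. Qed.

HB.instance Definition _ := Measure_isProbability.Build dm X R riesz_measure riesz_setT.

Local Close Scope ereal_scope.

(** Layer-cake comparison: [g] is cut into [M] layers of height [1/M]. A layer multiplied by [M] is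
    below the open set [G k], so its value under [L] is at most the mass of [G k] over [M], and the
    indicators of the [G k] add up to at most [M * g + 1]. *)
Lemma riesz_le01 g : rcont d g -> (forall x, 0 <= g x) -> (forall x, g x <= 1) ->
  L g <= Int (riesz_measure : probability X R) g.
Proof.
move=> cg g0 g1; apply/ler_addgt0Pr => e e0.
have [N Ne] : exists N : nat, (N.+1%:R : R)^-1 < e.
  by have [N _ /(_ N (leqnn N))] := near_infty_natSinv_lt (PosNum e0); exists N.
set M := N.+1 in Ne; have M0 : 0 < M%:R :> R by rewrite ltr0n.
pose mu : probability X R := riesz_measure.
pose t k x := Num.min (g x) (k%:R / M%:R).
pose G k := [set x | k%:R / M%:R < g x].
have oG k : d_open d (G k) by exact: rcont_openr.
have mG k : measurable (G k) by exact: (d_open_measurable dB).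
have ct k : rcont d (t k) by exact: rcont_min.
have tS k x : t k x <= t k.+1 x.
  rewrite /t le_min ge_min lexx /= ge_min; apply/orP; right.
  by rewrite ler_pM2r ?invr_gt0// ler_nat.
have bG k : bmeas (\1_(G k) : X -> R) by exact: bmeas_indic.
have kM k : k.+1%:R / M%:R = k%:R / M%:R + M%:R^-1 :> R.
  by rewrite -natr1 mulrDl mul1r.
have step k : L (fun x => t k.+1 x - t k x) <= M%:R^-1 * Int mu \1_(G k).
  rewrite ler_pdivlMl// -LZ; last exact: rcontB.
  rewrite Int_indic// /mu /= /riesz_measure ostar_open//=; apply: le_lam; split.
  - by apply: rcontZ; exact: rcontB.
  - by move=> x; apply: mulr_ge0; [exact: ltW|rewrite subr_ge0].
  - move=> x; rewrite indicE; have [gk|gk] := ltP (k%:R / M%:R) (g x); last first.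
      have gk' : g x <= k.+1%:R / M%:R by apply: le_trans gk _; rewrite kM lerDl invr_ge0 ltW.
      by rewrite /t !min_l// subrr mulr0.
    rewrite mem_set//= -ler_pdivlMl// mulr1 /t [in X in _ - X]min_r; last exact: ltW.
    by rewrite lerBlDr ge_min kM addrC lexx orbT.
have LE : L g = \sum_(k < M) L (fun x => t k.+1 x - t k x).
  rewrite -L_sum; last by move=> k; exact: rcontB.
  congr L; apply/funext => x; rewrite -(big_mkord xpredT (fun k => t k.+1 x - t k x)).
  rewrite telescope_sumr// /t divff ?gt_eqF// mul0r min_l// min_r//.
  by rewrite subr0.
rewrite LE; apply: (@le_trans _ _ (\sum_(k < M) Int mu (fun x => M%:R^-1 * \1_(G k) x))).
  by apply: ler_sum => k _; rewrite IntZ.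
have bg : bmeas g by exact: (rcont_bmeas dP dB dK).
rewrite -Int_sum; last by move=> k; exact: bmeasZ.
rewrite -[X in _ <= _ + X](Int_cst mu) -IntD//; last exact: bmeas_cst.
apply: Int_le.
- by apply: bmeas_sum => k; exact: bmeasZ.
- by apply: bmeasD => //; exact: bmeas_cst.
move=> x; apply: (@le_trans _ _ (g x + M%:R^-1)); last by rewrite lerD2l ltW.
(* Layers of [g + 1/M]: wherever [g > k/M], the layer of index [k] of this larger function is
   full. *)
pose u k := Num.min (g x + M%:R^-1) (k%:R / M%:R).
apply: (@le_trans _ _ (\sum_(k < M) (u k.+1 - u k))).
  apply: ler_sum => k _; rewrite indicE.
  have [gk|gk] := boolP (x \in G k); last first.
    rewrite mulr0 subr_ge0 /u le_min ge_min lexx /= ge_min kM; apply/orP; right.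
    by rewrite lerDl invr_ge0 ltW.
  have {}gk : k%:R / M%:R < g x by exact: (set_mem gk).
  have M1 : 0 < M%:R^-1 :> R by rewrite invr_gt0.
  by rewrite mulr1 /u kM !min_r; lra.
rewrite -(big_mkord xpredT (fun k => u k.+1 - u k)) telescope_sumr//.
rewrite /u mul0r [in X in _ - X]min_r; last by apply: addr_ge0 => //; rewrite invr_ge0 ltW.
by rewrite subr0 ge_min lexx.
Qed.

Lemma riesz_le g : rcont d g -> L g <= Int (riesz_measure : probability X R) g.
Proof.
move=> cg; have [B B0 hB] := rcont_bounded dP dK cg.
pose mu : probability X R := riesz_measure.
have cg' : rcont d (fun x => g x + B) by apply: rcontD => //; exact: rcont_cst.
have bg : bmeas g by exact: (rcont_bmeas dP dB dK).
have B2 : 0 < 2 * B by rewrite mulr_gt0.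
have := @riesz_le01 (fun x => (2 * B)^-1 * (g x + B)) (rcontZ _ cg').
rewrite LZ// LD//; last exact: rcont_cst.
rewrite L_cst IntZ ?IntD ?Int_cst//; last 2 first.
- exact: bmeas_cst.
- by apply: bmeasD => //; exact: bmeas_cst.
rewrite ler_pM2l ?invr_gt0// lerD2r; apply => x; have := hB x; rewrite ler_norml => /andP[h1 h2].
  by apply: mulr_ge0; [rewrite invr_ge0 ltW|lra].
by rewrite ler_pdivrMl//; lra.
Qed.

(** One inequality holds for all continuous functions; applied to [-g] it gives the other. *)
Lemma riesz_representation : exists mu : probability X R, forall g, rcont d g -> Int mu g = L g.
Proof.
exists (riesz_measure : probability X R) => g cg; apply/eqP; rewrite eq_le riesz_le// andbT.
have bg : bmeas g by exact: (rcont_bmeas dP dB dK).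
have := riesz_le (rcontZ (-1) cg); rewrite LZ// IntZ// !mulN1r lerN2.
exact.
Qed.

End Riesz.

(** * Limit points of empirical measures *)

Section LimitPoints.
Context {dm : measure_display} {X : measurableType dm} {R : realType}.
Variable d : X -> X -> R.
Hypothesis dP : is_metric d.
Hypothesis dB : borel_sets d.
Hypothesis dK : d_compact d.
Variable f : X -> X.
Hypothesis fC : d_cont d f.

Let rb g : rcont d g -> bmeas g. Proof. exact: (rcont_bmeas dP dB dK). Qed.

Lemma fmap_ultra (S T : Type) (G : set_system S) (h : S -> T) :
  UltraFilter G -> UltraFilter (h @ G).
Proof.
move=> uG; split => [|H pH GH]; first by apply: fmap_proper_filter; exact: ultra_proper.
apply/seteqP; split => // A HA; have [//|nA] := in_ultra_setVsetC (h @^-1` A) uG.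
exfalso; apply: (@filter_not_empty _ H _).
rewrite -(setICr A); apply: filterI => //; exact: GH.
Qed.

Lemma Int_emp_bound n (x : X) g (B : R) : bmeas g -> 0 <= B -> (forall y, `|g y| <= B) ->
  `|Int (emp f n x) g| <= B.
Proof.
move=> bg B0 hB; rewrite Int_empE//; case: n => [|n]; first by rewrite big_ord0 mulr0 normr0.
rewrite normrM normfV (ger0_norm (ler0n R _)) ler_pdivrMl ?ltr0n//.
apply: (le_trans (ler_norm_sum _ _ _)); apply: (@le_trans _ _ (\sum_(i < n.+1) B)).
  by apply: ler_sum.
by rewrite sumr_const card_ord mulr_natl.
Qed.

Lemma Vpts_nonempty (x : X) : exists mu : probability X R, Vpts d f x mu.
Proof.
have [G [uG sG]] := @ultraFilterLemma nat \oo _.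
have pG : ProperFilter G by exact: ultra_proper.
pose a g n : R := Int (emp f n x) g.
have cva g : rcont d g -> cvg (a g @ G).
  move=> cg; have [B B0 hB] := rcont_bounded dP dK cg.
  have := @segment_compact R (- B) B; rewrite compact_ultra => /(_ (a g @ G) (fmap_ultra _ uG)).
  have h : G (a g @^-1` `[- B, B]%classic).
    apply: filterS (@filterT _ G _) => n _ /=.
    rewrite in_itv /=; rewrite -ler_norml.
    exact: (Int_emp_bound n x (rb cg) (ltW B0) hB).
  by move=> /(_ h)[l [_ hl]]; apply/cvg_ex; exists l.
pose L g := lim (a g @ G).
have [| | | |mu hmu] := @riesz_representation _ X R d dP dB dK L.
- move=> g h cg ch; rewrite /L -limD; [|exact: cva..].
  congr (lim (_ @ G)); apply/funext => n.
  rewrite /a !Int_empE ?mulrDr//; [|exact: rb..|apply: bmeasD; exact: rb].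
  by rewrite big_split mulrDr /= fctE !Int_empE//; exact: rb.
- move=> c g cg; rewrite /L; transitivity (c *: lim (a g @ G)) => //.
  rewrite -limZl_tmp; last exact: cva.
  congr (lim (_ @ G)); apply/funext => n.
  rewrite /a Int_empE; last by apply: bmeasZ; exact: rb.
  rewrite -mulr_sumr mulrCA -[RHS]/(c * Int (emp f n x) g) Int_empE//.
  exact: rb.
- move=> g cg g0; apply: limr_ge; first exact: cva.
  apply: filterS (@filterT _ G _) => n _.
  by rewrite /a Int_empE ?mulr_ge0 ?invr_ge0 ?sumr_ge0//; exact: rb.
- apply/cvg_lim => //; apply: cvg_near_cst; apply: sG.
  exists 1%N => // n /= n0; rewrite /a Int_empE; last exact: bmeas_cst.
  by rewrite sumr_const card_ord mulVf// pnatr_eq0 -lt0n.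
exists mu => k gs cgs e e0 N.
have h j : G [set n | `|Int (emp f n x) (gs j) - Int mu (gs j)| < e].
  rewrite hmu//; have /cvgrPdist_lt /(_ e e0) := cva _ (cgs j).
  by apply: filterS => n; rewrite distrC.
have hN : G [set n | (N < n)%N] by apply: sG; exists N.+1.
have /filter_ex[n [Nn hn]] : G ([set n | (N < n)%N] `&`
    [set n | forall j, `|Int (emp f n x) (gs j) - Int mu (gs j)| < e]).
  apply: filterI => //.
  have := @filter_forall _ _ (fun j n => `|Int (emp f n x) (gs j) - Int mu (gs j)| < e) G _ h.
  exact.
by exists n; split; [exact: ltnW|exact: leq_ltn_trans Nn|].
Qed.

(** Along an orbit the empirical integrals of [g] and [g \o f] differ by two end terms divided by
    [n]. Both functions are tested at once so that a single [n] serves them. *)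
Lemma Vpts_invariant (x : X) mu : Vpts d f x mu -> f_invariant f mu.
Proof.
move=> hV; have mf := d_cont_measurable dB fC.
have IE g : rcont d g -> Int mu (g \o f) = Int mu g.
  move=> cg; have cgf := rcont_comp cg fC.
  have [B B0 hB] := rcont_bounded dP dK cg.
  apply/eqP; rewrite -subr_eq0 -normr_le0; apply/ler_addgt0Pr => e e0; rewrite add0r.
  have e30 : 0 < e / 3 by rewrite divr_gt0.
  have [N hN] : exists N : nat, 2 * B / (e / 3) < N%:R.
    by exists (Num.truncn (2 * B / (e / 3))).+1; exact: truncnS_gt.
  pose gs (j : 'I_2) := if j == ord0 then g else g \o f.
  have cgs j : rcont d (gs j) by rewrite /gs; case: ifP.
  have [n [Nn n0 hn]] := hV 2%N gs cgs _ e30 N.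
  have /= h1 := hn ord0; have /= h2 := hn (lift ord0 ord0).
  have h3 : `|Int (emp f n x) (g \o f) - Int (emp f n x) g| < e / 3.
    rewrite !Int_empE; [|exact: rb..].
    rewrite -mulrBr normrM normfV (ger0_norm (ler0n R _)).
    rewrite mulrC ltr_pdivrMr ?ltr0n// [e / 3 * _]mulrC.
    rewrite -ltr_pdivrMr//; apply: le_lt_trans (lt_le_trans hN _); last by rewrite ler_nat.
    rewrite ler_pM2r ?invr_gt0//.
    have -> : \sum_(i < n) (g \o f) (iter i f x) - \sum_(i < n) g (iter i f x) =
       g (iter n f x) - g x.
      rewrite -sumrB -(big_mkord xpredT (fun i => (g \o f) (iter i f x) - g (iter i f x))).
      by rewrite (telescope_sumr (fun i => g (iter i f x))).
    apply: (le_trans (ler_normB _ _)); have := hB (iter n f x); have := hB x; lra.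
  rewrite (_ : Int mu (g \o f) - Int mu g =
     - (Int (emp f n x) (g \o f) - Int mu (g \o f)) +
      (Int (emp f n x) (g \o f) - Int (emp f n x) g) + (Int (emp f n x) g - Int mu g)); last by ring.
  apply: (le_trans (ler_normD _ _)).
  apply: (@le_trans _ _ (e / 3 + e / 3 + e / 3)); last lra.
  apply: lerD; last exact: ltW.
  apply: (le_trans (ler_normD _ _)); rewrite normrN.
  by apply: lerD; exact: ltW.
have h := @measure_ext_rcont _ X R d dP dB dK (pushforward mu f) mu.
move=> A mA; rewrite -[LHS]/(pushforward mu f A); apply: h => //.
- exact: (prob_fin mu).
- exact: (prob_fin mu).
- move=> g cg; rewrite -IE//.
  rewrite /Int; congr fine.
  rewrite (integral_pushforward mf)//.
  + by apply/measurable_EFinP; case: (rb cg).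
  + rewrite preimage_setT; apply: bmeas_integrable; first exact: (prob_fin mu).
    exact: (rb (rcont_comp cg fC)).
Qed.

End LimitPoints.

(** * Entropy of partitions *)

Section Fekete.
Context {R : realType}.

(** The limit is the infimum over positive [n]: a near-minimal [m] is fixed, and the remainders
    modulo [m] cost at most the constant [C]. *)
Lemma fekete (a : nat -> R) : (forall n, 0 <= a n) ->
  (forall m n, a (m + n)%N <= a m + a n) -> cvgn (fun n => a n / n%:R).
Proof.
move=> a0 aD.
pose S := [set a n.+1 / n.+1%:R | n in setT].
have S0 : has_inf S.
  by split; [exists (a 1%N / 1%:R), 0%N|exists 0 => _ [n _ <-]; rewrite divr_ge0].
apply/cvg_ex; exists (inf S); apply/cvgrPdist_le => e e0.
have e20 : 0 < e / 2 by rewrite divr_gt0.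
have [_ [k _ <-] hk] := inf_adherent e20 S0.
set m := k.+1 in hk.
pose C := \sum_(r < m) a r.
have aq q r : a (q * m + r)%N <= q%:R * a m + a r.
  elim: q => [|q IH]; first by rewrite mul0r add0r.
  rewrite mulSn -addnA; apply: (le_trans (aD _ _)).
  by rewrite -natr1 mulrDl mul1r; move: IH; lra.
have [N hN] : exists N : nat, C / (e / 2) < N%:R.
  by exists (Num.truncn (C / (e / 2))).+1; exact: truncnS_gt.
exists N.+1 => // n /= Nn.
have n0 : 0 < n%:R :> R by rewrite ltr0n (leq_ltn_trans _ Nn).
have lb : inf S <= a n / n%:R.
  apply: ge_inf; first by case: S0.
  by exists n.-1 => //; rewrite prednK// -(ltr0n R).
rewrite distrC ger0_norm ?subr_ge0// lerBlDl.
have h : a n <= (n %/ m)%:R * a m + C.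
  rewrite {1}(divn_eq n m); apply: (le_trans (aq _ _)); rewrite lerD2l /C.
  have rm : (n %% m < m)%N by rewrite ltn_mod.
  by rewrite (bigD1 (Ordinal rm)) //= lerDl sumr_ge0.
have m0 : 0 < m%:R :> R by rewrite ltr0n.
have h2 : (n %/ m)%:R * a m <= n%:R * (a m / m%:R).
  rewrite mulrA ler_pdivlMr// mulrAC ler_wpM2r// -natrM ler_nat.
  exact: leq_trunc_div.
rewrite ler_pdivrMr//.
have h3 : C <= n%:R * (e / 2).
  rewrite -ler_pdivrMr//; apply: ltW; apply: (lt_trans hN); rewrite ltr_nat.
  exact: Nn.
have h4 : n%:R * (a m / m%:R) <= n%:R * (inf S + e / 2) by rewrite ler_pM2l// ltW.
apply: (le_trans h); apply: (le_trans (lerD h2 h3)).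
by apply: (le_trans (lerD h4 (lexx _))); rewrite -mulrDr mulrC; lra.
Qed.

End Fekete.

(** * Shannon entropy of finite distributions *)

Section Shannon.
Context {R : realType}.

Definition eta (t : R) : R := - (t * ln t).

Lemma ln_le_sub1 (x : R) : 0 < x -> ln x <= x - 1.
Proof.
move=> x0; have := expR_ge1Dx (ln x); rewrite lnK ?posrE//; lra.
Qed.

Lemma eta_ge0 (t : R) : 0 <= t -> t <= 1 -> 0 <= eta t.
Proof. by move=> t0 t1; rewrite oppr_ge0 mulr_ge0_le0// ln_le0. Qed.

(* Gibbs' inequality against the product of the marginals. *)
Lemma eta_subadditive (A B : finType) (p : A -> B -> R) : (forall a b, 0 <= p a b) ->
  \sum_a \sum_b p a b = 1 ->
  \sum_a \sum_b eta (p a b) <=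
    \sum_a eta (\sum_b p a b) + \sum_b eta (\sum_a p a b).
Proof.
move=> p0 p1; pose P a := \sum_b p a b; pose Q b := \sum_a p a b.
have P0 a : 0 <= P a by apply: sumr_ge0.
have Q0 b : 0 <= Q b by apply: sumr_ge0.
have Pp a b : p a b <= P a by rewrite /P (bigD1 b) //= lerDl sumr_ge0.
have Qp a b : p a b <= Q b by rewrite /Q (bigD1 a) //= lerDl sumr_ge0.
have key a b : eta (p a b) + (p a b - P a * Q b) <= - (p a b * ln (P a)) - p a b * ln (Q b).
  have [/eqP pz|pp] := boolP (p a b == 0).
    by rewrite pz /eta !mul0r; have := mulr_ge0 (P0 a) (Q0 b); lra.
  have {}pp : 0 < p a b by rewrite lt_def pp p0.
  have PP : 0 < P a := lt_le_trans pp (Pp a b).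
  have QQ : 0 < Q b := lt_le_trans pp (Qp a b).
  have := ln_le_sub1 (divr_gt0 (mulr_gt0 PP QQ) pp).
  rewrite ln_div ?posrE ?mulr_gt0// lnM ?posrE// => h.
  have := ler_wpM2l (ltW pp) h.
  have -> : p a b * (P a * Q b / p a b - 1) = P a * Q b - p a b by field; exact: lt0r_neq0.
  rewrite /eta.
  by lra.
have sP : \sum_a \sum_b (P a * Q b) = 1.
  under eq_bigr do rewrite -mulr_sumr.
  by rewrite -mulr_suml p1 mul1r /Q exchange_big.
have -> : \sum_a \sum_b eta (p a b) =
    \sum_a \sum_b (eta (p a b) + (p a b - P a * Q b)).
  under [RHS]eq_bigr do rewrite big_split sumrB /=.
  by rewrite big_split sumrB /= p1 sP subrr addr0.
have -> : \sum_a eta (P a) + \sum_b eta (Q b) =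
   \sum_a \sum_b (- (p a b * ln (P a)) - p a b * ln (Q b)).
  under [RHS]eq_bigr do rewrite big_split /= !sumrN -mulr_suml.
  rewrite big_split /=; congr (_ + _).
  transitivity (\sum_b - \sum_a (p a b * ln (Q b))).
    by apply: eq_bigr => b _; rewrite /eta -mulr_suml.
  by rewrite !sumrN exchange_big.
by apply: ler_sum => a _; apply: ler_sum => b _; exact: key.
Qed.

End Shannon.

(** * Entropy of finite-valued measurable maps *)

Section FiniteMaps.
Context {dm : measure_display} {X : measurableType dm} {R : realType}.
(** Partitions are handled as finite labellings: a join is then a pairing or a word, and a
    coarsening a composition. *)
Definition mfin (Q : finType) (tau : X -> Q) := forall q, measurable (tau @^-1` [set q]).

Lemma mfin_comp (Q S : finType) (tau : X -> Q) (h : Q -> S) : mfin tau -> mfin (h \o tau).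
Proof.
move=> mt s.
have -> : (h \o tau) @^-1` [set s] = \bigcup_(q in [set q | h q = s]) tau @^-1` [set q].
  by apply/seteqP; split => [x Px|x [q Pq /= ->]//]; exists (tau x).
by apply: fin_bigcup_measurable => //; exact: finite_finset.
Qed.

Lemma mfin_pair (Q S : finType) (tau : X -> Q) (h : X -> S) : mfin tau -> mfin h ->
  mfin (fun x => (tau x, h x)).
Proof.
move=> mt mh [q s].
have -> : (fun x => (tau x, h x)) @^-1` [set (q, s)] = tau @^-1` [set q] `&` h @^-1` [set s].
  by apply/seteqP; split => [x [<- <-]//|x [/= -> ->]].
exact: measurableI.
Qed.

Lemma mfin_ffun (I : finType) (Q : finType) (tau : I -> X -> Q) : (forall i, mfin (tau i)) ->
  mfin (fun x => [ffun i => tau i x]).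
Proof.
move=> mt w.
have -> : (fun x => [ffun i => tau i x]) @^-1` [set w] =
    \bigcap_(i in [set: I]) tau i @^-1` [set w i].
  apply/seteqP; split => [x /= <- i _ /=|x h /=]; first by rewrite ffunE.
  by apply/ffunP => i; rewrite ffunE; exact: h.
by apply: fin_bigcap_measurable => [|i _]; [exact: finite_finset|exact: mt].
Qed.

Lemma mfin_precomp (Q : finType) (tau : X -> Q) (g : X -> X) : measurable_fun setT g ->
  mfin tau -> mfin (tau \o g).
Proof.
move=> mg mt q; rewrite comp_preimage -[X in measurable X]setTI.
exact: mg.
Qed.

Variable mu : probability X R.

Definition Pr (A : set X) : R := fine (mu A).

Lemma Pr_ge0 A : 0 <= Pr A.
Proof. by rewrite fine_ge0. Qed.

Lemma Pr_le1 A : measurable A -> Pr A <= 1.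
Proof.
move=> mA; rewrite -lee_fin fineK ?fin_num_measure//.
exact: probability_le1.
Qed.

Lemma PrT : Pr setT = 1.
Proof. by rewrite /Pr probability_setT. Qed.

Lemma Pr_fibers (Q : finType) (tau : X -> Q) A : mfin tau -> measurable A ->
  Pr A = \sum_q Pr (A `&` tau @^-1` [set q]).
Proof.
move=> mt mA; rewrite /Pr.
transitivity (\sum_q Int mu \1_(A `&` tau @^-1` [set q])); last first.
  by apply: eq_bigr => q _; rewrite Int_indic//; exact: measurableI.
rewrite -Int_sum; last by move=> q; apply: bmeas_indic; exact: measurableI.
rewrite -Int_indic//; congr Int; apply/funext => x.
rewrite (bigD1 (tau x)) //= big1 ?addr0; last first.
  move=> q qx; rewrite indicE memNset// => -[_ /= /esym/eqP].
  by rewrite (negbTE qx).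
rewrite !indicE; congr (_%:R); congr nat_of_bool.
by apply/idP/idP => [/set_mem h|/set_mem[h _]]; apply/mem_set.
Qed.

Definition Hfun (Q : finType) (tau : X -> Q) : R := \sum_q eta (Pr (tau @^-1` [set q])).

Lemma Pr_sum1 (Q : finType) (tau : X -> Q) : mfin tau -> \sum_q Pr (tau @^-1` [set q]) = 1.
Proof.
move=> mt; rewrite -PrT (@Pr_fibers _ tau setT)//.
by apply: eq_bigr => q _; rewrite setTI.
Qed.

Lemma Hfun_ge0 (Q : finType) (tau : X -> Q) : mfin tau -> 0 <= Hfun tau.
Proof. by move=> mt; apply: sumr_ge0 => q _; rewrite eta_ge0 ?Pr_ge0 ?Pr_le1. Qed.

Lemma Hfun_pair (Q S : finType) (tau : X -> Q) (h : X -> S) : mfin tau -> mfin h ->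
  Hfun (fun x => (tau x, h x)) <= Hfun tau + Hfun h.
Proof.
move=> mt mh; pose p q s := Pr (tau @^-1` [set q] `&` h @^-1` [set s]).
have E1 q : Pr (tau @^-1` [set q]) = \sum_s p q s by exact: Pr_fibers.
have E2 s : Pr (h @^-1` [set s]) = \sum_q p q s.
  by rewrite (Pr_fibers mt)//; apply: eq_bigr => q _; rewrite setIC.
have -> : Hfun (fun x => (tau x, h x)) = \sum_q \sum_s eta (p q s).
  rewrite pair_big; apply: eq_bigr => -[q s] _ /=; congr (eta (Pr _)).
  by apply/seteqP; split => [x [<- <-]//|x [/= -> ->]].
rewrite /Hfun; under [X in _ <= X + _]eq_bigr do rewrite E1.
under [X in _ <= _ + X]eq_bigr do rewrite E2.
apply: eta_subadditive => [q s|]; first exact: Pr_ge0.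
by under eq_bigr do rewrite -E1; exact: Pr_sum1.
Qed.

Lemma Hfun_bij (Q S : finType) (tau : X -> Q) (h : Q -> S) : bijective h ->
  Hfun (h \o tau) = Hfun tau.
Proof.
move=> [k hk kh]; rewrite /Hfun (reindex h) /=; last by exists k => x _.
apply: eq_bigr => q _; congr (eta (Pr _)).
by apply/seteqP; split => x /= => [/(can_inj hk)|->].
Qed.

Lemma Hfun_invariant (g : X -> X) (Q : finType) (tau : X -> Q) : f_invariant g mu -> mfin tau ->
  Hfun (tau \o g) = Hfun tau.
Proof.
move=> inv mt; apply: eq_bigr => q _; congr (eta _).
by rewrite /Pr comp_preimage inv.
Qed.

End FiniteMaps.

(** * Words read along orbits *)

Section Words.
Context {dm : measure_display} {X : measurableType dm} {R : realType}.
Variables (f : X -> X) (S : finType) (sigma : X -> S).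

Definition word n (x : X) : {ffun 'I_n -> S} := [ffun i : 'I_n => sigma (iter i f x)].

Lemma iter_invariant (mu : probability X R) n : measurable_fun setT f -> f_invariant f mu ->
  f_invariant (iter n f) mu.
Proof.
move=> mf inv; elim: n => [//|n IH] A mA.
have -> : iter n.+1 f @^-1` A = iter n f @^-1` (f @^-1` A) by [].
by rewrite IH ?inv// -[X in measurable X]setTI; exact: mf.
Qed.

Lemma measurable_iter n : measurable_fun setT f -> measurable_fun setT (iter n f).
Proof.
move=> mf; elim: n => [|n IH]; first exact: measurable_id.
exact: measurableT_comp mf IH.
Qed.

Lemma mfin_word n : measurable_fun setT f -> mfin sigma -> mfin (word n).
Proof.
move=> mf ms; apply: mfin_ffun => i; apply: mfin_precomp => //.
exact: measurable_iter.
Qed.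

Definition split_word m n (w : {ffun 'I_(m + n) -> S}) : {ffun 'I_m -> S} * {ffun 'I_n -> S} :=
  ([ffun i => w (lshift n i)], [ffun i => w (rshift m i)]).

Lemma split_word_bij m n : bijective (@split_word m n).
Proof.
exists (fun p : {ffun 'I_m -> S} * {ffun 'I_n -> S} =>
    [ffun k : 'I_(m + n) => match fintype.split k with inl i => p.1 i | inr j => p.2 j end]).
  move=> w; apply/ffunP => k; rewrite ffunE -[in RHS](splitK k).
  by case: (fintype.split k) => i /=; rewrite ffunE.
move=> [u v]; congr (_, _); apply/ffunP => i; rewrite !ffunE.
  by rewrite (unsplitK (inl i)).
by rewrite (unsplitK (inr i)).
Qed.

Lemma split_wordE m n x : split_word (word (m + n) x) = (word m x, word n (iter m f x)).
Proof.
by congr (_, _); apply/ffunP => i; rewrite !ffunE//= addnC iterD.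
Qed.

Lemma Hword_subadditive (mu : probability X R) m n : measurable_fun setT f -> mfin sigma ->
  f_invariant f mu -> Hfun mu (word (m + n)) <= Hfun mu (word m) + Hfun mu (word n).
Proof.
move=> mf ms inv; rewrite -(Hfun_bij mu (word (m + n)) (split_word_bij m n)).
have -> : @split_word m n \o word (m + n) = fun x => (word m x, (word n \o iter m f) x).
  by apply/funext => x /=; rewrite split_wordE.
have mi := measurable_iter m mf.
have mw k : mfin (word k) by exact: mfin_word.
apply: (le_trans (Hfun_pair mu (mw m) (mfin_precomp mi (mw n)))).
by rewrite lerD2l (Hfun_invariant (iter_invariant m mf inv)).
Qed.

Lemma Hword_cvg (mu : probability X R) : measurable_fun setT f -> mfin sigma ->
  f_invariant f mu -> cvgn (fun n => Hfun mu (word n) / n%:R).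
Proof.
move=> mf ms inv; apply: fekete => [n|m n]; last exact: Hword_subadditive.
by apply: Hfun_ge0; exact: mfin_word.
Qed.

End Words.

Section Partitions.
Context {dm : measure_display} {X : measurableType dm} {R : realType}.

Lemma partition_symbol (s : seq (set X)) : meas_partition s ->
  exists sigma : X -> 'I_(size s), mfin sigma /\
    forall i : 'I_(size s), sigma @^-1` [set i] = nth set0 s i.
Proof.
move=> [ms ds cs].
have /choice[sigma hs] : forall x, exists i : 'I_(size s), nth set0 s i x.
  by move=> x; have [i si hi] := cs x; exists (Ordinal si).
have E i : sigma @^-1` [set i] = nth set0 s i.
  apply/seteqP; split => x /= => [<-//|hi].
  apply/eqP/negPn/negP => ne.
  have : (nth set0 s (sigma x) `&` nth set0 s i) x by split.
  by rewrite ds.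
by exists sigma; split => // i; rewrite E; apply: ms; exact: mem_nth.
Qed.

Lemma Hjoin_word (f : X -> X) (mu : probability X R) (s : seq (set X)) (sigma : X -> 'I_(size s)) n :
  (forall i : 'I_(size s), sigma @^-1` [set i] = nth set0 s i) ->
  Hjoin f mu s n = Hfun mu (word f sigma n).
Proof.
move=> E; apply: eq_bigr => w _; congr (eta (Pr mu _)).
apply/seteqP; split => x /= h.
  apply/ffunP => i; rewrite ffunE; have := h i.
  by rewrite -E.
by move=> i; rewrite -E /= -h ffunE.
Qed.

(** [h_part] is a [limn], informative only once convergence is known; subadditivity of the entropy
    of words supplies it. *)
Lemma Hjoin_cvg (f : X -> X) (mu : probability X R) (s : seq (set X)) :
  measurable_fun setT f -> f_invariant f mu -> meas_partition s ->
  (fun n => Hjoin f mu s n / n%:R) @ \oo --> h_part f mu s.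
Proof.
move=> mf inv ps; have [sigma [ms E]] := partition_symbol ps.
suff : cvgn (fun n => Hjoin f mu s n / n%:R) by [].
under eq_fun do rewrite (Hjoin_word _ _ _ E).
exact: Hword_cvg.
Qed.

End Partitions.

(** * Covers by Bowen balls from entropy *)

Section NullSpheres.
Context {dm : measure_display} {X : measurableType dm} {R : realType}.
Variable d : X -> X -> R.
Hypothesis dP : is_metric d.
Hypothesis dB : borel_sets d.
Hypothesis dK : d_compact d.
Variable mu : probability X R.

Lemma Pr_cover (I : finType) (A : set X) (F : I -> set X) : measurable A ->
  (forall i, measurable (F i)) -> (forall x, A x -> exists i, F i x) ->
  Pr mu A <= \sum_i Pr mu (F i).
Proof.
move=> mA mF AF; rewrite /Pr -Int_indic//.
under eq_bigr do rewrite -Int_indic//.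
have bF i : bmeas (\1_(F i) : X -> R) by exact: bmeas_indic.
rewrite -Int_sum//; apply: Int_le; [exact: bmeas_indic|exact: bmeas_sum|].
move=> x; rewrite indicE; have [/set_mem/AF[i Fi]|_] := boolP (x \in A); last first.
  by apply: sumr_ge0 => i _; rewrite indicE.
by rewrite (bigD1 i) //= indicE mem_set//= lerDl sumr_ge0// => j _; rewrite indicE.
Qed.

(** Distinct level sets are disjoint, so only finitely many have mass above [1/(k+1)]. The charged
    levels are therefore countable, whereas the interval has positive Lebesgue measure. *)
Lemma null_level (g : X -> R) (a b : R) : measurable_fun setT g -> a < b ->
  exists r, [/\ a < r, r < b & Pr mu [set x | g x = r] = 0].
Proof.
move=> mg ab; apply: contrapT => no.
have mS r : measurable [set x | g x = r].
  rewrite -[X in measurable X]setTI.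
  exact: (mg measurableT [set r] (measurable_set1 r)).
have pos r : `]a, b[%classic r -> exists k : nat, k.+1%:R^-1 < Pr mu [set x | g x = r].
  rewrite /= in_itv /= => /andP[ar rb].
  have P0 : 0 < Pr mu [set x | g x = r].
    rewrite lt_def Pr_ge0 andbT; apply/negP => /eqP h; apply: no; exists r; split => //.
  by have [N _ /(_ N (leqnn N))] := near_infty_natSinv_lt (PosNum P0); exists N.
pose A k := [set r | k.+1%:R^-1 < Pr mu [set x | g x = r]].
have fA k : finite_set (A k).
  apply: contrapT => /(infinite_set_fset k.+2)[B BA sB].
  have : \sum_(r <- finmap.enum_fset B) Pr mu [set x | g x = r] <= 1.
    rewrite /Pr; under eq_bigr do rewrite -Int_indic//.
    rewrite -Int_sum; last by move=> r; exact: bmeas_indic.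
    rewrite -[leRHS](Int_cst mu); apply: Int_le.
    - by apply: bmeas_sum => r; exact: bmeas_indic.
    - exact: bmeas_cst.
    move=> x; have uB : uniq (finmap.enum_fset B) by exact: finmap.fset_uniq.
    have [gB|gB] := boolP (g x \in finmap.enum_fset B).
      rewrite (big_rem _ gB) /= big_seq big1 ?addr0; last first.
        move=> r; rewrite mem_rem_uniq// inE => /andP[rg _].
        by rewrite indicE memNset//= => /esym/eqP; rewrite (negbTE rg).
      by rewrite indicE; case: (_ \in _).
    rewrite big_seq big1// => r rB; rewrite indicE memNset//= => gr.
    by move: gB; rewrite gr rB.
  apply/negP; rewrite -ltNge.
  have kk : (1 : R) < (size (finmap.enum_fset B))%:R * k.+1%:R^-1.
    by rewrite ltr_pdivlMr ?ltr0n// mul1r ltr_nat.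
  apply: (lt_le_trans kk); rewrite -sum1_size natr_sum mulr_suml big_seq [leRHS]big_seq.
  by apply: ler_sum => r rB; rewrite mul1r ltW//; exact: BA.
have cI : countable `]a, b[%classic.
  have s : `]a, b[%classic `<=` \bigcup_k A k.
    by move=> r /pos[k hk]; exists k.
  apply: (sub_countable (subset_card_le s)).
  apply: bigcup_countable => // k _; exact: finite_set_countable.
have := countable_lebesgue_measure0 cI.
rewrite lebesgue_measure_itv /= lte_fin ab => /eqP.
by rewrite -EFinB eqe subr_eq0 => /eqP ba; move: ab; rewrite ba ltxx.
Qed.

Lemma rcont_d x : rcont d (d x).
Proof.
move=> y e e0; exists e => // z yz; rewrite ltr_norml.
have := d_tri dP x y z; have := d_tri dP x z y; rewrite (d_sym dP z y).
by lra.
Qed.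

(* The open kernels [O i] exhaust the space up to a null set: only the spheres, chosen null, are lost. *)
Lemma adapted_partition (e : R) : 0 < e -> exists s : seq (set X), meas_partition s /\
  (forall i x y, (i < size s)%N -> nth set0 s i x -> nth set0 s i y -> d x y < e) /\
  exists O : nat -> set X, [/\ forall i, d_open d (O i),
    forall i, (i < size s)%N -> O i `<=` nth set0 s i &
    Pr mu [set x | forall i, (i < size s)%N -> ~ O i x] = 0].
Proof.
move=> e0.
have /choice[r hr] : forall x, exists r, [/\ 0 < r, r < e / 2 & Pr mu [set y | d x y = r] = 0].
  move=> x; apply: null_level; last by rewrite divr_gt0.
  by apply: (rcont_measurable dB); exact: rcont_d.
have [n [c hc]] : exists (n : nat) (c : 'I_n -> X), forall x, exists k, d (c k) x < r (c k).
  by apply: (ball_cover dP dK) => x; case: (hr x).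
(* The centres are indexed by [nat] because a partition is a list addressed by [nth]; the default
   [point] occurs only from index [n] on. *)
pose ct i : X := nth point (codom c) i.
have ctE (k : 'I_n) : ct k = c k.
  by rewrite /ct /codom (nth_map k) ?size_enum_ord// nth_ord_enum.
pose B i : set X := [set y | d (ct i) y < r (ct i)].
pose A i : set X := [set y | B i y /\ forall j : 'I_i, ~ B j y].
pose O i : set X := [set y | B i y /\ forall j : 'I_i, r (ct j) < d (ct j) y].
have oB i : d_open d (B i) by exact: d_open_ball.
have oO i : d_open d (O i).
  apply: (d_openI (oB i)); apply: d_open_forall => j.
  exact: d_openC_closed_ball.
have mA i : measurable (A i).
  apply: measurableI; first exact: (d_open_measurable dB).
  rewrite (_ : (fun y => _) = \bigcap_(j in [set: 'I_i]) ~` B j).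
    apply: fin_bigcap_measurable => [|j _]; first exact: finite_finset.
    by apply: measurableC; exact: (d_open_measurable dB).
  by apply/seteqP; split => y /= h j; [move=> _; exact: h|exact: h].
have fst x : exists2 i, (i < n)%N & A i x.
  have : exists i, (i < n)%N && `[< B i x >].
    have [k hk] := hc x; exists (nat_of_ord k); rewrite ltn_ord /=; apply/asboolP.
    by rewrite /B /= ctE.
  move=> /ex_minnP[i /andP[i_n /asboolP Bi] imin]; exists i => //; split => // j Bj.
  have := imin j; rewrite (ltn_trans (ltn_ord j) i_n) /= => h.
  have : (i <= j)%N by apply: h; apply/asboolP.
  by rewrite leqNgt ltn_ord.
have dA i j x : (i < j)%N -> A i x -> A j x -> False.
  by move=> ij [Bi _] [_ /(_ (Ordinal ij))]; apply.
have szs : size (mkseq A n) = n by rewrite size_mkseq.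
exists (mkseq A n); rewrite szs; split; [split|split].
- by move=> _ /mapP[i _ ->].
- move=> i j; rewrite szs => i_n j_n ij; rewrite !nth_mkseq//.
  apply/seteqP; split => // x [/= Ai Aj].
  move: ij; rewrite neq_ltn => /orP[ij|ij]; [exact: (dA _ _ _ ij Ai Aj)|exact: (dA _ _ _ ij Aj Ai)].
- by move=> x; have [i i_n Ai] := fst x; exists i; rewrite ?szs ?nth_mkseq.
- move=> i x y i_n; rewrite nth_mkseq// => -[Bx _] [By _].
  apply: (le_lt_trans (d_tri dP x (ct i) y)); rewrite (d_sym dP).
  by move: Bx By; rewrite /B /=; case: (hr (ct i)); lra.
- exists O; split => //.
    move=> i i_n; rewrite nth_mkseq// => x [Bx h]; split => // j /=.
    by rewrite /B /=; apply/negP; rewrite -leNgt ltW.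
  apply/eqP; rewrite eq_le Pr_ge0 andbT.
  have mS (j : 'I_n) : measurable [set y | d (ct j) y = r (ct j)].
    rewrite -[X in measurable X]setTI.
    exact: (rcont_measurable dB (rcont_d _) measurableT (measurable_set1 _)).
  have <- : \sum_(j < n) Pr mu [set y | d (ct j) y = r (ct j)] = 0.
    by apply: big1 => j _; case: (hr (ct j)).
  apply: Pr_cover => //.
    rewrite (_ : [set x | _] = \bigcap_(i in [set: 'I_n]) ~` O i).
      apply: fin_bigcap_measurable => [|j _]; first exact: finite_finset.
      by apply: measurableC; exact: (d_open_measurable dB).
    apply/seteqP; split => y /= h; first by move=> i _; exact: h.
    by move=> i i_n; exact: (h (Ordinal i_n)).
  move=> x hx; have [i i_n [Bi nB]] := fst x.
  apply: contrapT => no; apply: (hx i i_n); split => // j.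
  have j_n : (j < n)%N := ltn_trans (ltn_ord j) i_n.
  rewrite lt_neqAle; apply/andP; split; last by rewrite leNgt; apply/negP; exact: nB.
  by apply/eqP => h; apply: no; exists (Ordinal j_n).
Qed.

End NullSpheres.

(** * Smoothed distributions and likelihood counts *)

Section Counting.
Context {R : realType}.

(** Each mass is increased by [k] and the sum renormalised. Raising the masses only raises the
    logarithms, and the normaliser costs at most [ln (1 + k * N) <= k * N], which the choice of [k]
    keeps below [K] minus the entropy. Positivity everywhere bounds the logarithms of all words from
    below. *)
Lemma smoothing (W : finType) (p : W -> R) (K : R) : (forall w, 0 <= p w) -> \sum_w p w = 1 ->
  \sum_w eta (p w) < K ->
  exists q : W -> R, [/\ forall w, 0 < q w, \sum_w q w = 1 & - K < \sum_w p w * ln (q w)].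
Proof.
move=> p0 p1 pK; pose N : R := #|W|%:R.
have N0 : 0 <= N by rewrite ler0n.
pose k := (K - \sum_w eta (p w)) / (2 * (N + 1)).
have k0 : 0 < k by rewrite divr_gt0 ?subr_gt0// mulr_gt0//; lra.
have Z0 : 0 < 1 + k * N by have := mulr_ge0 (ltW k0) N0; lra.
have pk0 w : 0 < p w + k by have := p0 w; lra.
exists (fun w => (p w + k) / (1 + k * N)); split.
- by move=> w; rewrite divr_gt0.
- rewrite -mulr_suml big_split /= p1 sumr_const -mulr_natr -/N divff//.
  exact: lt0r_neq0.
have kN : k * N < K - \sum_w eta (p w).
  rewrite /k mulrAC ltr_pdivrMr; last by rewrite mulr_gt0//; lra.
  by rewrite ltr_pM2l ?subr_gt0//; lra.
apply: (@lt_le_trans _ _ (\sum_w (- eta (p w) - p w * (k * N)))).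
  by rewrite sumrB sumrN -mulr_suml p1 mul1r; lra.
apply: ler_sum => w _.
rewrite ln_div ?posrE// mulrBr; apply: lerB; last first.
  apply: ler_wpM2l => //; have := ln_le_sub1 Z0; lra.
have [->|word_mass] := eqVneq (p w) 0; first by rewrite /eta !mul0r oppr0.
have pw0 : 0 < p w by rewrite lt_def word_mass p0.
by rewrite /eta opprK ler_wpM2l// ler_ln ?posrE//; lra.
Qed.

Lemma sum_residues (m q : nat) (F : nat -> R) :
  \sum_(j < m) \sum_(b < q) F (j + b * m)%N = \sum_(i < q * m) F i.
Proof.
rewrite exchange_big /= -[RHS](big_mkord xpredT) big_nat_mul big_mkord.
apply: eq_bigr => b _; rewrite mulSn addnC -{2}[(b * m)%N]add0n addnC.
rewrite [in RHS]addnC big_addn -addnBAC// subnn add0n big_mkord.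
by apply: eq_bigr.
Qed.

(** Markov's inequality for the counting measure: the products are the masses of a product
    probability and add up to 1. *)
Lemma card_large_products (W : finType) (k : nat) (q : W -> R) (t : R) :
  (forall w, 0 < q w) -> \sum_w q w = 1 -> 0 < t ->
  #|[set u : {ffun 'I_k -> W} | t <= \prod_b q (u b)]%SET|%:R * t <= 1.
Proof.
move=> q0 q1 t0.
have E : \sum_(u : {ffun 'I_k -> W}) \prod_b q (u b) = 1.
  by rewrite -(bigA_distr_bigA (fun _ => q)) big1.
rewrite -[leRHS]E -sum1_card natr_sum mulr_suml big_mkcond /=.
apply: ler_sum => u _; rewrite inE; case: ifP => h; first by rewrite mul1r.
by apply: prodr_ge0 => b _; exact: ltW.
Qed.

End Counting.

Section EntropyCover.
Context {dm : measure_display} {X : measurableType dm} {R : realType}.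
Variable d : X -> X -> R.
Hypothesis dP : is_metric d.
Hypothesis dB : borel_sets d.
Hypothesis dK : d_compact d.
Variable f : X -> X.
Hypothesis fC : d_cont d f.
Variable mu : probability X R.
Hypothesis inv : f_invariant f mu.

Lemma dn_lt n x y (e : R) : 0 < e -> (forall i, (i < n)%N -> d (iter i f x) (iter i f y) < e) ->
  dn d f n x y < e.
Proof. by move=> e0 h; rewrite /dn; apply: bigmax_lt => // i _; exact: h. Qed.

(* [g] is a continuous minorant of the log-likelihood [ln (q (word m x))] of the smoothed
   block distribution; a lower bound on its Birkhoff average bounds from below the likelihood of
   one of the [m] block decompositions of the orbit, and likelihoods sum to 1. *)
Lemma entropy_minorant (S : finType) (sigma : X -> S) (O : S -> set X) (m : nat) (K : R) :
  mfin sigma -> (forall a, d_open d (O a)) -> (forall a, O a `<=` sigma @^-1` [set a]) ->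
  Pr mu [set x | forall a, ~ O a x] = 0 -> Hfun mu (word f sigma m) < K ->
  exists (g : X -> R) (eta0 : R) (q : {ffun 'I_m -> S} -> R),
    [/\ rcont d g, 0 < eta0, (forall w, 0 < q w) /\ \sum_w q w = 1,
      forall x, g x <= ln (q (word f sigma m x)) & - K < Int mu g - eta0].
Proof.
move=> ms oO OS O0 HK.
have mf := d_cont_measurable dB fC.
have mw : mfin (word f sigma m) by exact: mfin_word.
pose p w := Pr mu (word f sigma m @^-1` [set w]).
have [q [q0 q1 qK]] := smoothing (fun w => Pr_ge0 mu _) (Pr_sum1 mu mw) HK.
(* Open subset of the cylinder of [w]; by [PO] it has lost no mass. *)
pose OW (w : {ffun 'I_m -> S}) := [set x | forall i : 'I_m, O (w i) (iter i f x)].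
have oOW w : d_open d (OW w).
  apply: d_open_forall => i; apply: (d_open_preimage (g := iter i f)) => //.
  exact: d_cont_iter.
have OWw w : OW w `<=` word f sigma m @^-1` [set w].
  by move=> x h; apply/ffunP => i; rewrite ffunE; exact: (OS _ _ (h i)).
have mN : measurable [set x | forall a, ~ O a x].
  rewrite (_ : [set x | _] = \bigcap_(a in [set: S]) ~` O a).
    apply: fin_bigcap_measurable => [|j _]; first exact: finite_finset.
    by apply: measurableC; exact: (d_open_measurable dB).
  by apply/seteqP; split => y /= h a; [move=> _; exact: h|exact: h].
have mOW w : measurable (OW w) by exact: (d_open_measurable dB).
(* The cylinder of [w] is covered by [OW w] and [m] preimages of the set outside all kernels, which
   are null by invariance. *)
have PO w : p w <= Pr mu (OW w).
  pose F (i : option 'I_m) := if i is Some i then iter i f @^-1` [set x | forall a, ~ O a x] else OW w.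
  have mF i : measurable (F i).
    case: i => [i|]; last exact: mOW.
    by rewrite -[X in measurable X]setTI; exact: (measurable_iter i mf).
  apply: (@le_trans _ _ (\sum_i Pr mu (F i))).
    apply: Pr_cover => // x xw; apply: contrapT => no; apply: (no); exists None => i.
    have [a Oa] : exists a, O a (iter i f x).
      apply: contrapT => na; apply: no; exists (Some i) => a Oa; apply: na; by exists a.
    suff -> : w i = a by [].
    by rewrite -xw ffunE; exact: (OS _ _ Oa).
  rewrite (bigD1 None) //= big1 ?addr0// => -[i|//] _ /=.
  by rewrite /Pr (iter_invariant i mf inv).
(* A common lower bound for all [ln (q w)]: above the base level [l] the bumps have nonnegative
   coefficients, so that bumps below the indicators give a minorant. *)
pose l : R := \sum_w ln (q w).
have q_le1 w : q w <= 1.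
  by rewrite -q1 (bigD1 w) //= lerDl sumr_ge0// => v _; exact: ltW.
have lq0 w : ln (q w) <= 0 by rewrite ln_le0.
have lq w : l <= ln (q w).
  by rewrite /l (bigD1 w) //= gerDl sumr_le0.
(* One third of the slack pays for the bumps, one third is [eta0], the last leaves the inequality
   strict. *)
pose gap := (\sum_w p w * ln (q w) + K) / 3.
have gap0 : 0 < gap by rewrite divr_gt0//; move: qK; rewrite -/p; lra.
pose D := \sum_w (ln (q w) - l).
have D0 : 0 <= D by apply: sumr_ge0 => w _; rewrite subr_ge0.
pose tau := gap / (D + 1).
have tau0 : 0 < tau by rewrite divr_gt0//; lra.
have /choice[k hk] : forall w, exists k, Pr mu (OW w) - tau < Int mu (bump d (OW w) k).
  by move=> w; apply: Int_bump_approx.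
pose phi w := bump d (OW w) (k w).
have cphi w : rcont d (phi w) by exact: rcont_bump.
exists (fun x => l + \sum_w (ln (q w) - l) * phi w x), gap, q.
have cg : rcont d (fun x => l + \sum_w (ln (q w) - l) * phi w x).
  apply: rcontD; first exact: rcont_cst.
  by apply: rcont_sum => w; exact: rcontZ.
split => //.
  move=> x; set w := word f sigma m x; rewrite (bigD1 w) //= big1 ?addr0; last first.
    move=> v vw; rewrite /phi (bump_notin dP) ?mulr0// => /OWw /= xv.
    by move: vw; rewrite -xv eqxx.
  have := bump_le1 d (OW w) (k w) x; rewrite -/(phi w x) => ph.
  have := ler_wpM2l (_ : 0 <= ln (q w) - l) ph; rewrite subr_ge0 mulr1 => /(_ (lq w)).
  by lra.
have bphi w : bmeas (phi w) by exact: (rcont_bmeas dP dB dK).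
rewrite IntD; [|exact: bmeas_cst|by apply: bmeas_sum => w; exact: bmeasZ].
rewrite Int_cst Int_sum; last by move=> w; exact: bmeasZ.
have h1 : \sum_w (ln (q w) - l) * (p w - tau) <= \sum_w Int mu (fun x => (ln (q w) - l) * phi w x).
  apply: ler_sum => w _; rewrite IntZ//; apply: ler_wpM2l; first by rewrite subr_ge0.
  by have := hk w; have := PO w; rewrite -/(phi w); lra.
have h2 : \sum_w (ln (q w) - l) * (p w - tau) = \sum_w p w * ln (q w) - l - tau * D.
  have p1 : \sum_w p w = 1 by exact: Pr_sum1.
  transitivity (\sum_w (p w * ln (q w) - l * p w - tau * (ln (q w) - l))).
    by apply: eq_bigr => w _; ring.
  by rewrite !sumrB -!mulr_sumr p1 mulr1.
have h3 : tau * D <= gap.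
  by rewrite /tau mulrAC ler_pdivrMr ?ler_pM2l//; lra.
have h4 : \sum_w p w * ln (q w) + K = gap * 3 by rewrite /gap divfK.
by lra.
Qed.

Lemma likelihood_cover (S : finType) (sigma : X -> S) (m : nat) (q : {ffun 'I_m -> S} -> R) (c e : R) :
  (0 < m)%N -> (forall w, 0 < q w) -> \sum_w q w = 1 -> 0 < e ->
  (forall x y, sigma x = sigma y -> d x y < e) ->
  exists C : R, forall n, exists (N : nat) (l : 'I_N -> X),
    N%:R <= C * expR (n%:R * c) /\
    forall x, - (n%:R * (m%:R * c)) <= \sum_(i < n) ln (q (word f sigma m (iter i f x))) ->
      exists k, dn d f n (l k) x < e.
Proof.
move=> m0 q0 q1 e0 small; pose W := {ffun 'I_m -> S}.
pose l : R := \sum_w ln (q w).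
have q_le1 w : q w <= 1.
  by rewrite -q1 (bigD1 w) //= lerDl sumr_ge0// => v _; exact: ltW.
have lq0 w : ln (q w) <= 0 by rewrite ln_le0.
have lq w : l <= ln (q w) by rewrite /l (bigD1 w) //= gerDl sumr_le0.
(* The factors count the offsets and the initial words and pay for the blocks that overrun time
   [n]. *)
exists (m%:R * #|{: W}|%:R * expR (- l)) => n.
pose k := (n %/ m).+1.
(* The word at time 0 fixes the letters before time [m], the [k] blocks from offset [j] those from
   [j] to beyond [n]; together they determine the first [n] letters. *)
pose code (j : 'I_m) x : W * {ffun 'I_k -> W} :=
  (word f sigma m x, [ffun b : 'I_k => word f sigma m (iter (j + b * m) f x)]).
pose t := expR (- (n%:R * c) + l).
have t0 : 0 < t by exact: expR_gt0.
pose T := [set z : 'I_m * (W * {ffun 'I_k -> W}) | t <= \prod_b q (z.2.2 b)]%SET.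
have cardT : #|T|%:R <= m%:R * #|{: W}|%:R * expR (- l) * expR (n%:R * c).
  pose U := [set u : {ffun 'I_k -> W} | t <= \prod_b q (u b)]%SET.
  have -> : #|T| = (m * (#|{: W}| * #|U|))%N.
    rewrite (_ : T = finset.setX [set: 'I_m]%SET (finset.setX [set: W]%SET U)).
      by rewrite !cardsX !cardsT card_ord.
    by apply/finset.setP => -[j [w u]]; rewrite !inE.
  have hU := card_large_products k q0 q1 t0.
  rewrite -ler_pdivlMr// div1r in hU.
  rewrite !natrM -!mulrA; apply: ler_wpM2l => //; apply: ler_wpM2l => //.
  apply: (le_trans hU); rewrite /t -expRN -expRD ler_expR; lra.
have [rep hrep] : exists rep : 'I_m * (W * {ffun 'I_k -> W}) -> X,
    forall j x, code j (rep (j, code j x)) = code j x.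
  have /choice[rep hrep] : forall z : 'I_m * (W * {ffun 'I_k -> W}), exists y,
      (exists x, code z.1 x = z.2) -> code z.1 y = z.2.
    move=> z; have [[x hx]|no] := pselect (exists x, code z.1 x = z.2); first by exists x.
    by exists point.
  by exists rep => j x; apply: (hrep (j, code j x)); exists x.
exists #|T|, (fun i => rep (enum_val i)); split => // x hx.
have km : (n < k * m)%N by rewrite /k ltn_ceil.
have km2 : (k * m <= n + m)%N by rewrite /k mulSn addnC leq_add2r leq_trunc_div.
pose G i : R := ln (q (word f sigma m (iter i f x))).
(* Pigeonhole over the offsets: their likelihood sums run through all times below [k * m], and the
   at most [m] times from [n] on contribute at least [l] each. *)
have [j hj] : exists j : 'I_m, - (n%:R * c) + l <= \sum_(b < k) G (j + b * m)%N.
  apply: contrapT => no.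
  have : \sum_(j < m) \sum_(b < k) G (j + b * m)%N < \sum_(j < m) (- (n%:R * c) + l).
    have hlt (j : 'I_m) : \sum_(b < k) G (j + b * m)%N < - (n%:R * c) + l.
      by rewrite ltNge; apply/negP => h; apply: no; exists j.
    apply: ltr_sum => //; apply/hasP; exists (Ordinal m0) => //.
  rewrite sum_residues sumr_const card_ord; apply/negP; rewrite -leNgt.
  rewrite -(subnKC (ltnW km)) big_split_ord /=.
  have h2 : m%:R * l <= \sum_(i < k * m - n) G (n + i)%N.
    apply: (@le_trans _ _ (\sum_(i < k * m - n) l)); last by apply: ler_sum => i _; exact: lq.
    rewrite sumr_const card_ord -[leRHS]mulr_natl; apply: ler_wnM2r.
      by rewrite /l sumr_le0.
    by rewrite ler_nat leq_subLR.
  apply: le_trans (lerD hx h2); rewrite -mulr_natl; lra.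
have xT : (j, code j x) \in T.
  rewrite inE /= /t; rewrite (_ : \prod_b _ = expR (\sum_(b < k) G (j + b * m)%N)).
    by rewrite ler_expR.
  rewrite expR_sum; apply: eq_bigr => b _.
  by rewrite ffunE /G lnK ?posrE.
exists (enum_rank_in xT (j, code j x)); rewrite enum_rankK_in//.
set y := rep _; have [hw hu] : code j y = code j x by exact: hrep.
apply: dn_lt => // i i_n; apply: small.
have [im|mi] := ltnP i m.
  by move/ffunP/(_ (Ordinal im)): hw; rewrite !ffunE.
pose b := ((i - j) %/ m)%N; pose r := ((i - j) %% m)%N.
have ij : (j <= i)%N by exact: leq_trans (ltnW (ltn_ord j)) mi.
have bk : (b < k)%N.
  by rewrite /b /k ltnS leq_div2r// (leq_trans (leq_subr _ _))// ltnW.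
have rm : (r < m)%N by rewrite ltn_mod.
have E : i = (r + (j + b * m))%N.
  by rewrite addnCA [(r + _)%N]addnC -divn_eq subnKC.
move/ffunP/(_ (Ordinal bk)): hu; rewrite !ffunE => /ffunP/(_ (Ordinal rm)).
by rewrite !ffunE /= -!iterD -E.
Qed.

(** The condition on [x] puts its empirical measure into a weak* neighbourhood of [mu], so it holds
    for infinitely many [n] whenever [mu] is a limit point; the constant [C] is the same for all
    [n]. *)
Lemma entropy_cover (c e : R) : (h_mu f mu < c%:E)%E -> 0 < e ->
  exists (g : X -> R) (eta0 C : R), [/\ rcont d g, 0 < eta0 &
    forall n, (0 < n)%N -> exists (N : nat) (l : 'I_N -> X),
      N%:R <= C * expR (n%:R * c) /\
      forall x, Int mu g - eta0 < Int (emp f n x) g -> exists k, dn d f n (l k) x < e].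
Proof.
move=> hc e0; have [s [pps [sml [V [oV VA V0]]]]] := adapted_partition dP dB dK mu e0.
have mf := d_cont_measurable dB fC.
have [sigma [ms E]] := partition_symbol pps.
have hs : h_part f mu s < c.
  by rewrite -lte_fin; apply: le_lt_trans hc; apply: ereal_sup_ubound; exists s.
have [m m0 hm] : exists2 m, (0 < m)%N & Hjoin f mu s m < m%:R * c.
  have /cvgrPdist_lt/(_ (c - h_part f mu s)) := Hjoin_cvg mf inv pps.
  rewrite subr_gt0 => /(_ hs)[N _ /(_ N.+1 (leqnSn N))] /=.
  rewrite ltr_norml => /andP[h _]; exists N.+1 => //.
  have : Hjoin f mu s N.+1 / N.+1%:R < c by move: h; rewrite opprB ltrD2l ltrN2.
  by rewrite ltr_pdivrMr ?ltr0n// mulrC.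
rewrite (Hjoin_word _ _ _ E) in hm.
have [|a||g [eta0 [q [cg eta00 [q0 q1] gq gK]]]] := entropy_minorant (O := fun a : 'I_(size s) => V a) ms _ _ _ hm.
- by move=> a; exact: oV.
- by rewrite E; exact: VA.
- rewrite -[RHS]V0; congr (Pr mu _); apply/seteqP; split => x /= h.
    by move=> i si; exact: (h (Ordinal si)).
  by move=> i; exact: h.
have [|C hC] := likelihood_cover (sigma := sigma) c m0 q0 q1 e0.
  move=> x y xy; apply: (sml (sigma x)) => //; rewrite -E//=.
exists g, eta0, C; split => // n n0; have [N [l [hN hl]]] := hC n.
exists N, l; split => // x hx; apply: hl.
apply: (@le_trans _ _ (\sum_(i < n) g (iter i f x))); last by apply: ler_sum => i _.
move: hx; rewrite Int_empE; last exact: (rcont_bmeas dP dB dK).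
move=> hx; have := lt_trans gK hx; rewrite ltr_pdivlMl ?ltr0n// => /ltW.
by rewrite mulrN.
Qed.

End EntropyCover.

(** * Bowen entropy *)

Section RealAux.
Context {R : realType}.

Lemma esum_le_seq (T : choiceType) (C : set T) (a : T -> R) (M : R) :
  (forall s : seq T, uniq s -> (forall p, p \in s -> C p) -> \sum_(p <- s) a p <= M) ->
  (\esum_(p in C) (a p)%:E <= M%:E)%E.
Proof.
move=> h; apply: ge_ereal_sup => _ [F [fF FC] <-].
rewrite fsbig_finite// sumEFin lee_fin; apply: h; first exact: finmap.fset_uniq.
by move=> p; rewrite in_fset_set// => /set_mem/FC.
Qed.

Lemma geometric_tail (r : R) (N M : nat) : 0 <= r -> r < 1 ->
  \sum_(n < M | (N <= n)%N) r ^+ n <= r ^+ N / (1 - r).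
Proof.
move=> r0 r1; have r10 : 0 < 1 - r by rewrite subr_gt0.
rewrite ler_pdivlMr// mulr_suml.
have [MN|NM] := leqP M N.
  rewrite big1 ?exprn_ge0// => i Ni; have := leq_trans (ltn_ord i) MN.
  by rewrite ltnNge Ni.
under eq_bigr do rewrite mulrBr mulr1 -exprSr.
rewrite -(big_mkord (fun n => N <= n)%N (fun n => r ^+ n - r ^+ n.+1)).
rewrite (_ : \sum_(0 <= i < M | (N <= i)%N) _ = \sum_(N <= i < M) (r ^+ i - r ^+ i.+1)); last first.
  by rewrite [RHS](big_nat_widenl _ 0).
under eq_bigr do rewrite -opprB.
rewrite sumrN telescope_sumr ?(ltnW NM)// opprB gerBl exprn_ge0//.
Qed.

Lemma exprn_small (r t : R) : 0 <= r -> r < 1 -> 0 < t -> exists N, forall n, (N <= n)%N -> r ^+ n < t.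
Proof.
move=> r0 r1 t0; have : `|r| < 1 by rewrite ger0_norm.
move=> /cvg_expr/cvgrPdist_lt/(_ t t0)[N _ hN]; exists N => n /hN /=.
by rewrite sub0r normrN ger0_norm// exprn_ge0.
Qed.

Lemma half_series_le (t : R) K : 0 <= t -> \sum_(k < K) t / 2 ^+ k.+1 <= t.
Proof.
move=> t0; suff : \sum_(k < K) t / 2 ^+ k.+1 = t - t / 2 ^+ K.
  by move=> ->; rewrite gerBl divr_ge0// exprn_ge0.
elim: K => [|K IH]; first by rewrite big_ord0 expr0 divr1 subrr.
rewrite big_ord_recr /= IH exprS invfM.
by field; rewrite expf_neq0.
Qed.

Lemma sum_uniq_eq (T : eqType) (s : seq T) (z : T) (a : R) : uniq s -> 0 <= a ->
  \sum_(p <- s) (if p == z then a else 0) <= a.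
Proof.
move=> us a0; rewrite -big_mkcond big_const_seq iter_addr_0.
have -> : count (eq_op^~ z) s = (z \in s) by exact: count_uniq_mem.
by case: (z \in s); rewrite ?mulr1n ?mulr0n.
Qed.

End RealAux.

Section BowenEntropy.
Context {dm : measure_display} {X : measurableType dm} {R : realType}.
Variable d : X -> X -> R.
Variable f : X -> X.

Local Open Scope ereal_scope.

Lemma Gamma_sub (Z1 Z2 : set X) (N1 N2 : nat) (e1 e2 : R) : Z1 `<=` Z2 -> (N1 <= N2)%N ->
  (e2 <= e1)%R -> Gamma d f Z2 N2 e2 `<=` Gamma d f Z1 N1 e1.
Proof.
move=> Z12 N12 e21 C [cC hN hc]; split => // [p /hN|x /Z12/hc[p Cp Bp]].
  exact: leq_trans.
by exists p => //; rewrite /Bn /=; exact: lt_le_trans Bp e21.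
Qed.

Lemma mZN_mono (Z1 Z2 : set X) (s : R) (N1 N2 : nat) (e1 e2 : R) : Z1 `<=` Z2 -> (N1 <= N2)%N ->
  (e2 <= e1)%R -> mZN d f Z1 s N1 e1 <= mZN d f Z2 s N2 e2.
Proof.
move=> Z12 N12 e21; apply: le_ereal_inf => _ [C GC <-].
by exists C => //; exact: Gamma_sub GC.
Qed.

Lemma mZN_ge0 Z s N (e : R) : 0 <= mZN d f Z s N e.
Proof.
apply: le_ereal_inf_tmp => _ [C _ <-]; apply: esum_ge0 => p _.
by rewrite lee_fin expR_ge0.
Qed.

Lemma mZN_le_s Z (s t : R) N (e : R) : (s <= t)%R -> mZN d f Z t N e <= mZN d f Z s N e.
Proof.
move=> st; apply: le_ereal_inf_tmp => _ [C GC <-].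
apply: (@le_trans _ _ (\esum_(p in C) (expR (- (p.2%:R * t)))%:E)).
  by apply: ereal_inf_lbound; exists C.
apply: le_esum => p _; rewrite lee_fin ler_expR lerN2.
by apply: ler_wpM2l.
Qed.

Lemma mZ_cvg Z s (e : R) : cvgn (fun N => mZN d f Z s N e).
Proof. by apply: ereal_nondecreasing_is_cvgn => N M NM; exact: mZN_mono. Qed.

Lemma mZ_mono (Z1 Z2 : set X) (s : R) (e1 e2 : R) : Z1 `<=` Z2 ->
  (e2 <= e1)%R -> mZ d f Z1 s e1 <= mZ d f Z2 s e2.
Proof.
move=> Z12 e21; apply: lee_lim; [exact: mZ_cvg|exact: mZ_cvg|].
by apply: nearW => N; exact: mZN_mono.
Qed.

Lemma mZ_ge0 Z s (e : R) : 0 <= mZ d f Z s e.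
Proof. by apply: lime_ge; [exact: mZ_cvg|apply: nearW => N; exact: mZN_ge0]. Qed.

Lemma htopZ_mono (Z1 Z2 : set X) (e1 e2 : R) : Z1 `<=` Z2 -> (e2 <= e1)%R ->
  htopZ d f Z1 e1 <= htopZ d f Z2 e2.
Proof.
move=> Z12 e21; apply: le_ereal_inf => _ [s hs <-]; exists s => //=.
by apply/eqP; rewrite eq_le mZ_ge0 andbT -hs; exact: mZ_mono.
Qed.

Lemma hB_cvg Z : htopZ d f Z e @[e --> 0^'+] --> ereal_sup [set htopZ d f Z e | e in `]0%R, +oo[].
Proof.
by apply: nonincreasing_at_right_cvge => // e1 e2 _ _ e12; exact: htopZ_mono.
Qed.

Lemma hBE Z : hB d f Z = ereal_sup [set htopZ d f Z e | e in `]0%R, +oo[].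
Proof. by apply/cvg_lim => //; exact: hB_cvg. Qed.

Lemma hB_mono (Z1 Z2 : set X) : Z1 `<=` Z2 -> hB d f Z1 <= hB d f Z2.
Proof.
move=> Z12; rewrite !hBE; apply: ge_ereal_sup => _ [e e0 <-].
apply: (@le_trans _ _ (htopZ d f Z2 e)); first exact: htopZ_mono.
by apply: ereal_sup_ubound; exists e.
Qed.

Lemma htopZ_le_hB Z (e : R) : (0 < e)%R -> htopZ d f Z e <= hB d f Z.
Proof.
by move=> e0; rewrite hBE; apply: ereal_sup_ubound; exists e => //=; rewrite in_itv /= andbT.
Qed.

Lemma hB_le Z (c : R) : (forall e s : R, (0 < e)%R -> (c < s)%R -> forall N, mZN d f Z s N e = 0) ->
  hB d f Z <= c%:E.
Proof.
move=> h; rewrite hBE; apply: ge_ereal_sup => _ [e he <-]; move: he; rewrite /= in_itv /= andbT => e0.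
apply/lee_addgt0Pr => t t0; rewrite -EFinD; apply: ereal_inf_lbound; exists (c + t)%R => //=.
apply/cvg_lim => //; apply: cvg_near_cst; apply: nearW => N.
by apply: h => //; rewrite ltrDl.
Qed.

Local Close Scope ereal_scope.

(** Family [k] is used only from length [m k] on, where its whole weight, a geometric tail with
    ratio [expR (c - s)], is at most [t / 2 ^+ k.+1]. A point that lies in [Y k n] for infinitely
    many [n] is still covered. *)
Lemma mZN_countable_cover (Y : nat -> nat -> set X) (Z : set X) (c s e : R) :
  (forall k, exists C : R, forall n, (0 < n)%N -> exists (N : nat) (l : 'I_N -> X),
      N%:R <= C * expR (n%:R * c) /\ forall x, Y k n x -> exists i, dn d f n (l i) x < e) ->
  (forall x, Z x -> exists k, forall M : nat, exists2 n, (M <= n)%N & Y k n x) ->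
  c < s -> forall N, mZN d f Z s N e = 0%E.
Proof.
move=> hY hZ cs N0; apply/eqP; rewrite eq_le mZN_ge0 andbT.
apply/lee_addgt0Pr => t t0; rewrite add0e.
have /choice[C hC] : forall k, exists C : R, 0 < C /\ forall n, (0 < n)%N -> exists (N : nat) (l : nat -> X),
      N%:R <= C * expR (n%:R * c) /\ forall x, Y k n x -> exists2 i, (i < N)%N & dn d f n (l i) x < e.
  move=> k; have [C hC] := hY k; exists (`|C| + 1); split; first by apply: ltr_wpDl.
  move=> n /hC[N [l [hN hl]]]; exists N, (fun i => if insub i is Some j then l j else point).
  split.
    apply: (le_trans hN); rewrite ler_pM2r ?expR_gt0//.
    by apply: (le_trans (ler_norm _)); rewrite lerDl.
  by move=> x /hl[i hi]; exists i => //; rewrite valK.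
have /choice[h hh] : forall kn : nat * nat, exists Nl : nat * (nat -> X), (0 < kn.2)%N ->
    Nl.1%:R <= C kn.1 * expR (kn.2%:R * c) /\ forall x, Y kn.1 kn.2 x ->
      exists2 i, (i < Nl.1)%N & dn d f kn.2 (Nl.2 i) x < e.
  move=> [k n]; have [n0|] := boolP (0 < n)%N; last by exists (0%N, fun=> point).
  by have [N [l hl]] := (hC k).2 n n0; exists (N, l).
pose r := expR (c - s).
have r0 : 0 < r by exact: expR_gt0.
have r1 : r < 1 by rewrite -expR0 ltr_expR subr_lt0.
have r10 : 0 < 1 - r by rewrite subr_gt0.
have /choice[m hm] : forall k, exists m, [/\ (N0 <= m)%N, (0 < m)%N & C k * r ^+ m / (1 - r) <= t / 2 ^+ k.+1].
  move=> k; have Ck0 := (hC k).1.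
  have t1 : 0 < (1 - r) * (t / 2 ^+ k.+1) / C k.
    by rewrite divr_gt0// mulr_gt0// divr_gt0// exprn_gt0.
  have [M hM] := exprn_small (ltW r0) r1 t1.
  exists (maxn M (maxn N0 1)); rewrite !leq_max leqnn !orbT; split => //.
  have /ltW := hM _ (leq_maxl M (maxn N0 1)).
  by rewrite ler_pdivlMr// ler_pdivrMr// mulrC [_ * (1 - r)]mulrC.
pose Cov : set (X * nat) := [set p | exists k i, [/\ (m k <= p.2)%N, (i < (h (k, p.2)).1)%N &
    p.1 = (h (k, p.2)).2 i]].
have GC : Gamma d f Z N0 e Cov.
  split.
  - have s1 : Cov `<=` range (fun q : nat * nat * nat => ((h (q.1.1, q.1.2)).2 q.2, q.1.2)).
      move=> [x n] [k [i [/= _ _ ->]]]; by exists (k, n, i).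
    by apply: (sub_countable (subset_card_le s1)); apply: (sub_countable (card_image_le _ _)); exact: countableP.
  - by move=> p [k [i [mk _ _]]]; apply: leq_trans mk; case: (hm k).
  - move=> x /hZ[k /(_ (m k))[n mn Yx]].
    have n0 : (0 < n)%N by apply: leq_trans mn; case: (hm k).
    have [_ /(_ x Yx)[i iN hi]] := hh (k, n) n0.
    by exists ((h (k, n)).2 i, n) => //; exists k, i.
apply: (@le_trans _ _ (\esum_(p in Cov) (expR (- (p.2%:R * s)))%:E)%E).
  by apply: ereal_inf_lbound; exists Cov.
apply: esum_le_seq => S uS SC.
have /choice[idx hidx] : forall p, exists q : nat * nat, p \in S -> [/\ (m q.1 <= p.2)%N,
    (q.2 < (h (q.1, p.2)).1)%N & p.1 = (h (q.1, p.2)).2 q.2].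
  move=> p; have [/SC[k [i hki]]|pS] := boolP (p \in S); last by exists (0, 0)%N.
  by exists (k, i).
pose K := (\max_(p <- S) (idx p).1).+1.
pose M := (\max_(p <- S) p.2).+1.
have a0 (p : X * nat) : 0 <= expR (- (p.2%:R * s)) by exact: expR_ge0.
(* A ball of the cover may come from several indices; the sum over balls is dominated by the sum
   over all indices, each of which matches at most one ball of the duplicate-free [S]. *)
apply: (@le_trans _ _ (\sum_(p <- S) \sum_(k < K) \sum_(n < M | (m k <= n)%N)
    \sum_(i < (h (nat_of_ord k, nat_of_ord n)).1)
      (if p == ((h (nat_of_ord k, nat_of_ord n)).2 i, nat_of_ord n) then expR (- (n%:R * s)) else 0))).
  rewrite big_seq [leRHS]big_seq; apply: ler_sum => p pS.
  have [h1 h2 h3] := hidx p pS.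
  have kK : ((idx p).1 < K)%N by rewrite /K ltnS; exact: (leq_bigmax_seq (F := fun p => (idx p).1)).
  have nM : (p.2 < M)%N by rewrite /M ltnS; exact: (leq_bigmax_seq (F := fun p => p.2)).
  have in0 (b : bool) (n : nat) : 0 <= (if b then expR (- (n%:R * s)) else 0) :> R.
    by case: b => //; exact: expR_ge0.
  rewrite (bigD1 (Ordinal kK)) //= ler_wpDr//.
    by apply: sumr_ge0 => ? _; apply: sumr_ge0 => ? _; apply: sumr_ge0.
  rewrite (bigD1 (Ordinal nM)) //= ler_wpDr//.
    by apply: sumr_ge0 => ? _; apply: sumr_ge0.
  rewrite (bigD1 (Ordinal h2)) //= ler_wpDr//.
    by apply: sumr_ge0.
  by rewrite -h3 -surjective_pairing eqxx.
rewrite exchange_big /=.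
apply: (@le_trans _ _ (\sum_(k < K) t / 2 ^+ k.+1)); last by apply: half_series_le; exact: ltW.
apply: ler_sum => k _; have [_ mk0 mkt] := hm k; apply: le_trans mkt.
rewrite exchange_big /=.
apply: (@le_trans _ _ (\sum_(n < M | (m k <= n)%N) C k * r ^+ n)); last first.
  by rewrite -mulr_sumr -mulrA ler_pM2l ?(hC k).1// geometric_tail// ltW.
apply: ler_sum => n mn; rewrite exchange_big /=.
have [hN _] := hh (nat_of_ord k, nat_of_ord n) (leq_trans mk0 mn).
apply: (@le_trans _ _ (\sum_(i < (h (nat_of_ord k, nat_of_ord n)).1) expR (- (n%:R * s)))).
  by apply: ler_sum => i _; apply: sum_uniq_eq => //; exact: expR_ge0.
rewrite sumr_const card_ord -[leLHS]mulr_natl.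
apply: (@le_trans _ _ (C k * expR (n%:R * c) * expR (- (n%:R * s)))).
  by rewrite ler_pM2r ?expR_gt0.
by rewrite -mulrA -expRD /r -expRM_natl ler_pM2l ?(hC k).1// ler_expR mulrBr.
Qed.

End BowenEntropy.

(** * Upper bound *)

Section Dmetric.
Context {dm : measure_display} {X : measurableType dm} {R : realType}.
Variable d : X -> X -> R.
Hypothesis dP : is_metric d.
Hypothesis dB : borel_sets d.
Hypothesis dK : d_compact d.
Variable phi : nat -> X -> R.
Hypothesis phiC : forall i, (0 < i)%N -> rcont d (phi i) /\ 0 < supnorm (phi i).

Implicit Types mu nu : probability X R.

Let rb g : rcont d g -> bmeas g. Proof. exact: (rcont_bmeas dP dB dK). Qed.

Lemma le_supnorm g x : rcont d g -> `|g x| <= supnorm g.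
Proof.
move=> cg; apply: sup_ubound; last by exists x.
by have [B _ hB] := rcont_bounded dP dK cg; exists B => _ [y _ <-].
Qed.

Lemma Int_le_supnorm (mu : probability X R) g : rcont d g -> `|Int mu g| <= supnorm g.
Proof.
move=> cg; have := @Int_dist_le _ X R mu g (fun=> 0) (supnorm g) (rb cg) (bmeas_cst 0).
by rewrite Int_cst subr0; apply => x; rewrite subr0; exact: le_supnorm.
Qed.

Definition Dterm (mu nu : probability X R) i : R :=
  `|Int mu (phi i) - Int nu (phi i)| / (2 ^+ i.+1 * supnorm (phi i)).

Definition Dpart (mu nu : probability X R) n : R := \sum_(1 <= i < n) Dterm mu nu i.

Lemma Dterm_ge0 mu nu i : (0 < i)%N -> 0 <= Dterm mu nu i.
Proof. by move=> /phiC[_ s0]; rewrite divr_ge0// mulr_ge0 ?exprn_ge0// ltW. Qed.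

Lemma Dterm_le mu nu i : (0 < i)%N -> Dterm mu nu i <= 2^-1 ^+ i.
Proof.
move=> /phiC[cp s0]; rewrite ler_pdivrMr ?mulr_gt0 ?exprn_gt0//.
have -> : 2^-1 ^+ i * (2 ^+ i.+1 * supnorm (phi i)) = 2 * supnorm (phi i) :> R.
  by rewrite mulrA exprS mulrCA -exprMn mulVf// expr1n mulr1.
apply: (le_trans (ler_normB _ _)).
by have := Int_le_supnorm mu cp; have := Int_le_supnorm nu cp; lra.
Qed.

Lemma DpartS mu nu n : (0 < n)%N -> Dpart mu nu n.+1 = Dpart mu nu n + Dterm mu nu n.
Proof. by move=> n0; rewrite /Dpart big_nat_recr. Qed.

Lemma Dpart_nd mu nu : {homo Dpart mu nu : n m / (n <= m)%N >-> n <= m}.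
Proof.
apply/nondecreasing_seqP => -[|n]; first by rewrite /Dpart !big_geq.
by rewrite [leRHS]DpartS// lerDl Dterm_ge0.
Qed.

Lemma Dpart_tail mu nu k n : (0 < k)%N -> (k <= n)%N ->
  Dpart mu nu n <= Dpart mu nu k + 2 * 2^-1 ^+ k.
Proof.
move=> k0 kn.
(* Carrying the remainder on the left as well makes the bound inductive. *)
suff h m : Dpart mu nu (k + m)%N + 2 * 2^-1 ^+ (k + m) <= Dpart mu nu k + 2 * 2^-1 ^+ k.
  rewrite -(subnKC kn); apply: le_trans (h (n - k)%N); rewrite lerDl mulr_ge0// exprn_ge0// invr_ge0.
elim: m => [|m IH]; first by rewrite addn0.
have km : (0 < k + m)%N by rewrite addn_gt0 k0.
rewrite addnS DpartS// exprS mulrA divff// mul1r.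
have := Dterm_le mu nu km; move: IH; lra.
Qed.

Lemma Dpart_cvg mu nu : cvgn (Dpart mu nu).
Proof.
apply: nondecreasing_is_cvgn; first exact: Dpart_nd.
exists (Dpart mu nu 1 + 2 * 2^-1 ^+ 1) => _ [n _ <-].
apply: (@le_trans _ _ (Dpart mu nu (maxn 1 n))); first by apply: Dpart_nd; exact: leq_maxr.
by apply: Dpart_tail => //; exact: leq_maxl.
Qed.

Lemma DmetricE mu nu : Dmetric phi mu nu = limn (Dpart mu nu).
Proof. by []. Qed.

Lemma Dmetric_ge mu nu i : (0 < i)%N ->
  `|Int mu (phi i) - Int nu (phi i)| <= Dmetric phi mu nu * (2 ^+ i.+1 * supnorm (phi i)).
Proof.
move=> i0; have [_ s0] := phiC i0.
rewrite -ler_pdivrMr ?mulr_gt0 ?exprn_gt0//.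
rewrite DmetricE; apply: (@le_trans _ _ (Dpart mu nu i.+1)).
  by rewrite DpartS// lerDr /Dpart big_nat sumr_ge0// => j /andP[j0 _]; exact: Dterm_ge0.
by apply: nondecreasing_cvgn_le; [exact: Dpart_nd|exact: Dpart_cvg].
Qed.

Lemma Dmetric_le mu nu k : (0 < k)%N -> Dmetric phi mu nu <= Dpart mu nu k + 2 * 2^-1 ^+ k.
Proof.
move=> k0; rewrite DmetricE; apply: limr_le; first exact: Dpart_cvg.
by exists k => // n kn; exact: Dpart_tail.
Qed.

Hypothesis phiD : dense_seq d phi.

Lemma dense_approx g (e : R) : rcont d g -> 0 < e ->
  exists2 i, (0 < i)%N & forall x, `|g x - phi i x| < e.
Proof.
move=> cg e0; have [i i0 hi] := phiD cg e0; exists i => // x.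
by apply: le_lt_trans hi; apply: (le_supnorm (g := fun x => g x - phi i x)); apply: rcontB => //; case: (phiC i0).
Qed.

Variable f : X -> X.
Hypothesis fC : d_cont d f.
Variable nu : probability X R.

(** A weak* neighbourhood contains a ball of [Dmetric]: each test is replaced by a nearby [phi i],
    whose integral the ball controls through a single term of the series. *)
Lemma ball_entropy_lt (c : R) : f_invariant f nu -> usc_entropy d f -> (h_mu f nu < c%:E)%E ->
  exists2 dl : R, 0 < dl & forall mu : probability X R, f_invariant f mu ->
    Ball phi nu dl mu -> (h_mu f mu < c%:E)%E.
Proof.
move=> inu usc hc; have [k [gs [cgs [e e0 he]]]] := usc nu inu c hc.
have e30 : 0 < e / 3 by rewrite divr_gt0.
have /choice[i hi] : forall j : 'I_k, exists i, (0 < i)%N /\ forall x, `|gs j x - phi i x| < e / 3.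
  by move=> j; have [i i0 h] := dense_approx (cgs j) e30; exists i.
pose w j := 2 ^+ (i j).+1 * supnorm (phi (i j)).
have w0 j : 0 < w j.
  by rewrite mulr_gt0 ?exprn_gt0//; have [_ s0] := phiC (hi j).1.
exists (\big[Num.min/1]_j (e / 3 / w j)).
  by apply: lt_bigmin => // j _; rewrite divr_gt0.
move=> mu imu Bmu; apply: he => // j.
have cp : rcont d (phi (i j)) by case: (phiC (hi j).1).
have h1 : `|Int mu (gs j) - Int mu (phi (i j))| <= e / 3.
  by apply: Int_dist_le; [exact: rb|exact: rb|move=> x; apply: ltW; exact: (hi j).2].
have h2 : `|Int nu (gs j) - Int nu (phi (i j))| <= e / 3.
  by apply: Int_dist_le; [exact: rb|exact: rb|move=> x; apply: ltW; exact: (hi j).2].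
have h3 : `|Int nu (phi (i j)) - Int mu (phi (i j))| < e / 3.
  apply: (le_lt_trans (Dmetric_ge _ _ (hi j).1)).
  rewrite -ltr_pdivlMr; last exact: w0.
  by apply: (lt_le_trans Bmu); exact: bigmin_le.
rewrite distrC in h3.
rewrite (_ : Int mu (gs j) - Int nu (gs j) = (Int mu (gs j) - Int mu (phi (i j))) +
   (Int mu (phi (i j)) - Int nu (phi (i j))) - (Int nu (gs j) - Int nu (phi (i j)))); last by ring.
apply: (le_lt_trans (ler_normB _ _)).
have := ler_normD (Int mu (gs j) - Int mu (phi (i j))) (Int mu (phi (i j)) - Int nu (phi (i j))).
move: h1 h2 h3; set A := `|_|; set B := `|_|; set D := `|_|; set E := `|_|; lra.
Qed.

Lemma upper_bound (c : R) : f_invariant f nu -> usc_entropy d f -> (h_mu f nu < c%:E)%E ->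
  exists2 dl : R, 0 < dl & (hB d f (Delta_sub d f (Ball phi nu dl)) <= c%:E)%E.
Proof.
move=> inu usc hc; have [dl dl0 hdl] := ball_entropy_lt inu usc hc.
exists dl => //; apply: hB_le => e s e0 cs N.
(* Thresholds are rational and tests taken from [phi], so there are countably many conditions, one
   cover for all limit measures in the ball. *)
pose good (i : nat) (r : rat) := exists C : R, forall n, (0 < n)%N -> exists (N : nat) (l : 'I_N -> X),
   N%:R <= C * expR (n%:R * c) /\
   forall x, ratr r < Int (emp f n x) (phi i) -> exists k, dn d f n (l k) x < e.
pose Y k n := [set x : X | exists i r, [/\ choice.unpickle k = Some (i, r), good i r &
  ratr r < Int (emp f n x) (phi i)]].
apply: (@mZN_countable_cover _ X R d f Y _ c) => //.
  move=> k; have [[i [r [kE [C hC]]]]|no] := pselect (exists i r, choice.unpickle k = Some (i, r) /\ good i r).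
    exists C => n n0; have [M [l [hM hl]]] := hC n n0; exists M, l; split => //.
    by move=> x [i' [r' [kE' _ h]]]; apply: hl; move: kE'; rewrite kE => -[-> ->].
  exists 0 => n n0; exists 0%N, (fun=> point); split; first by rewrite mul0r.
  by move=> x [i [r [kE g _]]]; exfalso; apply: no; exists i, r.
move=> x Zx; have [mu Vmu] := Vpts_nonempty dP dB dK f x.
have imu : f_invariant f mu by exact: (Vpts_invariant dP dB dK fC Vmu).
have hmu := hdl mu imu (Zx mu Vmu).
have [g [eta0 [C [cg eta00 hC]]]] := entropy_cover dP dB dK fC imu hmu e0.
(* Two approximations at [eta0 / 4] and a rational within [eta0 / 3] lose [5/6] of [eta0] in all. *)
have e40 : 0 < eta0 / 4 by rewrite divr_gt0.
have [i i0 hi] := dense_approx cg e40.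
have cp : rcont d (phi i) by case: (phiC i0).
have /rat_in_itvoo[r] : Int mu (phi i) - eta0 / 3 < Int mu (phi i) by rewrite gtrBl divr_gt0.
rewrite in_itv /= => /andP[r1 r2].
have h1 : `|Int mu g - Int mu (phi i)| <= eta0 / 4.
  by apply: Int_dist_le; [exact: rb|exact: rb|move=> y; exact: ltW].
have gd : good i r.
  exists C => n n0; have [M [l [hM hl]]] := hC n n0; exists M, l; split => // y hy.
  apply: hl; have : `|Int (emp f n y) g - Int (emp f n y) (phi i)| <= eta0 / 4.
    rewrite !Int_empE; [|exact: rb|exact: rb].
    rewrite -mulrBr -sumrB normrM normfV (ger0_norm (ler0n R _)) ler_pdivrMl ?ltr0n//.
    apply: (le_trans (ler_norm_sum _ _ _)); apply: (@le_trans _ _ (\sum_(j < n) eta0 / 4)).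
      by apply: ler_sum => j _; exact: ltW.
    by rewrite sumr_const card_ord mulr_natl.
  move: h1; rewrite !ler_norml => /andP[? ?] /andP[? ?]; lra.
exists (choice.pickle (i, r)) => M.
have e'0 : 0 < Int mu (phi i) - ratr r by rewrite subr_gt0.
have [n [Mn n0 hn]] := Vmu 1%N (fun=> phi i) (fun=> cp) _ e'0 M.
exists n => //; exists i, r; split => //; first exact: choice.pickleK.
by have := hn ord0; rewrite ltr_norml => /andP[+ _]; rewrite opprB ltrD2r.
Qed.

End Dmetric.

(** * Independent typical words *)

Section IidTuples.
Context {R : realType}.
Variables (Q : finType) (p : Q -> R).
Hypothesis p0 : forall q, 0 <= p q.
Hypothesis p1 : \sum_q p q = 1.

Definition mass (M : nat) (u : {ffun 'I_M -> Q}) : R := \prod_j p (u j).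

Lemma mass_ge0 M (u : {ffun 'I_M -> Q}) : 0 <= mass u.
Proof. exact: prodr_ge0. Qed.

Lemma mass_sum M : \sum_(u : {ffun 'I_M -> Q}) mass u = 1.
Proof. by rewrite -(bigA_distr_bigA (fun _ => p)) big1. Qed.

(** Independence: the sum is a product over the coordinates, and for [j != l] the factor of
    coordinate [j] is the vanishing mean of [h]. *)
Lemma sum_mass2 M (h : Q -> R) (j l : 'I_M) : \sum_q p q * h q = 0 ->
  \sum_(u : {ffun 'I_M -> Q}) mass u * (h (u j) * h (u l)) =
  if j == l then \sum_q p q * h q ^+ 2 else 0.
Proof.
move=> h0.
pose F (i : 'I_M) q := p q * ((if i == j then h q else 1) * (if i == l then h q else 1)).
transitivity (\sum_(u : {ffun 'I_M -> Q}) \prod_i F i (u i)).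
  apply: eq_bigr => u _; rewrite big_split /= big_split /=; congr (_ * (_ * _)).
    by rewrite -big_mkcond /= big_pred1_eq.
  by rewrite -big_mkcond /= big_pred1_eq.
rewrite -bigA_distr_bigA /= (bigD1 j) //= /F eqxx.
case: eqP => [<-|jl]; last first.
  by under eq_bigr do rewrite mulr1; rewrite h0 mul0r.
rewrite [X in _ * X]big1 ?mulr1; last first.
  move=> i ij; rewrite (negbTE ij).
  by under eq_bigr do rewrite !mulr1; rewrite p1.
by under eq_bigr do rewrite -expr2.
Qed.

Definition mean (g : Q -> R) : R := \sum_q p q * g q.

Lemma chebyshev (M : nat) (g : Q -> R) (t : R) : (0 < M)%N -> 0 < t ->
  \sum_(u : {ffun 'I_M -> Q} | M%:R * t < `|\sum_j g (u j) - M%:R * mean g|) mass u <=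
    (\sum_q p q * (g q - mean g) ^+ 2) / (M%:R * t ^+ 2).
Proof.
move=> M0 t0; set V := \sum_q _; pose h q := g q - mean g.
have M0' : 0 < M%:R :> R by rewrite ltr0n.
have h0 : \sum_q p q * h q = 0.
  by under eq_bigr do rewrite mulrBr; rewrite sumrB -mulr_suml p1 mul1r subrr.
have E : \sum_(u : {ffun 'I_M -> Q}) mass u * (\sum_j h (u j)) ^+ 2 = M%:R * V.
  transitivity (\sum_(u : {ffun 'I_M -> Q}) \sum_j \sum_l mass u * (h (u j) * h (u l))).
    apply: eq_bigr => u _; rewrite expr2 mulr_suml mulr_sumr; apply: eq_bigr => j _.
    by rewrite mulr_sumr mulr_sumr.
  rewrite exchange_big /=.
  transitivity (\sum_(j < M) V); last by rewrite sumr_const card_ord mulr_natl.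
  apply: eq_bigr => j _; rewrite exchange_big /= (bigD1 j) //= sum_mass2// eqxx.
  rewrite [X in _ + X]big1 ?addr0// => l lj.
  by rewrite sum_mass2// eq_sym (negbTE lj).
rewrite ler_pdivlMr ?mulr_gt0 ?exprn_gt0//.
rewrite -(ler_pM2l M0') -E mulr_suml mulr_sumr [leLHS]big_mkcond /=.
apply: ler_sum => u _; case: ifP => [hu|_]; last first.
  by rewrite mulr_ge0 ?mass_ge0 ?sqr_ge0.
have -> : \sum_j h (u j) = \sum_j g (u j) - M%:R * mean g.
  by rewrite sumrB sumr_const card_ord mulr_natl.
rewrite (_ : M%:R * (mass u * (M%:R * t ^+ 2)) = mass u * (M%:R * t) ^+ 2); last by ring.
apply: ler_wpM2l; first exact: mass_ge0.
rewrite -[leRHS]real_normK ?num_real//; apply: lerXn2r; rewrite ?nnegrE ?normr_ge0//.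
  by rewrite mulr_ge0 ?ltW.
exact: ltW.
Qed.

Lemma weak_law (I : finType) (g : I -> Q -> R) (t : R) : 0 < t -> exists2 M, (0 < M)%N &
  1 / 2 <= \sum_(u : {ffun 'I_M -> Q} |
    [forall i, `|\sum_j g i (u j) - M%:R * mean (g i)| <= M%:R * t]) mass u.
Proof.
move=> t0; pose V i := \sum_q p q * (g i q - mean (g i)) ^+ 2.
have V0 i : 0 <= V i by apply: sumr_ge0 => q _; rewrite mulr_ge0// sqr_ge0.
pose VS := \sum_i V i.
(* Makes the Chebyshev bounds of all tests add up to at most 1/2. *)
pose M := (Num.truncn (2 * VS / t ^+ 2)).+1.
have hM : 2 * VS / t ^+ 2 < M%:R by exact: truncnS_gt.
have M0 : 0 < M%:R :> R by rewrite ltr0n.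
exists M => //.
pose P (u : {ffun 'I_M -> Q}) :=
  [forall i, `|\sum_j g i (u j) - M%:R * mean (g i)| <= M%:R * t].
have := mass_sum M; rewrite (bigID P) /= => h.
suff : \sum_(u | ~~ P u) mass u <= 1 / 2.
  rewrite -[X in _ -> _ <= X]/(\sum_(u | P u) mass u); move: h; lra.
apply: (@le_trans _ _ (\sum_i V i / (M%:R * t ^+ 2))); last first.
  rewrite -mulr_suml ler_pdivrMr ?mulr_gt0 ?exprn_gt0//.
  by move: hM; rewrite ltr_pdivrMr ?exprn_gt0// -/VS; lra.
apply: (@le_trans _ _ (\sum_i \sum_(u : {ffun 'I_M -> Q} |
    M%:R * t < `|\sum_j g i (u j) - M%:R * mean (g i)|) mass u)); last first.
  by apply: ler_sum => i _; exact: chebyshev.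
under [leRHS]eq_bigr do rewrite big_mkcond.
rewrite exchange_big /= big_mkcond /=; apply: ler_sum => u _.
have pos i : 0 <= (if M%:R * t < `|\sum_j g i (u j) - M%:R * mean (g i)| then mass u else 0).
  by case: ifP => // _; exact: mass_ge0.
case: ifP => [|_]; last by apply: sumr_ge0.
rewrite /P negb_forall => /existsP[i]; rewrite -ltNge => hi.
by rewrite (bigD1 i) //= hi lerDl sumr_ge0.
Qed.

Variables (S : finType) (n : nat) (wrd : Q -> {ffun 'I_n -> S}).

(** [Q] will consist of words over a larger alphabet, carrying information besides the letter in
    [S]; only the [S]-word counts here. *)
Definition word_mass (w : {ffun 'I_n -> S}) : R := \sum_(q | wrd q == w) p q.

Definition hamming (v w : {ffun 'I_n -> S}) : nat := #|[pred i | v i != w i]|.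

(** The sum factorises over the positions; each factor is 1 for the unchanged letter plus [l] for
    every other letter. *)
Lemma sum_ham (l : R) (w : {ffun 'I_n -> S}) : 0 <= l ->
  \sum_v l ^+ hamming v w <= (1 + #|S|%:R * l) ^+ n.
Proof.
move=> l0; pose F (i : 'I_n) (a : S) := if a != w i then l else 1.
have -> : \sum_v l ^+ hamming v w = \sum_(v : {ffun 'I_n -> S}) \prod_i F i (v i).
  apply: eq_bigr => v _; rewrite /F -big_mkcond /= prodr_const.
  by congr (_ ^+ _); apply: eq_card.
rewrite -bigA_distr_bigA /= -[X in _ ^+ X](card_ord n) -prodr_const.
apply: ler_prod => i _; apply/andP; split.
  by apply: sumr_ge0 => a _; rewrite /F; case: ifP.
rewrite (bigD1 (w i)) //= /F eqxx lerD2l.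
apply: (@le_trans _ _ (\sum_(a : S) l)); last by rewrite sumr_const mulr_natl.
rewrite big_mkcond /=; by apply: ler_sum => a _; case: ifP => // ->.
Qed.

Lemma sum_mass_words M (v : {ffun 'I_M -> {ffun 'I_n -> S}}) :
  \sum_(u : {ffun 'I_M -> Q} | [forall j, wrd (u j) == v j]) mass u = \prod_j word_mass (v j).
Proof.
rewrite /word_mass; under [RHS]eq_bigr do rewrite big_mkcond.
rewrite bigA_distr_bigA big_mkcond /=; apply: eq_bigr => u _.
case: ifP => [/forallP h|/negbT]; first by apply: eq_bigr => j _; rewrite h.
by rewrite negb_forall => /existsP[j /negbTE hj]; rewrite (bigD1 j) //= hj mul0r.
Qed.

Definition tuple_hamming M (u v : {ffun 'I_M -> Q}) : nat := \sum_j hamming (wrd (u j)) (wrd (v j)).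

(* Each word of the Hamming ball of radius [h] costs at least [l ^+ h]. *)
Lemma mass_ham_ball M (G : {set {ffun 'I_M -> Q}}) (b l : R) (h : nat) (t : {ffun 'I_M -> Q}) :
  0 < l -> l <= 1 -> 0 <= b ->
  (forall u, u \in G -> \prod_j word_mass (wrd (u j)) <= b) ->
  \sum_(u in G | (tuple_hamming u t <= h)%N) mass u <= b * (l ^+ h)^-1 * (1 + #|S|%:R * l) ^+ (n * M).
Proof.
move=> l0 l1 b0 Gb.
pose wt : {ffun 'I_M -> Q} -> {ffun 'I_M -> {ffun 'I_n -> S}} := fun u => [ffun j => wrd (u j)].
pose hv (v : {ffun 'I_M -> {ffun 'I_n -> S}}) := (\sum_j hamming (v j) (wrd (t j)))%N.
have pw0 w : 0 <= word_mass w by apply: sumr_ge0.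
have lh0 : 0 < l ^+ h by rewrite exprn_gt0.
apply: (@le_trans _ _ (\sum_(v : {ffun 'I_M -> {ffun 'I_n -> S}}) b * (l ^+ h)^-1 * l ^+ hv v)); last first.
  rewrite -mulr_sumr; apply: ler_wpM2l; first by rewrite mulr_ge0// invr_ge0 ltW.
  have -> : \sum_v l ^+ hv v = \sum_(v : {ffun 'I_M -> {ffun 'I_n -> S}}) \prod_j l ^+ hamming (v j) (wrd (t j)).
    by apply: eq_bigr => v _; rewrite -expr_sum.
  rewrite -(bigA_distr_bigA (fun j w => l ^+ hamming w (wrd (t j)))) exprM.
  rewrite -[X in _ ^+ X](card_ord M) -prodr_const; apply: ler_prod => j _; apply/andP; split.
    by apply: sumr_ge0 => w _; rewrite exprn_ge0// ltW.
  by apply: sum_ham; exact: ltW.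
rewrite (partition_big wt predT) //=; apply: ler_sum => v _.
have [/existsP[u /andP[/andP[uG uh] /eqP uv]]|] :=
    boolP [exists u, (u \in G) && (tuple_hamming u t <= h)%N && (wt u == v)]; last first.
  rewrite negb_exists => /forallP no; rewrite big_pred0 => [|u]; last by apply/negbTE; exact: no.
  by rewrite !mulr_ge0// ?invr_ge0 ?exprn_ge0// ltW.
have hvh : (hv v <= h)%N.
  by apply: leq_trans uh; rewrite /hv -uv; apply: leq_sum => j _; rewrite ffunE.
apply: (@le_trans _ _ b); last first.
  rewrite -mulrA ler_peMr// mulrC ler_pdivlMr// mul1r.
  by apply: ler_wiXn2l => //; exact: ltW.
apply: (@le_trans _ _ (\prod_j word_mass (v j))); last first.
  apply: le_trans (Gb u uG); rewrite -uv.
  by under eq_bigr do rewrite ffunE.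
rewrite -sum_mass_words big_mkcond [leRHS]big_mkcond; apply: ler_sum => u' _.
case: ifP => [/andP[_ /eqP <-]|_].
  by rewrite ifT//; apply/forallP => j; rewrite ffunE.
by case: ifP => // _; exact: mass_ge0.
Qed.

(** A maximal separated subset is also spanning, so the Hamming balls around its elements cover [G],
    and [mass_ham_ball] bounds the mass of each. *)
Lemma separated_count M (G : {set {ffun 'I_M -> Q}}) (b l : R) (h : nat)
    (close : rel {ffun 'I_M -> Q}) :
  0 < l -> l <= 1 -> 0 < b -> reflexive close -> symmetric close ->
  (forall u, u \in G -> \prod_j word_mass (wrd (u j)) <= b) ->
  (forall u v, u \in G -> v \in G -> close u v -> (tuple_hamming u v <= h)%N) ->
  exists T : {set {ffun 'I_M -> Q}}, [/\ T \subset G,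
    forall u v, u \in T -> v \in T -> close u v -> u = v &
    \sum_(u in G) mass u <= #|T|%:R * (b * (l ^+ h)^-1 * (1 + #|S|%:R * l) ^+ (n * M))].
Proof.
move=> l0 l1 b0 cr cs Gb Gc.
pose sep (T : {set {ffun 'I_M -> Q}}) := (T \subset G) &&
   [forall u, forall v, (u \in T) && (v \in T) && close u v ==> (u == v)].
have sep0 : sep finset.set0.
  rewrite /sep finset.sub0set; apply/forallP => u; apply/forallP => v; by rewrite finset.inE.
have [T /maxsetP[/andP[TG /forallP sT] maxT] _] := maxset_exists sep0.
have sT' u v : u \in T -> v \in T -> close u v -> u = v.
  by move=> uT vT uv; have /forallP/(_ v)/implyP := sT u; rewrite uT vT uv => /(_ isT)/eqP.
exists T; split => //.
apply: (@le_trans _ _ (\sum_(t in T) \sum_(u in G | (tuple_hamming u t <= h)%N) mass u)); last first.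
  apply: (@le_trans _ _ (\sum_(t in T) (b * (l ^+ h)^-1 * (1 + #|S|%:R * l) ^+ (n * M)))).
    by apply: ler_sum => t _; apply: mass_ham_ball => //; exact: ltW.
  by rewrite sumr_const -[leLHS]mulr_natl.
have cov u : u \in G -> exists2 t, t \in T & close u t.
  move=> uG; have [uT|uT] := boolP (u \in T); first by exists u.
  apply: contrapT => no.
  have sU : sep (u |: T)%SET.
    apply/andP; split; first by rewrite finset.subUset finset.sub1set uG.
    apply/forallP => a; apply/forallP => c; apply/implyP.
    rewrite !in_setU1 => /andP[/andP[/orP[/eqP ->|aT] /orP[/eqP ->|cT]] ac] //.
    - by exfalso; apply: no; exists c.
    - by exfalso; apply: no; exists a => //; rewrite cs.
    - by apply/eqP; exact: sT'.
  have := maxT _ sU (finset.subsetUr _ _) => E.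
  by move: uT; rewrite -E in_setU1 eqxx.
under [leRHS]eq_bigr do rewrite big_mkcondr.
rewrite exchange_big /=; apply: ler_sum => u uG.
have [t tT ut] := cov u uG.
have tG : t \in G by exact: (fintype.subsetP TG).
rewrite (bigD1 t) //= (Gc _ _ uG tG ut) lerDl; apply: sumr_ge0 => v _.
by case: ifP => // _; exact: mass_ge0.
Qed.

End IidTuples.

(** * Inner regularity *)

Section InnerRegularity.
Context {dm : measure_display} {X : measurableType dm} {R : realType}.
Variable d : X -> X -> R.
Hypothesis dP : is_metric d.
Hypothesis dB : borel_sets d.
Hypothesis dK : d_compact d.
Variable mu : probability X R.

Definition d_closed (K : set X) := d_open d (~` K).

Definition inner_reg (A : set X) := forall e : R, 0 < e ->
  exists K, [/\ d_closed K, K `<=` A & Pr mu (A `\` K) < e].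

Lemma d_closed_measurable K : d_closed K -> measurable K.
Proof. by move=> cK; rewrite -(setCK K); apply: measurableC; exact: (d_open_measurable dB). Qed.

Lemma inner_reg_open U : d_open d U -> inner_reg U.
Proof.
move=> oU e e0; have e20 : 0 < e / 2 by rewrite divr_gt0.
have [k hk] := Int_bump_approx dP dB mu oU e20.
pose K := [set x | e / 2 <= bump d U k x].
have cb : rcont d (bump d U k) by exact: rcont_bump.
have cK : d_closed K.
  rewrite /d_closed (_ : ~` K = [set x | bump d U k x < e / 2]); first exact: rcont_openl.
  by apply/seteqP; split => x /=; [move/negP; rewrite -ltNge|rewrite ltNge => /negP].
have mK := d_closed_measurable cK; have mU := d_open_measurable dB oU.
have KU : K `<=` U.
  move=> x /= h; apply: contrapT => /(bump_notin dP k) b0.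
  by move: h; rewrite /K /= b0 leNgt e20.
exists K; split => //.
have PD : Pr mu U = Pr mu K + Pr mu (U `\` K).
  rewrite /Pr -!Int_indic//; last exact: measurableD.
  rewrite -IntD; [|exact: bmeas_indic|by apply: bmeas_indic; exact: measurableD].
  congr Int; apply/funext => x; rewrite !indicE.
  have [xK|xK] := boolP (x \in K).
    rewrite mem_set ?(memNset (A := U `\` K)) ?addr0//; first by move=> [_]; apply; exact: set_mem.
    exact: KU (set_mem xK).
  rewrite add0r; congr (_%:R); congr nat_of_bool.
  apply/idP/idP => [/set_mem h|/set_mem[h _]]; apply/mem_set => //.
  by split => // /mem_set; apply/negP.
have : Int mu (bump d U k) <= Int mu (fun x => \1_K x + e / 2).
  apply: Int_le.
  - exact: (rcont_bmeas dP dB dK).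
  - by apply: bmeasD; [exact: bmeas_indic|exact: bmeas_cst].
  move=> x; rewrite indicE; have [xK|xK] := boolP (x \in K).
    by have := bump_le1 d U k x; rewrite /=; lra.
  rewrite add0r leNgt; apply/negP => h; move: xK; rewrite mem_set//= /K /=; exact: ltW.
rewrite IntD; [|exact: bmeas_indic|exact: bmeas_cst].
rewrite Int_cst Int_indic// -/(Pr mu K); move: hk; rewrite -/(Pr mu U) PD; lra.
Qed.

Lemma inner_reg_closed K : d_closed K -> inner_reg K.
Proof.
move=> cK e e0; exists K; split => //.
by rewrite setDv /Pr measure0.
Qed.

(** An infinite union of closed sets may fail to be closed, so the union is first cut off at an
    index [N] with small loss. *)
Lemma inner_reg_bigcup (F : nat -> set X) : (forall n, measurable (F n)) ->
  (forall n, inner_reg (F n)) -> inner_reg (\bigcup_n F n).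
Proof.
move=> mF iF e e0; have e20 : 0 < e / 2 by rewrite divr_gt0.
have mUF : measurable (\bigcup_n F n) by exact: bigcup_measurable.
pose G N := \bigcup_(i < N) F i.
have mG N : measurable (G N) by apply: bigcup_measurable.
have [N hN] : exists N, Pr mu (\bigcup_n F n) - e / 2 < Pr mu (G N).
  have ndG : {homo G : n m / (n <= m)%N >-> (n <= m)%O}.
    move=> n m nm; apply/subsetPset => x [i /= i_n Fi]; exists i => //=.
    exact: leq_trans i_n nm.
  have UG : \bigcup_n G n = \bigcup_n F n.
    apply/seteqP; split => x [n _]; first by move=> [i _ Fi]; exists i.
    by move=> Fn; exists n.+1 => //; exists n => /=.
  have : (mu \o G) x @[x --> \oo] --> (fine (mu (\bigcup_n F n)))%:E.
    rewrite fineK ?fin_num_measure// -UG; apply: nondecreasing_cvg_mu => //.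
    by rewrite UG.
  move=> /fine_cvgP[_ /cvgrPdist_lt/(_ _ e20)[N _ /(_ N (leqnn N))]] /= h.
  by exists N; move: h; rewrite ltr_norml => /andP[_]; rewrite /Pr /=; lra.
have e30 : 0 < e / 2 / N.+1%:R by rewrite divr_gt0// ltr0n.
have /choice[K hK] : forall n, exists K, [/\ d_closed K, K `<=` F n & Pr mu (F n `\` K) < e / 2 / N.+1%:R].
  by move=> n; exact: iF.
have mK n : measurable (K n) by apply: d_closed_measurable; case: (hK n).
have cK : d_closed (\bigcup_(i < N) K i).
  rewrite /d_closed (_ : ~` _ = [set x | forall i : 'I_N, (~` K i) x]).
    by apply: d_open_forall => i; case: (hK i).
  apply/seteqP; split => x /= h; first by move=> i Ki; apply: h; exists i => /=.
  by move=> [i /= iN]; exact: (h (Ordinal iN)).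
exists (\bigcup_(i < N) K i); split => //.
  by move=> x [i _ Ki]; exists i => //; case: (hK i) => _ + _; apply.
pose H (i : option 'I_N) := if i is Some i then F i `\` K i else \bigcup_n F n `\` G N.
have mH i : measurable (H i) by case: i => [i|]; exact: measurableD.
apply: (@le_lt_trans _ _ (\sum_i Pr mu (H i))).
  apply: Pr_cover => //; first by apply: measurableD => //; exact: d_closed_measurable.
  move=> x [[n _ Fn] nK]; have [[i /= iN Fi]|nG] := pselect (G N x).
    by exists (Some (Ordinal iN)); split => // Ki; apply: nK; exists i.
  by exists None; split => //; exists n.
have h1 : Pr mu (\bigcup_n F n `\` G N) < e / 2.
  have GF : G N `<=` \bigcup_n F n by move=> x [i _ Fi]; exists i.
  rewrite /Pr measureD//; last by rewrite -ge0_fin_numE ?fin_num_measure.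
  rewrite (setIidr GF) fineB ?fin_num_measure//; move: hN; rewrite /Pr; lra.
rewrite (bigD1 None) //=.
rewrite (_ : \sum_(i | _) _ = \sum_(i < N) Pr mu (F i `\` K i)); last first.
  rewrite (reindex_omap Some id) //=; last by case.
  by apply: eq_bigl => i; rewrite eqxx.
have h2 : \sum_(i < N) Pr mu (F i `\` K i) <= e / 2.
  apply: (@le_trans _ _ (\sum_(i < N) e / 2 / N.+1%:R)).
    by apply: ler_sum => i _; apply: ltW; case: (hK i).
  rewrite sumr_const card_ord -[leLHS]mulr_natl mulrCA ler_piMr ?(ltW e20)//.
  by rewrite ler_pdivrMr ?ltr0n// mul1r ler_nat.
by lra.
Qed.

Lemma inner_reg_bigcap (F : nat -> set X) : (forall n, measurable (F n)) ->
  (forall n, inner_reg (F n)) -> inner_reg (\bigcap_n F n).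
Proof.
move=> mF iF e e0; have e20 : 0 < e / 2 by rewrite divr_gt0.
have /choice[K hK] : forall n, exists K, [/\ d_closed K, K `<=` F n &
    Pr mu (F n `\` K) < e / 2 / (2 ^ n.+1)%:R].
  by move=> n; apply: iF; rewrite divr_gt0// ltr0n expn_gt0.
have mK n : measurable (K n) by apply: d_closed_measurable; case: (hK n).
have cK : d_closed (\bigcap_n K n).
  by rewrite /d_closed setC_bigcap; apply: d_open_bigcup => n _; case: (hK n).
exists (\bigcap_n K n); split => //.
  by move=> x h n _; case: (hK n) => _ + _; apply; exact: h.
have mD : measurable (\bigcap_n F n `\` \bigcap_n K n).
  by apply: measurableD; [exact: bigcapT_measurable|exact: d_closed_measurable].
have mFK n : measurable (F n `\` K n) by exact: measurableD.
suff : (mu (\bigcap_n F n `\` \bigcap_n K n) <= (e / 2)%:E)%E.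
  move=> h; apply: (@le_lt_trans _ _ (e / 2)); last by lra.
  by rewrite -lee_fin /Pr fineK// fin_num_measure.
apply: (le_trans _ (epsilon_trick0 xpredT (ltW e20))).
apply: (@le_trans _ _ (\sum_(n <oo) mu (F n `\` K n))%E); last first.
  apply: lee_nneseries => n _; first by [].
  rewrite -[leLHS]fineK ?fin_num_measure// lee_fin ltW//.
  by case: (hK n).
apply: measure_sigma_subadditive => //.
move=> x [hF hK']; apply: contrapT => no; apply: hK' => n _.
by apply: contrapT => nK; apply: no; exists n => //; split => //; exact: hF.
Qed.

(** Requiring the property of the complement as well makes the class a sigma-algebra. It contains
    the open sets: bumps approximate them from inside, and their complements are closed. *)
Lemma inner_regular A : measurable A -> inner_reg A.
Proof.
move=> mA; pose D : set (set X) := [set A | [/\ measurable A, inner_reg A & inner_reg (~` A)]].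
suff : D A by case.
move: mA; rewrite dB; apply: smallest_sub; last first.
  move=> U oU; split; [exact: (d_open_measurable dB)|exact: inner_reg_open|].
  by apply: inner_reg_closed; rewrite /d_closed setCK.
split.
- split => //; apply: inner_reg_closed; rewrite /d_closed ?setC0 ?setCT => //; exact: d_openT.
- move=> B [mB iB iC]; rewrite setTD /D /= setCK; split => //; exact: measurableC.
- move=> F hF; have mF n : measurable (F n) by case: (hF n).
  split; first exact: bigcup_measurable.
    by apply: inner_reg_bigcup => // n; case: (hF n).
  rewrite setC_bigcup; apply: inner_reg_bigcap => n; first exact: measurableC.
  by case: (hF n).
Qed.

End InnerRegularity.

(** * Positive distance between disjoint closed sets *)

Section Separation.
Context {dm : measure_display} {X : measurableType dm} {R : realType}.
Variable d : X -> X -> R.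
Hypothesis dP : is_metric d.
Hypothesis dK : d_compact d.

(** Lebesgue number argument: the doubled ball around a centre avoids every [K i] that misses the
    centre, so two sets meeting this ball both contain its centre and coincide. *)
Lemma closed_separated (I : finType) (K : I -> set X) : (forall i, d_closed d (K i)) ->
  (forall i j x, K i x -> K j x -> i = j) ->
  exists2 e : R, 0 < e & forall i j x y, K i x -> K j y -> d x y < e -> i = j.
Proof.
move=> cK dj.
have /choice[r hr] : forall x, exists r : R, 0 < r /\
    forall i, ~ K i x -> forall y, d x y < r *+ 2 -> ~ K i y.
  move=> x; have [r r0 h] : exists2 r : R, 0 < r & forall y, d x y < r -> forall i, ~ K i x -> ~ K i y.
    have o : d_open d [set y | forall i : {i | `[< ~ K i x >]}, (~` K (val i)) y].
      by apply: d_open_forall => i; exact: cK.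
    have [|r r0 h] := o x.
      by move=> [i hi] /=; exact/asboolP.
    exists r => // y /h /= hy i nK.
    exact: (hy (exist _ i (asboolT nK))).
  exists (r / 2); split; first by rewrite divr_gt0.
  by move=> i nK y; rewrite mulr2n -splitr => /h; apply.
have [n [c hc]] := ball_cover dP dK (fun x => (hr x).1).
exists (\big[Num.min/1]_k r (c k)).
  by apply: lt_bigmin => // i _; case: (hr (c i)).
move=> i j x y Kx Ky xy; have [k hk] := hc x.
have [r0 h] := hr (c k).
apply: (dj _ _ (c k)); apply: contrapT => nK.
  by apply: (h _ nK x) => //; apply: (lt_le_trans hk); rewrite mulr2n lerDl ltW.
apply: (h _ nK y) => //; apply: (le_lt_trans (d_tri dP _ x _)); rewrite mulr2n ltrD//.
by apply: (lt_le_trans xy); exact: bigmin_le.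
Qed.

End Separation.

(** * Entropy of trees of orbits *)

Section TreeEntropy.
Context {dm : measure_display} {X : measurableType dm} {R : realType}.
Variable d : X -> X -> R.
Variable f : X -> X.
Variables (T : finType) (t0 : T) (x : (nat -> T) -> X) (Z : set X) (L : nat) (e s : R).
Hypothesis L0 : (0 < L)%N.
Hypothesis s0 : 0 <= s.
Hypothesis sT : expR (s * L%:R) <= #|T|%:R.
Hypothesis xZ : forall a, Z (x a).
Hypothesis sep : forall a b k z m, a k != b k -> (k.+1 * L <= m)%N ->
  Bn d f m z e (x a) -> Bn d f m z e (x b) -> False.

Let cT : R := #|T|%:R.
Let cT0 : 0 < cT.
Proof. by rewrite ltr0n; apply/card_gt0P; exists t0. Qed.

Let W (p : X * nat) : R := expR (- (p.2%:R * s)).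

Definition agree (k : nat) (a b : nat -> T) := forall i, (i < k)%N -> a i = b i.

Definition hit (k : nat) (a : nat -> T) (p : X * nat) : bool :=
  `[< exists2 b, agree k a b & Bn d f p.2 p.1 e (x b) >].

(** Weight of the balls that meet the cylinder of sequences agreeing with [a] before [k]; it plays
    the part of the sum in Kraft's inequality. *)
Definition load (C : set (X * nat)) (k : nat) (a : nat -> T) : \bar R :=
  (\esum_(p in C) (if hit k a p then W p else 0)%:E)%E.

Definition upd (a : nat -> T) (k : nat) (t : T) (i : nat) : T := if i == k then t else a i.

Lemma hit_upd k a t p : hit k.+1 (upd a k t) p -> hit k a p.
Proof.
move=> /asboolP[b ab hb]; apply/asboolP; exists b => // i ik.
by rewrite -(ab i (leqW ik)) /upd ltn_eqF.
Qed.

Lemma hit_upd_uniq k a t t' p : (k.+1 * L <= p.2)%N -> hit k.+1 (upd a k t) p ->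
  hit k.+1 (upd a k t') p -> t = t'.
Proof.
move=> kp /asboolP[b ab hb] /asboolP[b' ab' hb'].
have bk : b k = t by rewrite -ab// /upd eqxx.
have bk' : b' k = t' by rewrite -ab'// /upd eqxx.
rewrite -bk -bk'; apply/eqP/negPn/negP => ne.
exact: (sep ne kp hb hb').
Qed.

(** A ball of length below [k.+1 * L] weighs at least [expR (- (s * L))] to the power [k.+1], and
    [expR (s * L) <= #|T|]. The threshold is fixed so that one such ball reaches it alone. *)
Lemma short_ball C k a p : C p -> hit k a p -> (p.2 < k.+1 * L)%N ->
  ((expR (- (s * L%:R)) / cT ^+ k)%:E <= load C k a)%E.
Proof.
move=> Cp hp pk.
have WE : expR (- (s * L%:R)) / cT ^+ k <= W p.
  rewrite ler_pdivrMr ?exprn_gt0//.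
  apply: (@le_trans _ _ (W p * expR (s * L%:R) ^+ k)); last first.
    rewrite ler_pM2l ?expR_gt0//; apply: lerXn2r; rewrite ?nnegrE ?expR_ge0 ?ler0n//.
  rewrite /W -expRM_natl -expRD ler_expR.
  have : p.2%:R <= k.+1%:R * L%:R :> R by rewrite -natrM ler_nat ltnW.
  move=> /(ler_wpM2r s0); rewrite -natr1; move: (p.2%:R) (k%:R) (L%:R) => u v w; nra.
apply: (@le_trans _ _ (W p)%:E); first by rewrite lee_fin.
apply: esum_ge; exists [set p]; first by split; [exact: finite_set1|move=> _ ->].
by rewrite fsbig_set1 hp.
Qed.

(* If no ball is short, each ball meets at most one of the [#|T|] subcylinders, so some subcylinder
   carries at most the average load. *)
Lemma load_step C k a : (load C k a < (expR (- (s * L%:R)) / cT ^+ k)%:E)%E ->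
  exists t, (load C k.+1 (upd a k t) < (expR (- (s * L%:R)) / cT ^+ k.+1)%:E)%E.
Proof.
move=> hl; apply: contrapT => no.
have big t : ((expR (- (s * L%:R)) / cT ^+ k.+1)%:E <= load C k.+1 (upd a k t))%E.
  by rewrite leNgt; apply/negP => h; apply: no; exists t.
have : (\sum_(t : T) load C k.+1 (upd a k t) <= load C k a)%E.
  rewrite /load -esum_sum; last first.
    by move=> p t _ _; rewrite lee_fin; case: ifP => // _; exact: expR_ge0.
  apply: le_esum => p Cp; rewrite sumEFin lee_fin.
  have [/existsP[t ht]|] := boolP [exists t, hit k.+1 (upd a k t) p]; last first.
    rewrite negb_exists => /forallP nh; rewrite big1 => [|t _]; last by rewrite (negbTE (nh t)).
    by case: ifP => // _; exact: expR_ge0.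
  have hk := hit_upd ht; rewrite hk (bigD1 t) //= ht big1 ?addr0// => t' tt'.
  case: ifP => // ht'; have [pk|kp] := ltnP p.2 (k.+1 * L).
    by have := short_ball Cp hk pk; rewrite leNgt hl.
  by move: tt'; rewrite (hit_upd_uniq kp ht' ht) eqxx.
apply/negP; rewrite -ltNge; apply: (lt_le_trans hl).
apply: (@le_trans _ _ (\sum_(t : T) (expR (- (s * L%:R)) / cT ^+ k.+1)%:E)%E); last first.
  by apply: lee_sum => t _.
rewrite sumEFin lee_fin sumr_const -[leRHS]mulr_natl -/cT exprS invfM.
by rewrite mulrCA mulrA mulrA -[expR _ * cT * _]mulrA divff ?gt_eqF// mulr1.
Qed.

(** If the cover were too light, successive subcylinders of small load would define a sequence [a].
    Some ball [p] contains [x a], hence is hit at every level, and at level [p.2] it is short, which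
    contradicts the small load there. *)
Lemma tree_cover N C : Gamma d f Z N e C -> ((expR (- (s * L%:R)))%:E <= \esum_(p in C) (W p)%:E)%E.
Proof.
move=> [_ _ ZC]; rewrite leNgt; apply/negP => hC.
pose good k a := (load C k a < (expR (- (s * L%:R)) / cT ^+ k)%:E)%E.
have /choice[g hg] : forall ka : nat * (nat -> T), exists t, good ka.1 ka.2 -> good ka.1.+1 (upd ka.2 ka.1 t).
  move=> [k a]; have [/load_step[t ht]|ng] := pselect (good k a); first by exists t.
  by exists t0.
pose fix A k : nat -> T := if k is k'.+1 then upd (A k') k' (g (k', A k')) else fun=> t0.
have gA k : good k (A k).
  elim: k => [|k IH] /=; last exact: (hg (k, A k)).
  rewrite /good expr0 divr1; apply: le_lt_trans hC.
  by apply: le_esum => p _; rewrite lee_fin; case: ifP => // _; exact: expR_ge0.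
pose a k := A k.+1 k.
have aA k i : (i < k)%N -> A k i = a i.
  elim: k => // k IH; rewrite ltnS leq_eqVlt => /orP[/eqP ->//|ik].
  by rewrite /= /upd ltn_eqF// IH.
have [p Cp hp] := ZC _ (xZ a).
have hk k : hit k (A k) p by apply/asboolP; exists a => // i /aA.
have := gA p.2; rewrite /good ltNge; apply/negP/negPn.
apply: (short_ball Cp (hk _)).
by rewrite (leq_trans (ltnSn _))// leq_pmulr.
Qed.

Lemma tree_htopZ : (s%:E <= htopZ d f Z e)%E.
Proof.
apply: le_ereal_inf_tmp => _ [s' hs' <-]; rewrite lee_fin leNgt; apply/negP => s's.
have : ((expR (- (s * L%:R)))%:E <= mZ d f Z s' e)%E.
  apply: lime_ge; first exact: mZ_cvg.
  apply: nearW => N; apply: (le_trans _ (mZN_le_s d f Z N e (ltW s's))).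
  by apply: le_ereal_inf_tmp => _ [C GC <-]; exact: tree_cover GC.
by rewrite hs' lee_fin leNgt expR_gt0.
Qed.

End TreeEntropy.

(** * Gluing orbits *)

Section Gluing.
Context {dm : measure_display} {X : measurableType dm} {R : realType}.
Variable d : X -> X -> R.
Hypothesis dP : is_metric d.
Variable f : X -> X.

(** One pair of points is fixed per pair of cells and transitivity is applied to the balls of radius
    [r] around them; as points of one cell are less than [r] apart, the same orbit segment serves
    all points of the two cells. Pairs with an empty cell get an arbitrary value. *)
Lemma transitions (S : finType) (gam : X -> S) (r : R) : 0 < r -> top_transitive d f ->
  (forall x y, gam x = gam y -> d x y < r) ->
  exists (tau : S -> S -> nat) (z : S -> S -> X),
    forall x y, [/\ (0 < tau (gam x) (gam y))%N, d x (z (gam x) (gam y)) < r + r &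
      d (iter (tau (gam x) (gam y)) f (z (gam x) (gam y))) y < r + r].
Proof.
move=> r0 tr small.
have H (ab : S * S) : exists tz : nat * X, forall x y, gam x = ab.1 -> gam y = ab.2 ->
    [/\ (0 < tz.1)%N, d x tz.2 < r + r & d (iter tz.1 f tz.2) y < r + r].
  have [[x0 [y0 [hx0 hy0]]]|no] := pselect (exists x y, gam x = ab.1 /\ gam y = ab.2); last first.
    by exists (0%N, point) => x y hx hy; exfalso; apply: no; exists x, y.
  have [||||t t0 [w [[z zx zw] wy]]] := tr [set u | d x0 u < r] [set u | d y0 u < r].
  - exact: d_open_ball.
  - exact: d_open_ball.
  - by exists x0 => /=; rewrite d_refl.
  - by exists y0 => /=; rewrite d_refl.
  exists (t, z) => x y hx hy /=; split => //.
    by apply: (le_lt_trans (d_tri dP x x0 z)); rewrite ltrD// small// hx.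
  rewrite zw; apply: (le_lt_trans (d_tri dP w y0 y)); rewrite ltrD//.
    by rewrite d_sym.
  by rewrite small// hy.
have [tz htz] := choice H.
exists (fun a b => (tz (a, b)).1), (fun a b => (tz (a, b)).2) => x y.
exact: (htz (gam x, gam y)).
Qed.

Variables (n : nat) (y : nat -> X) (tau : nat -> nat) (z : nat -> X) (dl : R).
Hypothesis n0 : (0 < n)%N.
Hypothesis dl0 : 0 <= dl.
Hypothesis tau0 : forall j, (0 < tau j)%N.
Hypothesis zl : forall j, d (iter n f (y j)) (z j) <= dl.
Hypothesis zr : forall j, d (iter (tau j) f (z j)) (y j.+1) <= dl.

Definition pos (j : nat) : nat := \sum_(l < j) (n + tau l).

(** A state of the pseudo-orbit is the number of the segment and the time spent in it; segment [j]
    lasts [n + tau j] steps, a word followed by a transition. *)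
Definition glue_next (ji : nat * nat) : nat * nat :=
  if (ji.2.+1 < n + tau ji.1)%N then (ji.1, ji.2.+1) else (ji.1.+1, 0%N).

Definition glue_state (t : nat) : nat * nat := iter t glue_next (0%N, 0%N).

Definition glue_point (ji : nat * nat) : X :=
  if (ji.2 < n)%N then iter ji.2 f (y ji.1) else iter (ji.2 - n) f (z ji.1).

Lemma glue_state_pos j i : (i < n + tau j)%N -> glue_state (pos j + i) = (j, i).
Proof.
elim: j i => [|j IHj] i.
  rewrite /pos big_ord0 add0n; elim: i => // i IHi h.
  by rewrite /glue_state iterS -/(glue_state i) IHi ?(ltnW h)// /glue_next /= h.
elim: i => [_|i IHi h].
  rewrite addn0 /pos big_ord_recr /= -/(pos j).
  have nt : (n + tau j).-1.+1 = (n + tau j)%N by rewrite prednK// addn_gt0 n0.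
  rewrite -[X in (_ + X)%N]nt addnS /glue_state iterS -/(glue_state _) IHj ?nt//.
  by rewrite /glue_next /= nt ltnn.
by rewrite addnS /glue_state iterS -/(glue_state _) IHi ?(ltnW h)// /glue_next /= h.
Qed.

Lemma glue_state_lt t : ((glue_state t).2 < n + tau (glue_state t).1)%N.
Proof.
elim: t => [|t IH]; first by rewrite /= addn_gt0 n0.
rewrite /glue_state iterS -/(glue_state t) /glue_next.
by case: ifP => // _; rewrite addn_gt0 n0.
Qed.

(** Jumps occur only twice per segment: from the word to the transition, and from the transition to
    the next word. *)
Lemma glue_pseudo_orbit t :
  d (f (glue_point (glue_state t))) (glue_point (glue_state t.+1)) <= dl.
Proof.
have := glue_state_lt t; have -> : glue_state t.+1 = glue_next (glue_state t) by [].
case: (glue_state t) => j i /= ilt; rewrite /glue_next /=.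
have [h|h] := ltnP i.+1 (n + tau j); rewrite /glue_point /=.
  have [in_|ni] := ltnP i n.
    have [in1|] := ltnP i.+1 n; first by rewrite -iterS d_refl.
    move=> ni; have E : n = i.+1 by apply/eqP; rewrite eqn_leq ni in_.
    by rewrite -iterS -E subnn /=; exact: zl.
  by rewrite ltnNge (leqW ni) /= subSn// iterS d_refl.
have E : i.+1 = (n + tau j)%N by apply/eqP; rewrite eqn_leq h ilt.
have ni : (n <= i)%N by rewrite -ltnS E -[X in (X < _)%N]addn0 ltn_add2l.
rewrite ltnNge ni /= n0 -iterS -subSn// E addKn; exact: zr.
Qed.

Lemma glue (e : R) : (forall xs : nat -> X, (forall i, d (f (xs i)) (xs i.+1) <= dl) ->
      exists x, forall i, d (iter i f x) (xs i) < e) ->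
  exists x, forall j i, (i < n)%N -> d (iter (pos j + i) f x) (iter i f (y j)) < e.
Proof.
move=> tr; have [x hx] := tr (fun t => glue_point (glue_state t)) glue_pseudo_orbit.
exists x => j i i_n; have := hx (pos j + i)%N.
by rewrite glue_state_pos ?(leq_trans i_n) ?leq_addr// /glue_point /= i_n.
Qed.

End Gluing.

(** * Separated typical tuples *)

Section HammingBalls.
Context {R : realType}.

(* [l] is the weight of a letter change in the Hamming count and [k] the proportion of changes allowed. *)
Lemma hamming_parameters (N : nat) (z : R) : 0 < z ->
  exists l k : R, [/\ 0 < l, l <= 1, 0 < k, 1 + N%:R * l <= expR z &
    forall (h n : nat), h%:R <= k * n%:R -> (l ^+ h)^-1 <= expR (z * n%:R)].
Proof.
move=> z0; have N0 : 0 <= N%:R :> R by [].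
pose l : R := Num.min 1 (z / (N%:R + 1)).
have l0 : 0 < l by rewrite lt_min ltr01 divr_gt0//; lra.
have l1 : l <= 1 by rewrite ge_min lexx.
pose a := - ln l.
have a0 : 0 <= a by rewrite oppr_ge0 ln_le0.
exists l, (z / (a + 1)); split => //.
- by rewrite divr_gt0//; lra.
- apply: le_trans (expR_ge1Dx z); rewrite lerD2l.
  apply: (@le_trans _ _ (N%:R * (z / (N%:R + 1)))).
    by rewrite ler_wpM2l// ge_min lexx orbT.
  by rewrite mulrCA ler_piMr ?(ltW z0)// ler_pdivrMr; lra.
- move=> h n hn.
  have -> : (l ^+ h)^-1 = expR (a * h%:R).
    by rewrite mulrC expRM_natl /a expRN lnK ?posrE// exprVn.
  rewrite ler_expR; apply: (@le_trans _ _ (a * (z / (a + 1) * n%:R))).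
    by rewrite ler_wpM2l.
  rewrite mulrA; apply: ler_wpM2r => //.
  by rewrite mulrCA ler_piMr ?(ltW z0)// ler_pdivrMr; lra.
Qed.

End HammingBalls.

(** * Laws of finite-valued maps *)

Section Fibers.
Context {dm : measure_display} {X : measurableType dm} {R : realType}.
Variable nu : probability X R.

Definition law (Q : finType) (tau : X -> Q) (q : Q) : R := Pr nu (tau @^-1` [set q]).

Lemma mean_law (Q : finType) (tau : X -> Q) (g : Q -> R) : mfin tau ->
  mean (law tau) g = Int nu (fun x => g (tau x)).
Proof. by move=> mt; rewrite Int_fin//; apply: eq_bigr => q _; rewrite mulrC. Qed.

Lemma bmeas_fin (Q : finType) (tau : X -> Q) (g : Q -> R) : mfin tau -> bmeas (fun x => g (tau x)).
Proof.
move=> mt.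
have -> : (fun x => g (tau x)) = (fun x => \sum_q g q * \1_(tau @^-1` [set q]) x).
  apply/funext => x; rewrite (bigD1 (tau x)) //= indicE mem_set// mulr1.
  rewrite big1 ?addr0// => q qx; rewrite indicE memNset ?mulr0// => /= /esym/eqP.
  by rewrite (negbTE qx).
by apply: bmeas_sum => q; apply: bmeasZ; exact: bmeas_indic.
Qed.

Lemma Int_birkhoff (f : X -> X) (g : X -> R) n : measurable_fun setT f -> f_invariant f nu ->
  bmeas g -> (0 < n)%N -> Int nu (fun x => n%:R^-1 * \sum_(t < n) g (iter t f x)) = Int nu g.
Proof.
move=> mf inv bg n0.
have bt t : bmeas (fun x => g (iter t f x)).
  by apply: (bmeas_comp (g := g)) => //; exact: measurable_iter.
rewrite IntZ; last by apply: bmeas_sum => t; exact: bt.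
rewrite Int_sum; last by move=> t; exact: bt.
rewrite (eq_bigr (fun=> Int nu g)); last first.
  by move=> t _; exact: (Int_invariant (measurable_iter t mf) (iter_invariant t mf inv) bg).
by rewrite sumr_const card_ord -[X in _ * X]mulr_natl mulKf// pnatr_eq0 -lt0n.
Qed.

Lemma law_push (Q S : finType) (tau : X -> Q) (h : Q -> S) (s : S) : mfin tau ->
  \sum_(q | h q == s) law tau q = Pr nu ((h \o tau) @^-1` [set s]).
Proof.
move=> mt; have mh := mfin_comp h mt.
rewrite (Pr_fibers nu mt (mh s)) big_mkcond /=; apply: eq_bigr => q _.
case: eqP => hq.
  by congr (Pr nu _); apply/seteqP; split => [x /= xq|x [_ //]]; split => //=; rewrite xq.
rewrite (_ : _ `&` _ = set0) ?/Pr ?measure0//.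
by apply/seteqP; split => // x [/= h1 h2]; apply: hq; rewrite -h2.
Qed.

End Fibers.

Section TypicalTuples.
Context {dm : measure_display} {X : measurableType dm} {R : realType}.
Variable d : X -> X -> R.
Hypothesis dP : is_metric d.
Hypothesis dB : borel_sets d.
Hypothesis dK : d_compact d.
Variable f : X -> X.
Hypothesis fC : d_cont d f.
Variable nu : probability X R.
Hypothesis inv : f_invariant f nu.

Let mf : measurable_fun setT f. Proof. exact: (d_cont_measurable dB fC). Qed.

(** The partition is merely measurable and its atoms may be dense; disjoint closed sets of nearly
    full mass inside them have positive distance, so there closeness in [X] implies equal
    letters. *)
Lemma separating_core (S : finType) (sigma : X -> S) (k : R) : mfin sigma -> 0 < k ->
  exists (K : S -> set X) (e : R), [/\ 0 < e, forall a, measurable (K a),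
    Pr nu [set x | ~ K (sigma x) x] <= k &
    forall x y, K (sigma x) x -> K (sigma y) y -> d x y < e -> sigma x = sigma y].
Proof.
move=> ms k0; have kS : 0 < k / (#|S|%:R + 1) by rewrite divr_gt0// ltr_wpDl.
have /choice[K hK] : forall a, exists K, [/\ d_closed d K, K `<=` sigma @^-1` [set a] &
    Pr nu (sigma @^-1` [set a] `\` K) < k / (#|S|%:R + 1)].
  by move=> a; exact: (inner_regular dP dB dK nu (ms a)).
have cK a : d_closed d (K a) by case: (hK a).
have KA a : K a `<=` sigma @^-1` [set a] by case: (hK a).
have mK a : measurable (K a) by exact: (d_closed_measurable dB).
have [|e e0 he] := closed_separated dP dK cK.
  by move=> a b x /KA <- /KA <-.
exists K, e; split => //; last by move=> x y Kx Ky; exact: he.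
apply: (@le_trans _ _ (\sum_a Pr nu (sigma @^-1` [set a] `\` K a))).
  apply: Pr_cover => [|a|x nK]; [|exact: measurableD|by exists (sigma x)].
  rewrite (_ : [set x | _] = \bigcap_(a in [set: S]) ~` (K a)).
    apply: fin_bigcap_measurable => [|a _]; [exact: finite_finset|exact: measurableC].
  apply/seteqP; split => x /= h; last by apply: h.
  by move=> a _ Ka; apply: h; rewrite (KA _ _ Ka).
apply: (@le_trans _ _ (\sum_(a : S) k / (#|S|%:R + 1))).
  by apply: ler_sum => a _; apply: ltW; case: (hK a).
rewrite sumr_const -[leLHS]mulr_natl mulrCA ler_piMr ?(ltW k0)// ler_pdivrMr ?ltr_wpDl//.
by rewrite mul1r lerDl.
Qed.

(** The order of the quantifiers matters: [e] decides the tracing accuracy and hence the size of the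
    cells [gam]; the cells decide the bound [Pm] on the transitions; the word length [n] comes last,
    so large that the count still has rate [c] when [n + Pm] steps are charged per word. *)
Lemma typical_tuples (s : seq (set X)) (c : R) (k : nat) (gs : 'I_k -> X -> R) (th : R) :
  meas_partition s -> c < h_part f nu s -> (forall j, rcont d (gs j)) -> 0 < th ->
  exists2 e : R, 0 < e & forall (C : finType) (gam : X -> C), mfin gam ->
    (forall x y, gam x = gam y -> forall j, `|gs j x - gs j y| <= th) ->
    forall Pm W : nat, exists (n M : nat) (T : finType) (Y : T -> 'I_M -> X),
    [/\ [/\ (W <= n)%N, (0 < n)%N & (0 < M)%N],
      (0 < #|T|)%N /\ (0 <= c -> expR (c * (M * (n + Pm))%:R) <= #|T|%:R),
      forall u v j, gam (Y u j) = gam (Y v j) /\ gam (iter n f (Y u j)) = gam (iter n f (Y v j)),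
      forall u v, u != v -> exists j i, (i < n)%N /\ e <= d (iter i f (Y u j)) (iter i f (Y v j)) &
      forall u i, `|\sum_j \sum_(t < n) gs i (iter t f (Y u j)) - (M * n)%:R * Int nu (gs i)| <=
        (M * n)%:R * (2 * th)].
Proof.
move=> ps hc cgs th0.
have [sigma [ms E]] := partition_symbol ps.
have Hc := Hjoin_cvg mf inv ps.
set S := 'I_(size s) in sigma ms E.
pose z := (h_part f nu s - c) / 8.
have z0 : 0 < z by rewrite divr_gt0// subr_gt0.
have [l [k0 [l0 l1 k00 hl hk]]] := hamming_parameters #|S| z0.
have k80 : 0 < k0 / 8 by rewrite divr_gt0.
have [K [e [e0 mK PK sepK]]] := separating_core ms k80.
exists e => // C gam mg gam_small Pm W.
pose bit x := `[< K (sigma x) x >].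
have mbit : mfin bit.
  have m1 : measurable (bit @^-1` [set true]).
    rewrite (_ : _ @^-1` _ = \bigcup_(a in [set: S]) (sigma @^-1` [set a] `&` K a)).
      apply: fin_bigcup_measurable => [|a _]; [exact: finite_finset|exact: measurableI].
    apply/seteqP; split => x /=; first by move/asboolP => h; exists (sigma x).
    by move=> [a _ [/= <- h]]; apply/asboolP.
  case=> //; rewrite (_ : _ @^-1` _ = ~` (bit @^-1` [set true])); first exact: measurableC.
  by apply/seteqP; split => x /=; case: (bit x).
(* The bit tells whether [sigma x] can be recovered from nearby points. *)
pose alpha x := (sigma x, bit x, gam x).
have malpha : mfin alpha by apply: mfin_pair => //; exact: mfin_pair.
pose cC : R := #|C|%:R.
have cC1 : 1 <= cC.
  by rewrite ler1n; apply/card_gt0P; exists (gam point).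
have [n [Wn n0 hH hC hP]] : exists n, [/\ (W <= n)%N, (0 < n)%N,
    n%:R * (c + 7 * z) < Hjoin f nu s n, 2 * cC ^+ 2 < expR (z * n%:R) & c * Pm%:R <= z * n%:R].
  have /cvgrPdist_lt/(_ _ z0)[N1 _ hN1] := Hc.
  pose N2 := (Num.truncn (2 * cC ^+ 2 / z)).+1.
  pose N3 := (Num.truncn (`|c * Pm%:R| / z)).+1.
  pose n := (W + N1 + N2 + N3)%N.
  have n0 : (0 < n)%N by rewrite /n addnS.
  have n0' : 0 < n%:R :> R by rewrite ltr0n.
  exists n; split => //.
  - by rewrite /n -!addnA leq_addr.
  - have /hN1 /= : (N1 <= n)%N by rewrite /n addnAC -!addnA addnCA leq_addr.
    rewrite ltr_norml => /andP[_ h]; rewrite mulrC -ltr_pdivlMr//.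
    have : h_part f nu s = c + 8 * z by rewrite /z; field.
    by move: h; lra.
  - have h : 2 * cC ^+ 2 / z <= n%:R.
      apply: ltW; apply: (lt_le_trans (truncnS_gt _)); rewrite ler_nat -/N2 /n.
      by rewrite addnAC leq_addl.
    rewrite ler_pdivrMr// mulrC [_ * z]mulrC in h.
    apply: (lt_le_trans _ (expR_ge1Dx _)); rewrite mulrC; apply: (le_lt_trans h).
    by rewrite ltrDr.
  - have h : `|c * Pm%:R| / z <= n%:R.
      by apply: ltW; apply: (lt_le_trans (truncnS_gt _)); rewrite ler_nat -/N3 /n leq_addl.
    rewrite ler_pdivrMr// in h; apply: (le_trans (ler_norm _)).
    by rewrite [leRHS]mulrC.
have n0' : 0 < n%:R :> R by rewrite ltr0n.
rewrite (Hjoin_word _ _ _ E) in hH.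
pose tau := word f alpha n; pose Q := {ffun 'I_n -> S * bool * C}.
have mtau : mfin tau by exact: mfin_word.
pose p := law nu tau.
have p0 q : 0 <= p q by exact: Pr_ge0.
have p1 : \sum_q p q = 1 by exact: Pr_sum1.
(* Words of positive mass are realised ([rep_pos]); a word without a point gets an arbitrary one. *)
have /choice[rep hrep] : forall q : Q, exists x, (exists y, tau y = q) -> tau x = q.
  move=> q; have [[y hy]|no] := pselect (exists y, tau y = q); first by exists y.
  by exists point.
have rep_tau x : tau (rep (tau x)) = tau x by apply: hrep; exists x.
have rep_pos q : 0 < p q -> tau (rep q) = q.
  move=> pq; apply: hrep; apply: contrapT => no; move: pq.
  rewrite /p /law (_ : tau @^-1` [set q] = set0) ?/Pr ?measure0 ?ltxx//.
  by apply/seteqP; split => // y /= hy; apply: no; exists y.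
pose wrd (q : Q) : {ffun 'I_n -> S} := [ffun t => (q t).1.1].
have wrd_tau : wrd \o tau = word f sigma n.
  by apply/funext => x; apply/ffunP => t; rewrite !ffunE.
have pwE w : word_mass p wrd w = Pr nu (word f sigma n @^-1` [set w]).
  by rewrite /word_mass (law_push nu wrd w mtau) wrd_tau.
pose gq (j : 'I_k) (q : Q) : R := n%:R^-1 * \sum_(t < n) gs j (iter t f (rep q)).
pose bq (q : Q) : R := n%:R^-1 * \sum_(t < n) (~~ (q t).1.2)%:R.
(* Information per letter of the [S]-word; its mean is exactly the entropy of words over [n]. *)
pose ell (q : Q) : R := - ln (word_mass p wrd (wrd q)) / n%:R.
pose G (i : option (option 'I_k)) q := match i with
  | Some (Some j) => gq j q | Some None => ell q | None => bq q end.
have mean_gq j : `|mean p (gq j) - Int nu (gs j)| <= th.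
  rewrite mean_law//.
  have bg : bmeas (gs j) by exact: (rcont_bmeas dP dB dK).
  rewrite -[X in _ - X](Int_birkhoff mf inv bg n0).
  apply: Int_dist_le; first exact: bmeas_fin.
    apply: bmeasZ; apply: bmeas_sum => t; apply: (bmeas_comp (g := gs j)) => //.
    exact: measurable_iter.
  move=> x; rewrite /gq -mulrBr -sumrB normrM normfV (ger0_norm (ler0n R _)) ler_pdivrMl//.
  apply: (le_trans (ler_norm_sum _ _ _)); apply: (@le_trans _ _ (\sum_(t < n) th)).
    apply: ler_sum => t _; apply: gam_small.
    by have /ffunP/(_ t) := rep_tau x; rewrite !ffunE => -[].
  by rewrite sumr_const card_ord mulr_natl.
have mean_bq : mean p bq <= k0 / 8.
  rewrite mean_law//; apply: le_trans PK.
  have mN : measurable [set x | ~ K (sigma x) x].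
    rewrite (_ : [set x | _] = bit @^-1` [set false]); first exact: mbit.
    by apply/seteqP; split => x /=; [move=> h; apply/asboolPn|move/asboolPn].
  have bN : bmeas (\1_[set x | ~ K (sigma x) x] : X -> R) by exact: bmeas_indic.
  rewrite -[leRHS]Int_indic// -(Int_birkhoff mf inv bN n0).
  rewrite le_eqVlt; apply/orP; left; apply/eqP; congr Int; apply/funext => x.
  rewrite /bq; congr (_ * _); apply: eq_bigr => t _; rewrite ffunE /= indicE; congr (_%:R).
  congr nat_of_bool; apply/idP/idP => [/asboolPn h|/set_mem /= h]; first exact/mem_set.
  exact/asboolPn.
have mean_ell : mean p ell = Hfun nu (word f sigma n) / n%:R.
  rewrite /mean /ell /Hfun (partition_big wrd predT) //= mulr_suml.
  apply: eq_bigr => w _; rewrite -pwE.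
  rewrite (eq_bigr (fun q => p q * (- ln (word_mass p wrd w) / n%:R))); last by move=> q /eqP ->.
  by rewrite -mulr_suml -/(word_mass p wrd w) /eta mulrA mulrN.
pose t := Num.min th (Num.min (k0 / 8) z).
have t0 : 0 < t by rewrite !lt_min th0 k80 z0.
have tth : t <= th by rewrite ge_min lexx.
have tk : t <= k0 / 8 by rewrite !ge_min lexx orbT.
have tz : t <= z by rewrite !ge_min lexx !orbT.
have [M M0 hM] := weak_law p0 p1 G t0.
have M0' : 0 < M%:R :> R by rewrite ltr0n.
exists n, M.
pose good (u : {ffun 'I_M -> Q}) :=
  [forall i, `|\sum_j G i (u j) - M%:R * mean p (G i)| <= M%:R * t].
pose pat (u : {ffun 'I_M -> Q}) : {ffun 'I_M -> C * C} :=
  [ffun j => (gam (rep (u j)), gam (iter n f (rep (u j))))].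
pose GG (pi : {ffun 'I_M -> C * C}) : {set {ffun 'I_M -> Q}} :=
  [set u | [&& good u, 0 < mass p u & pat u == pi]]%SET.
(* Pigeonhole: good tuples have mass at least 1/2, and the patterns, [cC ^+ 2] to the power [M] in
   number, are fewer than half of [expR (z * (M * n)%:R)]. *)
have [pi hpi] : exists pi, expR (- (z * (M * n)%:R)) <= \sum_(u in GG pi) mass p u.
  apply: contrapT => no.
  have h1 : \sum_pi \sum_(u in GG pi) mass p u <= (cC ^+ 2) ^+ M * expR (- (z * (M * n)%:R)).
    have -> : (cC ^+ 2) ^+ M = #|{ffun 'I_M -> C * C}|%:R.
      by rewrite card_ffun card_prod card_ord natrX natrM expr2.
    rewrite mulr_natl -sumr_const; apply: ler_sum => pi _.
    by rewrite leNgt; apply/negP => h; apply: no; exists pi; exact: ltW.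
  have h2 : \sum_(u | good u) mass p u <= \sum_pi \sum_(u in GG pi) mass p u.
    rewrite [leLHS]big_mkcond /= (exchange_big_dep xpredT) //=.
    apply: ler_sum => u _; case: ifP => gu; last by apply: sumr_ge0 => ? _; exact: mass_ge0.
    have [mu0|] := ltP 0 (mass p u); last first.
      by move=> /le_trans; apply; apply: sumr_ge0 => ? _; exact: mass_ge0.
    rewrite (bigD1 (pat u)) /=; last by rewrite finset.inE gu mu0 eqxx.
    by rewrite lerDl; apply: sumr_ge0 => ? _; exact: mass_ge0.
  have h3 : 2 * (cC ^+ 2) ^+ M < expR (z * (M * n)%:R).
    apply: (@le_lt_trans _ _ ((2 * cC ^+ 2) ^+ M)).
      rewrite [(2 * _) ^+ M]exprMn; apply: ler_wpM2r; first by rewrite !exprn_ge0// ler0n.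
      by rewrite -[X in X <= _]expr1; apply: ler_weXn2l => //; lra.
    rewrite (_ : z * (M * n)%:R = M%:R * (z * n%:R)); last by rewrite natrM; ring.
    rewrite expRM_natl ltrXn2r -?lt0n//.
    by rewrite mulr_ge0// exprn_ge0// ler0n.
  have h4 : (cC ^+ 2) ^+ M * expR (- (z * (M * n)%:R)) < 1 / 2.
    rewrite expRN ltr_pdivrMr ?expR_gt0//; move: h3; lra.
  have := le_trans hM (le_trans h2 h1); rewrite leNgt.
  by move/negP; apply.
pose Hn := Hfun nu (word f sigma n).
pose b := expR (- (M%:R * (Hn - n%:R * z))).
pose h := Num.truncn (k0 * (M * n)%:R).
pose close : rel {ffun 'I_M -> Q} := fun u v =>
  [forall j, [forall i : 'I_n, d (iter i f (rep (u j))) (iter i f (rep (v j))) < e]].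
have GGP u : u \in GG pi -> [/\ good u, forall j, 0 < p (u j) & pat u = pi].
  rewrite finset.inE => /and3P[gu mu0 /eqP pu]; split => // j.
  rewrite lt_def p0 andbT; apply/negP => /eqP pj; move: mu0.
  by rewrite /mass (bigD1 j) //= pj mul0r ltxx.
have goodP u i : good u -> `|\sum_j G i (u j) - M%:R * mean p (G i)| <= M%:R * t.
  by move/forallP/(_ i).
have pw_gt0 u j : u \in GG pi -> 0 < word_mass p wrd (wrd (u j)).
  move=> /GGP[_ /(_ j) pj _]; apply: (lt_le_trans pj).
  by rewrite /word_mass (bigD1 (u j)) //= lerDl; apply: sumr_ge0.
have Gb u : u \in GG pi -> \prod_j word_mass p wrd (wrd (u j)) <= b.
  move=> uG; have [gu _ _] := GGP u uG.
  have -> : \prod_j word_mass p wrd (wrd (u j)) = expR (- (n%:R * \sum_j ell (u j))).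
    rewrite mulr_sumr -sumrN expR_sum; apply: eq_bigr => j _.
    rewrite /ell mulrC divfK ?gt_eqF// opprK lnK// posrE; exact: pw_gt0.
  rewrite /b ler_expR lerN2.
  have := goodP u (Some None) gu; rewrite /G mean_ell ler_norml => /andP[h1 _].
  have h2 : M%:R * (Hn / n%:R - z) <= \sum_j ell (u j).
    have : M%:R * t <= M%:R * z by rewrite ler_pM2l.
    by move: h1; rewrite mulrBr -/Hn; lra.
  apply: (@le_trans _ _ (n%:R * (M%:R * (Hn / n%:R - z)))); last by rewrite ler_pM2l.
  rewrite le_eqVlt; apply/orP; left; apply/eqP.
  by field; rewrite gt_eqF.
pose bad (q : Q) : nat := #|[pred i : 'I_n | ~~ (q i).1.2]|.
have badE (q : Q) : (bad q)%:R = n%:R * bq q.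
  rewrite /bq mulVKf ?gt_eqF// -natr_sum; congr (_%:R).
  by rewrite /bad -sum1_card big_mkcond /=; apply: eq_bigr => i _; rewrite inE; case: ((q i).1.2).
have bad_sum u : u \in GG pi -> (\sum_j bad (u j))%:R <= k0 / 4 * (M * n)%:R.
  move=> uG; have [gu _ _] := GGP u uG.
  have -> : (\sum_j bad (u j))%:R = n%:R * \sum_j bq (u j).
    by rewrite natr_sum mulr_sumr; apply: eq_bigr => j _; exact: badE.
  have := goodP u None gu; rewrite /G ler_norml => /andP[_ h1].
  have h2 : \sum_j bq (u j) <= M%:R * (k0 / 4).
    have : M%:R * t <= M%:R * (k0 / 8) by rewrite ler_pM2l.
    have : M%:R * mean p bq <= M%:R * (k0 / 8) by rewrite ler_pM2l.
    by move: h1; lra.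
  by rewrite natrM [leRHS]mulrC [_ * n%:R]mulrC -mulrA ler_pM2l.
(* Letters of two close orbits can differ only at a time when one of them is outside the cores; the
   frequency test bounds the number of such times. *)
have Gc u v : u \in GG pi -> v \in GG pi -> close u v -> (tuple_hamming wrd u v <= h)%N.
  move=> uG vG /forallP cl; have [_ up _] := GGP u uG; have [_ vp _] := GGP v vG.
  have le1 : (tuple_hamming wrd u v <= \sum_j bad (u j) + \sum_j bad (v j))%N.
    rewrite -big_split /=; apply: leq_sum => j _.
    rewrite /hamming /bad; apply: leq_trans (_ :
        #|predU [pred i : 'I_n | ~~ (u j i).1.2] [pred i : 'I_n | ~~ (v j i).1.2]| <= _)%N; last first.
      by rewrite -cardUI leq_addr.
    apply: subset_leq_card; apply/fintype.subsetP => i; rewrite !inE => ne.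
    rewrite -negb_and; apply/negP => /andP[bu bv]; move/negP: ne; apply; apply/eqP.
    rewrite !ffunE.
    have eu := rep_pos _ (up j); have ev := rep_pos _ (vp j).
    move: bu bv; rewrite -eu -ev !ffunE /= => /asboolP bu /asboolP bv.
    apply: sepK => //.
    by have /forallP/(_ i) := cl j.
  rewrite /h truncn_ge_nat; last by rewrite mulr_ge0// ltW.
  apply: (@le_trans _ _ (\sum_j bad (u j) + \sum_j bad (v j))%:R); first by rewrite ler_nat.
  rewrite natrD; have := bad_sum u uG; have := bad_sum v vG.
  have : 0 <= k0 * (M * n)%:R by rewrite mulr_ge0// ltW.
  by lra.
have cr : reflexive close.
  by move=> u; apply/forallP => j; apply/forallP => i; rewrite (d_refl dP).
have cs : symmetric close.
  by move=> u v; apply/eq_forallb => j; apply/eq_forallb => i; rewrite (d_sym dP).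
have [T [TG sT hT]] := separated_count p0 l0 l1 (expR_gt0 _) cr cs Gb Gc.
have {}hT := le_trans hpi hT.
have lh : (l ^+ h)^-1 <= expR (z * (M * n)%:R).
  by apply: hk; rewrite truncn_le mulr_ge0// ltW.
have lS : (1 + #|S|%:R * l) ^+ (n * M) <= expR (z * (M * n)%:R).
  rewrite [z * _]mulrC [(n * M)%N]mulnC expRM_natl; apply: lerXn2r; rewrite ?nnegrE ?expR_ge0//.
  by rewrite addr_ge0// mulr_ge0// ltW.
have lh0 : 0 <= (l ^+ h)^-1 by rewrite invr_ge0 exprn_ge0// ltW.
have hT2 : expR (- (z * (M * n)%:R)) <= #|T|%:R * (b * expR (z * (M * n)%:R) * expR (z * (M * n)%:R)).
  apply: (le_trans hT); apply: ler_wpM2l => //.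
  apply: ler_pM => //.
  - by rewrite mulr_ge0// expR_ge0.
  - by rewrite exprn_ge0// addr_ge0// mulr_ge0// ltW.
  - by rewrite ler_pM2l ?expR_gt0.
pose ev (u : 'I_#|T|) : {ffun 'I_M -> Q} := enum_val u.
exists 'I_#|T|, (fun u j => rep (ev u j)).
have valG u : ev u \in GG pi by exact: (fintype.subsetP TG _ (enum_valP u)).
split.
- by split.
- rewrite card_ord; split.
    rewrite lt0n; apply/negP => /eqP T0; move: hT2.
    by rewrite T0 mul0r leNgt expR_gt0.
  move=> c0.
  move: hT2; rewrite /b -!expRD -ler_pdivrMr ?expR_gt0// -expRN -expRD.
  apply: le_trans; rewrite ler_expR.
  have e1 : M%:R * (n%:R * (c + 7 * z)) <= M%:R * Hn by rewrite ler_pM2l// ltW.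
  have e2 : M%:R * (c * Pm%:R) <= M%:R * (z * n%:R) by rewrite ler_pM2l.
  have e3 : 0 <= z * (M%:R * n%:R) by apply: mulr_ge0; [exact: ltW|exact: mulr_ge0].
  rewrite !natrM natrD; move: e1 e2 e3; lra.
- move=> u v j; have [_ _ pu] := GGP _ (valG u); have [_ _ pv] := GGP _ (valG v).
  by move: pu; rewrite -pv => /ffunP/(_ j); rewrite !ffunE => -[-> ->].
- move=> u v uv; have nc : ~~ close (ev u) (ev v).
    apply/negP => /(sT _ _ (enum_valP u) (enum_valP v)) E'.
    by move: uv; rewrite (enum_val_inj E') eqxx.
  move: nc; rewrite negb_forall => /existsP[j]; rewrite negb_forall => /existsP[i].
  by rewrite -leNgt => h'; exists j, i.
- move=> u i; have [gu _ _] := GGP _ (valG u).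
  have := goodP _ (Some (Some i)) gu; rewrite /G => h1.
  have -> : \sum_j \sum_(t1 < n) gs i (iter t1 f (rep (ev u j))) = n%:R * \sum_j gq i (ev u j).
    by rewrite mulr_sumr; apply: eq_bigr => j _; rewrite /gq mulVKf ?gt_eqF.
  have hA : `|\sum_j gq i (ev u j) - M%:R * Int nu (gs i)| <= M%:R * (2 * th).
    rewrite (_ : _ - _ = (\sum_j gq i (ev u j) - M%:R * mean p (gq i)) +
      M%:R * (mean p (gq i) - Int nu (gs i))); last by ring.
    apply: (le_trans (ler_normD _ _)); rewrite normrM (ger0_norm (ler0n R M)).
    have e1 : M%:R * `|mean p (gq i) - Int nu (gs i)| <= M%:R * th by rewrite ler_pM2l.
    have e2 : M%:R * t <= M%:R * th by rewrite ler_pM2l.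
    have := le_trans h1 e2; move: e1; lra.
  rewrite (_ : _ - _ = n%:R * (\sum_j gq i (ev u j) - M%:R * Int nu (gs i))); last first.
    by rewrite natrM; ring.
  rewrite normrM (ger0_norm (ler0n R n)); apply: (le_trans (ler_wpM2l (ler0n R n) hA)).
  rewrite le_eqVlt; apply/orP; left; apply/eqP; rewrite natrM; ring.
Qed.

End TypicalTuples.

(** * Lower bound *)

Section Blocks.
Context {R : realType}.

Lemma posS (n : nat) (tau : nat -> nat) (i : nat) : pos n tau i.+1 = (pos n tau i + (n + tau i))%N.
Proof. by rewrite /pos big_ord_recr. Qed.

Lemma sum_pos (n : nat) (tau : nat -> nat) (F : nat -> R) (M : nat) :
  \sum_(t < pos n tau M) F t = \sum_(j < M) \sum_(t < n + tau j) F (pos n tau j + t)%N.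
Proof.
elim: M => [|M IH]; first by rewrite /pos !big_ord0.
rewrite [RHS]big_ord_recr /= -IH; transitivity (\sum_(t < (pos n tau M + (n + tau M))%N) F t).
  by rewrite posS.
by rewrite big_split_ord.
Qed.

Lemma leq_pos (n : nat) (tau : nat -> nat) (i j : nat) : (i <= j)%N -> (pos n tau i <= pos n tau j)%N.
Proof. by move=> ij; rewrite /pos -(subnKC ij) big_split_ord /= leq_addr. Qed.

Lemma pos_periodic (n M : nat) (tau : nat -> nat) (k j : nat) : (forall i, tau (M + i)%N = tau i) ->
  pos n tau (k * M + j) = (k * pos n tau M + pos n tau j)%N.
Proof.
move=> per; elim: k => [//|k IH].
have S i : pos n tau (M + i) = (pos n tau M + pos n tau i)%N.
  by rewrite /pos big_split_ord /=; congr addn; apply: eq_bigr => l _; rewrite per.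
by rewrite !mulSn -!addnA S IH.
Qed.

(** The unfinished last block costs a constant, which disappears after division by [N]. *)
Lemma block_average (L : nat) (U : nat -> R) (e B : R) : (0 < L)%N -> 0 <= e -> 0 <= B ->
  (forall t, `|U t| <= B) -> (forall k, `|\sum_(t < L) U (k * L + t)%N| <= L%:R * e) ->
  forall N, `|\sum_(t < N) U t| <= N%:R * e + L%:R * B.
Proof.
move=> L0 e0 B0 UB Ub N.
rewrite (divn_eq N L); set q := (N %/ L)%N; set r := (N %% L)%N.
have rL : (r < L)%N by rewrite ltn_mod.
have hq : `|\sum_(t < q * L) U t| <= (q * L)%:R * e.
  elim: q => [|q IH]; first by rewrite mul0n big_ord0 normr0 mul0r.
  rewrite mulSn addnC big_split_ord /= natrD mulrDl.
  by apply: (le_trans (ler_normD _ _)); apply: lerD => //; exact: Ub.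
rewrite big_split_ord /=; apply: (le_trans (ler_normD _ _)); apply: lerD.
  by apply: (le_trans hq); rewrite ler_wpM2r// ler_nat leq_addr.
apply: (le_trans (ler_norm_sum _ _ _)); apply: (@le_trans _ _ (\sum_(t < r) B)).
  by apply: ler_sum => t _; exact: UB.
by rewrite sumr_const card_ord -[leLHS]mulr_natl ler_wpM2r// ler_nat ltnW.
Qed.

End Blocks.

Lemma ereal_dense {R : realType} (a b : \bar R) : (a < b)%E ->
  exists2 c : R, (a < c%:E)%E & (c%:E < b)%E.
Proof.
case: a => [a| |]; case: b => [b| |] //= ab.
- by exists ((a + b) / 2); rewrite lte_fin (midf_lt ab).
- by exists (a + 1); rewrite ?ltry// lte_fin ltrDl.
- by exists (b - 1); rewrite ?ltNyr// lte_fin gtrBl.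
- by exists 0; rewrite ?ltNyr ?ltry.
Qed.

Section LowerBound.
Context {dm : measure_display} {X : measurableType dm} {R : realType}.
Variable d : X -> X -> R.
Hypothesis dP : is_metric d.
Hypothesis dB : borel_sets d.
Hypothesis dK : d_compact d.
Variable phi : nat -> X -> R.
Hypothesis phiC : forall i, (0 < i)%N -> rcont d (phi i) /\ 0 < supnorm (phi i).
Variable f : X -> X.
Hypothesis fC : d_cont d f.
Variable nu : probability X R.
Hypothesis inv : f_invariant f nu.
Hypothesis ftr : top_transitive d f.
Hypothesis fpo : potp d f.

Let rb g : rcont d g -> bmeas g. Proof. exact: (rcont_bmeas dP dB dK). Qed.

Lemma Vpts_average (x : X) (mu : probability X R) (g : X -> R) (a e C : R) : rcont d g ->
  Vpts d f x mu -> (forall N, `|\sum_(t < N) (g (iter t f x) - a)| <= N%:R * e + C) ->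
  `|Int mu g - a| <= e.
Proof.
move=> cg Vmu h; apply/ler_addgt0Pr => e1 e10.
have e20 : 0 < e1 / 2 by rewrite divr_gt0.
pose N := (Num.truncn (C / (e1 / 2))).+1.
have [n [Nn n0 hn]] := Vmu 1%N (fun=> g) (fun=> cg) _ e20 N.
have := hn ord0; rewrite Int_empE; last exact: rb.
have n0' : 0 < n%:R :> R by rewrite ltr0n.
have h1 : `|n%:R^-1 * \sum_(t < n) g (iter t f x) - a| <= e + e1 / 2.
  rewrite (_ : _ - a = n%:R^-1 * \sum_(t < n) (g (iter t f x) - a)); last first.
    rewrite sumrB sumr_const card_ord mulrBr; congr (_ - _).
    by rewrite -[a *+ n]mulr_natl mulKf// gt_eqF.
  rewrite normrM normfV (ger0_norm (ler0n R n)) ler_pdivrMl//.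
  apply: (le_trans (h n)); rewrite mulrDr lerD2l.
  have : C / (e1 / 2) <= n%:R.
    by apply: ltW; apply: (lt_le_trans (truncnS_gt _)); rewrite ler_nat.
  by rewrite ler_pdivrMr.
move=> /= h2; rewrite -[Int mu g - a](subrKA (n%:R^-1 * \sum_(t < n) g (iter t f x))).
apply: (le_trans (ler_normD _ _)); rewrite distrC in h2.
rewrite (_ : e + e1 = e1 / 2 + (e + e1 / 2)); last by rewrite addrCA -splitr.
exact: lerD (ltW h2) h1.
Qed.

(** The tail of the series after [k] terms is below half the radius. Tests are shifted by one
    because the series starts at index 1. *)
Lemma Ball_of_tests (dl : R) : 0 < dl -> exists (k : nat) (th : R), 0 < th /\
  forall mu : probability X R,
    (forall j : 'I_k, `|Int mu (phi j.+1) - Int nu (phi j.+1)| <= th) -> Ball phi nu dl mu.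
Proof.
move=> dl0.
have [k hk] : exists k, 2 * 2^-1 ^+ k.+1 < dl / 2.
  have [|||k hk] := @exprn_small R 2^-1 (dl / 2); rewrite ?invr_ge0 ?divr_gt0//.
    by rewrite invf_lt1// ltr1n.
  by exists k; have := hk k (leqnn k); rewrite exprS mulrA divff// mul1r.
pose w i : R := (2 ^+ i.+1 * supnorm (phi i))^-1.
have w0 i : (0 < i)%N -> 0 <= w i.
  by move=> /phiC[_ s0]; rewrite invr_ge0 mulr_ge0 ?exprn_ge0// ltW.
pose S := \sum_(1 <= i < k.+1) w i.
have S0 : 0 <= S by rewrite /S big_nat sumr_ge0// => i /andP[i0 _]; exact: w0.
exists k, (dl / 2 / (S + 1)); split; first by rewrite !divr_gt0//; lra.
move=> mu hmu; rewrite /Ball /=.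
apply: (le_lt_trans (Dmetric_le dP dB dK phiC _ _ (ltn0Sn k))).
suff : Dpart phi nu mu k.+1 <= dl / 2 by move: hk; lra.
apply: (@le_trans _ _ (dl / 2 / (S + 1) * S)); last first.
  by rewrite mulrAC ler_pdivrMr ?ler_wpM2l//; lra.
rewrite /Dpart /S mulr_sumr big_nat [leRHS]big_nat; apply: ler_sum => i /andP[i0 ik].
rewrite /Dterm -/(w i); apply: ler_wpM2r; first exact: w0.
have ik' : (i.-1 < k)%N by rewrite prednK.
by have := hmu (Ordinal ik'); rewrite /= prednK// distrC.
Qed.

Lemma fine_cells (r : R) : 0 < r -> exists (C : finType) (gam : X -> C), mfin gam /\
  forall x y, gam x = gam y -> d x y < r.
Proof.
move=> r0; have [s [pps [sml _]]] := adapted_partition dP dB dK nu r0.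
have [gam [mg E]] := partition_symbol pps.
exists 'I_(size s), gam; split => // x y xy.
by apply: (sml (gam x)) => //; rewrite -E.
Qed.

Lemma lower_bound (s : seq (set X)) (c dl : R) : meas_partition s -> c < h_part f nu s -> 0 < dl ->
  (c%:E <= hB d f (Delta_sub d f (Ball phi nu dl)))%E.
Proof.
move=> pps hc dl0.
have [k [th4 [th40 hBall]]] := Ball_of_tests dl0.
(* Four shares: two for the typical tuples, one for tracing, one for the transitions. *)
pose th := th4 / 4; have th0 : 0 < th by rewrite divr_gt0.
pose gs (j : 'I_k) := phi j.+1.
have cgs j : rcont d (gs j) by case: (phiC (ltn0Sn j)).
have [e e0 typ] := typical_tuples dP dB dK fC inv pps hc cgs th0.
have [rho rho0 hrho] : exists2 rho : R, 0 < rho & forall j x y, d x y < rho -> `|gs j x - gs j y| <= th.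
  have /choice[r hr] : forall j, exists r : R, 0 < r /\ forall x y, d x y < r -> `|gs j x - gs j y| < th.
    by move=> j; have [r r0 h] := rcont_unif dP dK (cgs j) th0; exists r.
  exists (\big[Num.min/1]_j r j); first by apply: lt_bigmin => // j _; case: (hr j).
  move=> j x y xy; apply: ltW; apply: (hr j).2; apply: (lt_le_trans xy); exact: bigmin_le.
(* A quarter of [e] because two words are compared in four steps, through both shadowing points and
   the centre of the Bowen ball; [rho] controls the tests. *)
pose e' := Num.min (e / 4) rho.
have e'0 : 0 < e' by rewrite lt_min rho0 divr_gt0.
have e'e : e' <= e / 4 by rewrite ge_min lexx.
have e'r : e' <= rho by rewrite ge_min lexx orbT.
have [dlp dlp0 trace] := fpo e'0.
(* [transitions] yields jumps below [r + r], within the tracing tolerance; cells smaller than [rho]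
   hardly change the tests. *)
pose r := Num.min (dlp / 2) rho.
have r0 : 0 < r by rewrite lt_min rho0 divr_gt0.
have rr : r + r <= dlp.
  have : r <= dlp / 2 by rewrite ge_min lexx.
  by lra.
have [C [gam [mg gsml]]] := fine_cells r0.
have [tau [z htz]] := transitions dP r0 ftr gsml.
pose Pm := (\max_a \max_b tau a b)%N.
have tauP a b : (tau a b <= Pm)%N.
  apply: leq_trans (leq_bigmax a); exact: (leq_bigmax b).
have [B B0 hBd] : exists2 B : R, 0 < B & forall j x, `|gs j x| <= B.
  have /choice[b hb] : forall j, exists b : R, 0 < b /\ forall x, `|gs j x| <= b.
    by move=> j; have [b b0 h] := rcont_bounded dP dK (cgs j); exists b.
  exists (1 + \sum_j b j); first by apply: ltr_wpDr => //; apply: sumr_ge0 => j _; apply: ltW; case: (hb j).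
  move=> j x; apply: (le_trans ((hb j).2 x)); rewrite (bigD1 j) //= addrCA lerDl.
  by apply: addr_ge0 => //; apply: sumr_ge0 => i _; apply: ltW; case: (hb i).
(* For words this long, a transition changes the sum of a test by at most [th * n]. *)
pose W := (Num.truncn (2 * B * Pm%:R / th)).+1.
have [|n [M [T [Y [[Wn n0 M0] [T0 hT] patY sepY testY]]]]] := typ C gam mg _ Pm W.
  move=> x y /gsml xy j; apply: hrho; apply: (lt_le_trans xy); by rewrite ge_min lexx orbT.
have hPn : 2 * B * Pm%:R <= th * n%:R.
  have : 2 * B * Pm%:R / th <= n%:R.
    by apply: ltW; apply: (lt_le_trans (truncnS_gt _)); rewrite ler_nat.
  by rewrite ler_pdivrMr// [leRHS]mulrC.
(* All tuples share the initial and final cells of [u0], so the transitions computed from [u0] fit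
   every sequence [a], and the words of different sequences occupy the same times. *)
have /card_gt0P[u0 _] := T0.
pose jm i : 'I_M := Ordinal (ltn_pmod i M0).
pose y (a : nat -> T) i := Y (a (i %/ M)%N) (jm i).
pose st j := gam (Y u0 j); pose en j := gam (iter n f (Y u0 j)).
pose tr i := tau (en (jm i)) (st (jm i.+1)).
pose zz i := z (en (jm i)) (st (jm i.+1)).
have gst a i : gam (y a i) = st (jm i) by case: (patY (a (i %/ M)%N) u0 (jm i)).
have gen a i : gam (iter n f (y a i)) = en (jm i) by case: (patY (a (i %/ M)%N) u0 (jm i)).
have tr0 i : (0 < tr i)%N.
  by have [h _ _] := htz (iter n f (Y u0 (jm i))) (Y u0 (jm i.+1)).
have trP i : (tr i <= Pm)%N by exact: tauP.
have per i : tr (M + i)%N = tr i.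
  have E l : jm (M + l)%N = jm l by apply: val_inj; rewrite /= modnDl.
  by rewrite /tr -addnS !E.
(* Duration of a whole tuple with its transitions, including the one to the next tuple: the period
   of the time pattern. *)
pose L := pos n tr M.
have /choice[x hx] : forall a, exists x, forall j i, (i < n)%N ->
    d (iter (pos n tr j + i) f x) (iter i f (y a j)) < e'.
  move=> a; apply: (@glue _ X R d dP f n (y a) tr zz dlp) => //; first exact: ltW.
    move=> j; have [_ h _] := htz (iter n f (y a j)) (y a j.+1).
    by move: h; rewrite gen gst => h; apply: (le_trans (ltW h)).
  move=> j; have [_ _ h] := htz (iter n f (y a j)) (y a j.+1).
  by move: h; rewrite gen gst => h; apply: (le_trans (ltW h)).
have ykj a k' (j : 'I_M) : y a (k' * M + j)%N = Y (a k') j.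
  rewrite /y divnMDl// divn_small// addn0; congr (Y _ _).
  by apply: val_inj; rewrite /= modnMDl modn_small.
have posk k' (j : nat) : pos n tr (k' * M + j) = (k' * L + pos n tr j)%N by exact: pos_periodic.
have ML : (M * n <= L)%N.
  rewrite /L /pos -[X in (X * n)%N](card_ord M) -sum_nat_const; apply: leq_sum => j _.
  exact: leq_addr.
have LM : (L <= M * (n + Pm))%N.
  rewrite /L /pos -[X in (X * _)%N](card_ord M) -sum_nat_const; apply: leq_sum => j _.
  by rewrite leq_add2l.
have L0 : (0 < L)%N by apply: leq_trans ML; rewrite muln_gt0 M0.
have xD a : Delta_sub d f (Ball phi nu dl) (x a).
  move=> mu Vmu; apply: hBall => j; rewrite -/(gs j).
  apply: (@Vpts_average (x a) mu (gs j) (Int nu (gs j)) th4 (L%:R * (2 * B)) (cgs j) Vmu).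
  have IB : `|Int nu (gs j)| <= B.
    have := @Int_dist_le _ X R nu (gs j) (fun=> 0) B (rb (cgs j)) (bmeas_cst 0).
    by rewrite Int_cst subr0; apply => v; rewrite subr0.
  have UB v : `|gs j v - Int nu (gs j)| <= 2 * B.
    by apply: (le_trans (ler_normB _ _)); have := hBd j v; move: IB; lra.
  apply: (@block_average R L (fun t => gs j (iter t f (x a)) - Int nu (gs j)) th4 (2 * B)
    L0 (ltW th40)) => [||k']; first by rewrite mulr_ge0// ltW.
    by move=> t; exact: UB.
  rewrite /L (sum_pos n tr (fun t => gs j (iter (k' * pos n tr M + t) f (x a)) - Int nu (gs j))) -/L.
  under eq_bigr do rewrite big_split_ord /=.
  rewrite big_split /=; apply: (le_trans (ler_normD _ _)).
  have h1 : `|\sum_(i < M) \sum_(t < n) (gs j (iter (k' * L + (pos n tr i + t)) f (x a)) - Int nu (gs j))| <=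
      3 * th * (M * n)%:R.
    rewrite (_ : \sum_(i < M) _ = \sum_(i < M) \sum_(t < n)
        (gs j (iter (k' * L + (pos n tr i + t)) f (x a)) - gs j (iter t f (Y (a k') i))) +
      (\sum_(i < M) \sum_(t < n) gs j (iter t f (Y (a k') i)) - (M * n)%:R * Int nu (gs j))); last first.
      have -> : (M * n)%:R * Int nu (gs j) = \sum_(i < M) \sum_(t < n) Int nu (gs j).
        by rewrite !sumr_const !card_ord -mulrnA mulr_natl mulnC.
      rewrite -sumrB -big_split /=; apply: eq_bigr => i _.
      by rewrite -sumrB -big_split /=; apply: eq_bigr => t _; rewrite addrA subrK.
    apply: (le_trans (ler_normD _ _)).
    have h2 := testY (a k') j.
    have h3 : `|\sum_(i < M) \sum_(t < n)
        (gs j (iter (k' * L + (pos n tr i + t)) f (x a)) - gs j (iter t f (Y (a k') i)))| <= (M * n)%:R * th.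
      apply: (le_trans (ler_norm_sum _ _ _)).
      apply: (@le_trans _ _ (\sum_(i < M) \sum_(t < n) th)).
        apply: ler_sum => i _; apply: (le_trans (ler_norm_sum _ _ _)); apply: ler_sum => t _.
        apply: hrho; apply: (lt_le_trans _ e'r).
        by have := hx a (k' * M + i)%N t (ltn_ord t); rewrite ykj posk addnA.
      by rewrite !sumr_const !card_ord -mulrnA mulr_natl mulnC.
    apply: (le_trans (lerD h3 h2)); lra.
  have h4 : `|\sum_(i < M) \sum_(t < tr i)
      (gs j (iter (k' * L + (pos n tr i + (n + t))) f (x a)) - Int nu (gs j))| <= th * (M * n)%:R.
    apply: (le_trans (ler_norm_sum _ _ _)).
    apply: (@le_trans _ _ (\sum_(i < M) th * n%:R)); last first.
      by rewrite sumr_const card_ord -mulr_natl natrM; lra.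
    apply: ler_sum => i _; apply: le_trans hPn.
    apply: (le_trans (ler_norm_sum _ _ _)); apply: (@le_trans _ _ (\sum_(t < tr i) 2 * B)).
      by apply: ler_sum => t _; exact: UB.
    by rewrite sumr_const card_ord -[leLHS]mulr_natr ler_wpM2l ?ler_nat// mulr_ge0// ltW.
  apply: (le_trans (lerD h1 h4)).
  have : (M * n)%:R <= L%:R :> R by rewrite ler_nat.
  rewrite -(ler_pM2l th40) [leRHS]mulrC => /(le_trans _); apply.
  by rewrite /th; lra.
(* The tree estimate is stated for nonnegative rates; when [c <= 0] the rate 0 does, as [T] is
   nonempty. *)
pose sc := Num.max c 0.
have sc0 : 0 <= sc by rewrite le_max lexx orbT.
have scT : expR (sc * L%:R) <= #|T|%:R.
  rewrite /sc; case: (leP c 0) => c0; first by rewrite mul0r expR0 ler1n.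
  apply: (le_trans _ (hT (ltW c0))); rewrite ler_expR ler_pM2l// ler_nat.
  exact: LM.
have sep (a b : nat -> T) k' w m : a k' != b k' -> (k'.+1 * L <= m)%N ->
    Bn d f m w e' (x a) -> Bn d f m w e' (x b) -> False.
  move=> ab km ha hb; have [j [i [i_n hij]]] := sepY _ _ ab.
  pose t := (pos n tr (k' * M + j) + i)%N.
  have tm : (t < m)%N.
    apply: leq_trans km; rewrite /t posk mulSn [(L + _)%N]addnC -addnA ltn_add2l.
    apply: (@leq_trans (pos n tr j.+1)); last exact: leq_pos.
    by rewrite posS ltn_add2l (leq_trans i_n)// leq_addr.
  have near a' : Bn d f m w e' (x a') -> d (iter t f w) (iter t f (x a')) < e'.
    by apply: le_lt_trans; exact: (le_bigmax _ (fun l : 'I_m => d (iter l f w) (iter l f (x a'))) (Ordinal tm)).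
  have h1 := hx a (k' * M + j)%N i i_n; have h2 := hx b (k' * M + j)%N i i_n.
  rewrite ykj -/t in h1; rewrite ykj -/t in h2.
  have h3 := near a ha; have h4 := near b hb.
  have := d_tri dP (iter i f (Y (a k') j)) (iter t f (x a)) (iter i f (Y (b k') j)).
  have := d_tri dP (iter t f (x a)) (iter t f w) (iter i f (Y (b k') j)).
  have := d_tri dP (iter t f w) (iter t f (x b)) (iter i f (Y (b k') j)).
  rewrite (d_sym dP (iter t f (x a)) (iter t f w)) (d_sym dP (iter i f (Y (a k') j)) (iter t f (x a))).
  move: h1 h2 h3 h4 hij e'e; lra.
apply: (@le_trans _ _ sc%:E); first by rewrite lee_fin le_max lexx.
apply: (le_trans (tree_htopZ u0 L0 sc0 scT xD sep)).
exact: htopZ_le_hB.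
Qed.

End LowerBound.

(** * Comparison of the limit with the entropy *)

Theorem theorem2p3 (dm : measure_display) (X : measurableType dm) (R : realType)
  (d : X -> X -> R) (f : X -> X) (phi : nat -> X -> R) :
  is_metric d -> borel_sets d -> d_compact d -> d_cont d f ->
  (forall i, (0 < i)%N -> rcont d (phi i) /\ 0 < supnorm (phi i)) ->
  dense_seq d phi ->
  top_transitive d f -> potp d f ->
  forall nu : probability X R, f_invariant f nu ->
  usc_entropy d f ->
  hB d f (Delta_sub d f (Ball phi nu dl)) @[dl --> 0^'+] --> h_mu f nu.
Proof.
move=> dP dB dK fC phiC phiD ftr fpo nu inv usc.
have mono (dl1 dl2 : R) : dl1 <= dl2 -> (hB d f (Delta_sub d f (Ball phi nu dl1)) <=
    hB d f (Delta_sub d f (Ball phi nu dl2)))%E.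
  move=> h12; apply: hB_mono => x hx mu /hx; rewrite /Ball /= => h; exact: lt_le_trans h h12.
pose F (dl : R) := hB d f (Delta_sub d f (Ball phi nu dl)).
(* The sets shrink with [dl], so the limit is an infimum: the lower bound is used at every radius,
   the upper bound at one. *)
have cv : F dl @[dl --> 0^'+] --> ereal_inf [set F dl | dl in `]0%R, +oo[].
  apply: nondecreasing_at_right_cvge; last by move=> dl1 dl2 _ _; exact: mono.
  by [].
rewrite (_ : h_mu f nu = ereal_inf [set hB d f (Delta_sub d f (Ball phi nu dl)) | dl in `]0%R, +oo[])//.
apply/eqP; rewrite eq_le; apply/andP; split.
  apply: le_ereal_inf_tmp => _ [dl dl0 <-]; move: dl0; rewrite /= in_itv /= andbT => dl0.
  apply: ge_ereal_sup => _ [s pps <-]; apply/lee_subgt0Pr => t t0.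
  rewrite -EFinB; apply: (lower_bound dP dB dK phiC fC inv ftr fpo pps) => //.
  by rewrite gtrBl.
rewrite leNgt; apply/negP => lt.
have [c hc1 hc2] := ereal_dense lt.
have [dl dl0 hdl] := upper_bound dP dB dK phiC phiD fC inv usc hc1.
have : (c%:E < c%:E)%E.
  apply: (lt_le_trans hc2); apply: le_trans hdl; apply: ereal_inf_lbound.
  by exists dl => //; rewrite /= in_itv /= andbT.
by rewrite ltxx.
Qed.
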